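(* Let $\mathfrak{g}=\mathfrak{gl}(n,\mathbb{C})$ or $\mathfrak{so}(n,\mathbb{C})$. An element $x\in\mathfrak{g}$ is strongly regular if and only if $$\mathfrak{z}_{\mathfrak{g}_i}(x_i)\cap\mathfrak{z}_{\mathfrak{g}_{i+1}}(x_{i+1})=0\quad\text{for } i=1,\dots,n-1.$$
   Context: Consider the chain of subalgebras $\mathfrak{g}_1\subset\mathfrak{g}_2\subset\dots\subset\mathfrak{g}_{n-1}\subset\mathfrak{g}_n=\mathfrak{g}$, where: if $\mathfrak{g}=\mathfrak{gl}(n,\mathbb{C})$, $\mathfrak{g}_i=\mathfrak{gl}(i,\mathbb{C})$ embedded as the upper left $i\times i$ corner; if $\mathfrak{g}=\mathfrak{so}(n,\mathbb{C})$, $\mathfrak{g}_i=\mathfrak{so}(i,\mathbb{C})$, where $\mathfrak{so}(i,\mathbb C)\subset\mathfrak{so}(i+1,\mathbb C)$ is the annihilator of a non-isotropic vector (equivalently, there is a chain of nondegenerate subspaces $V_1\subset V_2\subset\dots\subset V_n=\mathbb{C}^n$, $\dim V_i=i$, and $\mathfrak{g}_i$ consists of the elements of $\mathfrak{g}$ annihilating $V_i^\perp$). Let $G_i\subset G$ be the corresponding connected algebraic group, and $r_i$ the rank of $\mathfrak{g}_i$ ($i$ for $\mathfrak{gl}(i,\mathbb{C})$, $\lfloor i/2\rfloor$ for $\mathfrak{so}(i,\mathbb{C})$). Let $\pi_i:\mathfrak{g}\to\mathfrak{g}_i$ be the projection along $\mathfrak{g}_i^{\perp}$ (orthogonal complement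 with respect to the trace form), and $x_i:=\pi_i(x)$. Let $\mathbb{C}[\mathfrak{g}_i]^{G_i}=\mathbb{C}[\psi_{i,1},\dots,\psi_{i,r_i}]$ be the (polynomial) ring of $\mathrm{Ad}(G_i)$-invariant polynomials on $\mathfrak{g}_i$, with algebraically independent generators $\psi_{i,j}$, and let $f_{i,j}=\pi_i^*\psi_{i,j}$. The Gelfand-Zeitlin functions are $J_{GZ}=\{f_{i,j}: i=1,\dots,n;\ j=1,\dots,r_i\}$. An element $x\in\mathfrak{g}$ is called strongly regular if the differentials $\{df_{i,j}(x): i=1,\dots,n;\ j=1,\dots,r_i\}\subset T_x^*(\mathfrak{g})$ are linearly independent. $\mathfrak{z}_{\mathfrak{g}_i}(x_i)$ is the centralizer of $x_i$ in $\mathfrak{g}_i$, viewed as a subalgebra of $\mathfrak{g}$. *)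

(* Defs.v *)
From HB Require Import structures.
From mathcomp Require Import all_boot all_order all_algebra.
From mathcomp Require Export complex mpoly reals.

Set Implicit Arguments.
Unset Strict Implicit.
Unset Printing Implicit Defensive.

Import GRing.Theory.
Local Open Scope ring_scope.

Lemma mem_lker_linfun (F : fieldType) (aT rT : vectType F)
    (f : {linear aT -> rT}) (v : aT) :
  (v \in lker (linfun f)) = (f v == 0).
Proof. by rewrite memv_ker lfunE. Qed.

Lemma mem_bigcap_vbasis (F : fieldType) (uT vT : vectType F) (W : {vspace uT})
    (K : uT -> {vspace vT}) (v : vT) :
  reflect (forall w, w \in (vbasis W : seq uT) -> v \in K w)
          (v \in (\bigcap_(w <- vbasis W) K w)%VS).
Proof.
elim: (tval (vbasis W)) => [|a s IHs].
  by rewrite big_nil memvf; constructor.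
rewrite big_cons memv_cap; apply: (iffP andP).
  by case=> Ka /IHs Ks w; rewrite inE => /orP[/eqP-> // | /Ks].
move=> Kas; split; first by apply: Kas; rewrite mem_head.
by apply/IHs=> w sw; apply: Kas; rewrite inE sw orbT.
Qed.

Section PolynomialFunctions.
Variables (F : fieldType) (vT : vectType F).
Implicit Types U W : {vspace vT}.

(* The algebra F[U] of polynomial functions on the vector space U, as the     *)
(* polynomials in the coordinates with respect to the basis vbasis U.         *)
Definition polyfun U := {mpoly F[\dim U]}.

Definition peval U (p : polyfun U) (v : vT) : F :=
  p.@[fun k => coord (vbasis U) k v].

(* dp(x), an element of the dual space of U (the cotangent space of U at x).  *)
Definition differential U (p : polyfun U) (x : vT) : 'Hom(subvs_of U, F^o) :=
  linfun (fun y : subvs_of U =>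
    \sum_(k < \dim U) peval p^`M(k) x * coord (vbasis U) k (vsval y) : F^o).

Lemma differentialE U (p : polyfun U) (x : vT) (y : subvs_of U) :
  differential p x y =
  \sum_(k < \dim U) peval p^`M(k) x * coord (vbasis U) k (vsval y).
Proof.
pose f (z : subvs_of U) : F^o :=
  \sum_(k < \dim U) peval p^`M(k) x * coord (vbasis U) k (vsval z).
have lf : linear f.
  move=> a u v; rewrite /f scaler_sumr -big_split /=; apply: eq_bigr => k _.
  by rewrite linearP /= mulrDr mulrCA.
pose fL := GRing.isLinear.Build F (subvs_of U) F^o *:%R f lf.
pose f' : {linear subvs_of U -> F^o} := HB.pack f fL.
by rewrite /differential -/f (lfunE f').
Qed.

(* f^* : F[W] -> F[U] for a linear map f that sends U into W.                 *)
Definition pullback U W (f : 'End(vT)) (p : polyfun W) : polyfun U :=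
  p \mPo [tuple \sum_(l < \dim U)
                  coord (vbasis W) k (f (vbasis U)`_l) *: 'X_l | k < \dim W].

Lemma pullbackE U W (f : 'End(vT)) (p : polyfun W) (x : vT) :
  x \in U -> peval (pullback U f p) x = peval p (f x).
Proof.
move=> Ux; rewrite /peval /pullback comp_mpoly_meval; apply: meval_eq => k.
rewrite tnth_mktuple raddf_sum {2}(coord_vbasis Ux) linear_sum linear_sum /=.
by apply: eq_bigr => l _; rewrite mevalZ mevalXU !linearZ /= mulrC.
Qed.

End PolynomialFunctions.

Section LieSubalgebras.
Variables (F : fieldType) (n : nat).
Local Notation M := 'M[F]_n.
Implicit Types (g h : {vspace M}) (x y z : M).

Definition lie x y : M := x *m y - y *m x.

Lemma lie_is_linear x : linear (lie x).
Proof.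
move=> a y z; rewrite /lie mulmxDr mulmxDl -scalemxAr -scalemxAl.
by rewrite scalerBr opprD addrACA.
Qed.
HB.instance Definition _ x := GRing.isLinear.Build F M M *:%R (lie x)
  (lie_is_linear x).

Definition liecent h x : {vspace M} := (h :&: lker (linfun (lie x)))%VS.

Lemma mem_liecent h x y : (y \in liecent h x) = (y \in h) && (lie x y == 0).
Proof. by rewrite memv_cap mem_lker_linfun. Qed.

Definition trform x y : F^o := \tr (x *m y).

Lemma trform_is_linear x : linear (trform x).
Proof. by move=> a y z; rewrite /trform mulmxDr -scalemxAr linearP. Qed.
HB.instance Definition _ x := GRing.isLinear.Build F M F^o *:%R (trform x)
  (trform_is_linear x).

(* The orthogonal complement of h in g for the trace form.                    *)
Definition trperp g h : {vspace M} :=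
  (g :&: \bigcap_(z <- vbasis h) lker (linfun (trform z)))%VS.

Lemma mem_trperp g h y :
  reflect (y \in g /\ forall z, z \in h -> \tr (z *m y) = 0) (y \in trperp g h).
Proof.
rewrite memv_cap; apply: (iffP andP) => -[gy]; last first.
  move=> hy; split=> //; apply/mem_bigcap_vbasis => z /vbasis_mem hz.
  by rewrite mem_lker_linfun; apply/eqP/hy.
move/mem_bigcap_vbasis=> hy; split=> // z /coord_vbasis->.
rewrite mulmx_suml linear_sum big1 //= => k _.
have /hy : (vbasis h)`_k \in (vbasis h : seq M) by rewrite mem_nth ?size_tuple.
rewrite mem_lker_linfun /= => /eqP hk.
by rewrite -scalemxAl mxtraceZ [\tr _]hk mulr0.
Qed.

(* The projection onto h along its trace-form complement in g; daddv_pi is    *)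
(* the projection attached to a direct sum, and h (+) trperp g h = g whenever *)
(* the trace form is nondegenerate on h.                                      *)
Definition trproj g h : 'End(M) := daddv_pi h (trperp g h).

(* A group of invertible matrices is given by its membership predicate.       *)
Definition Ad_invariant (G : M -> Prop) h (p : polyfun h) : Prop :=
  forall a y, G a -> y \in h -> peval p (a *m y *m invmx a) = peval p y.

(* F[h]^G is generated as an F-algebra by psi, which is algebraically         *)
(* independent over F.                                                        *)
Definition free_generators (G : M -> Prop) h r (psi : r.-tuple (polyfun h)) :
    Prop :=
  (forall p : polyfun h,
     Ad_invariant G p <-> exists q : {mpoly F[r]}, p = q \mPo psi)
  /\ (forall q : {mpoly F[r]}, q \mPo psi = 0 -> q = 0).

(* From here on, g 1, ..., g n is a chain of subalgebras with top g n; the    *)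
(* value g 0 plays no role.                                                   *)
Definition gz_proj (g : nat -> {vspace M}) (i : nat) : 'End(M) :=
  trproj (g n) (g i).

Definition gz_functions (g : nat -> {vspace M}) (r : nat -> nat)
    (psi : forall i, (r i).-tuple (polyfun (g i))) : seq (polyfun (g n)) :=
  [seq pullback (g n) (gz_proj g i) p | i <- iota 1 n, p <- psi i].

Definition strongly_regular (g : nat -> {vspace M}) (r : nat -> nat)
    (psi : forall i, (r i).-tuple (polyfun (g i))) x : bool :=
  free [seq differential f x | f <- gz_functions psi].

End LieSubalgebras.

Section GeneralLinear.
Variables (F : fieldType) (n : nat).
Local Notation M := 'M[F]_n.

(* gl(i), as the upper left corner of gl(n).                                  *)
Definition gl_corner (i : nat) : {vspace M} :=
  (\sum_(k < n | (k < i)%N) \sum_(l < n | (l < i)%N) <[delta_mx k l]>)%VS.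

Lemma mem_gl_corner (i : nat) (x : M) :
  reflect (forall k l : 'I_n, ~~ ((k < i) && (l < i))%N -> x k l = 0)
          (x \in gl_corner i).
Proof.
apply: (iffP idP) => [|x0].
  case/memv_sumP=> u Eu -> k l kl; rewrite summxE big1 // => k' k'i.
  case/memv_sumP: (Eu k' k'i) => v Ev ->; rewrite summxE big1 // => l' l'i.
  case/vlineP: (Ev l' l'i) => a ->; rewrite !mxE.
  case: eqP => [Ek|]; case: eqP => [El|]; rewrite ?mulr0 //.
  by rewrite Ek El k'i l'i in kl.
rewrite (matrix_sum_delta x); apply: memv_suml => k _; apply: memv_suml => l _.
case kl: ((k < i) && (l < i))%N; last by rewrite x0 ?kl // scale0r mem0v.
case/andP: kl => ki li; apply: memvZ.
apply: (subvP (sumv_sup k ki (subvv _))).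
exact: (subvP (sumv_sup l li (subvv _))) (memv_line _).
Qed.

(* GL(i), acting on the first i basis vectors and fixing the others.          *)
Definition GL_corner (i : nat) (a : M) : Prop :=
  a \in unitmx /\
  forall k l : 'I_n, ~~ ((k < i) && (l < i))%N -> a k l = (k == l)%:R.

End GeneralLinear.

Section Orthogonal.
Variables (F : fieldType) (n : nat).
Local Notation M := 'M[F]_n.
Local Notation V := 'cV[F]_n.
(* B is the Gram matrix of the bilinear form (v, w) |-> v^T B w on V.         *)
Implicit Types (B x a : M) (W : {vspace V}).

Definition orthov B W : {vspace V} :=
  (\bigcap_(w <- vbasis W) lker (linfun (mulmx (w^T *m B))))%VS.

Lemma mem_orthov B W (v : V) :
  reflect (forall w, w \in W -> w^T *m B *m v = 0) (v \in orthov B W).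
Proof.
apply: (iffP (mem_bigcap_vbasis _ _ _)) => Wv w.
  move=> /coord_vbasis->; rewrite linear_sum !mulmx_suml big1 // => k _.
  have /Wv : (vbasis W)`_k \in (vbasis W : seq V).
    by rewrite mem_nth ?size_tuple.
  rewrite mem_lker_linfun linearZ -!scalemxAl => /eqP /= ->.
  by rewrite scaler0.
by move=> /vbasis_mem/Wv; rewrite mem_lker_linfun => /eqP.
Qed.

Definition skew B x : M := x^T *m B + B *m x.

Lemma skew_is_linear B : linear (skew B).
Proof.
move=> a x y; rewrite /skew linearP /= mulmxDl mulmxDr -scalemxAr -scalemxAl.
by rewrite scalerDr addrACA.
Qed.
HB.instance Definition _ B := GRing.isLinear.Build F M M *:%R (skew B)
  (skew_is_linear B).

(* so(W), for W nondegenerate, as the elements of so(B) that annihilate the   *)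
(* orthogonal complement of W.                                                *)
Definition so_sub B W : {vspace M} :=
  (lker (linfun (skew B))
   :&: \bigcap_(v <- vbasis (orthov B W)) lker (linfun (mulmxr v)))%VS.

Lemma mem_so_sub B W x :
  reflect (x^T *m B + B *m x = 0 /\ forall v, v \in orthov B W -> x *m v = 0)
          (x \in so_sub B W).
Proof.
rewrite memv_cap mem_lker_linfun; apply: (iffP andP) => -[xB].
  move=> /mem_bigcap_vbasis xW; split=> [|v /coord_vbasis->]; first exact/eqP.
  rewrite mulmx_sumr big1 // => k _.
  have /xW : (vbasis (orthov B W))`_k \in (vbasis (orthov B W) : seq V).
    by rewrite mem_nth ?size_tuple.
  by rewrite mem_lker_linfun -scalemxAr => /eqP /= ->; rewrite scaler0.
move=> xW; split; first exact/eqP.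
apply/mem_bigcap_vbasis=> v /vbasis_mem/xW xv.
by rewrite mem_lker_linfun /= xv.
Qed.

(* SO(W), the connected group with Lie algebra so(W).                         *)
Definition SO_sub B W a : Prop :=
  [/\ a^T *m B *m a = B, \det a = 1
    & forall v, v \in orthov B W -> a *m v = v].

Definition nondegenerate_flag B (W : nat -> {vspace V}) : Prop :=
  (forall i, (1 <= i <= n)%N ->
     \dim (W i) = i /\ (W i :&: orthov B (W i) = 0)%VS)
  /\ (forall i, (1 <= i < n)%N -> (W i <= W i.+1)%VS).

End Orthogonal.

(* Main.v *)
Require Import Defs.
From HB Require Import structures.
From mathcomp Require Import all_boot all_order all_fingroup all_algebra separable.
From mathcomp Require Import ring zify.
Set Implicit Arguments.
Unset Strict Implicit.
Unset Printing Implicit Defensive.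
Import Order.TTheory GRing.Theory Num.Theory.
Local Open Scope ring_scope.

(* Kostant's criterion, applied to each g_i: the gradients at y in g_i of     *)
(* free generators of the invariants (for the trace form) lie in the          *)
(* centralizer z(y), dim z(y) >= r_i, and the gradients are linearly          *)
(* independent iff dim z(y) = r_i. Hence, if x is strongly regular, the       *)
(* gradients at x_i form a basis of z_i := z(x_i), and their independence     *)
(* for all i makes the z_i independent. Conversely, an element of z_(i+1)     *)
(* that lies in g_i lies in z_i; so if consecutive z_i meet trivially, the    *)
(* sum of all z_i is direct. As this sum is isotropic for the alternating     *)
(* form (y, z) |-> tr (x [y, z]), whose radical in g is z_n, its dimension is *)
(* at most (dim g + dim z_n) / 2, and dim g = 2 (r_1 + ... + r_(n-1)) + r_n   *)
(* forces dim z_i = r_i for all i.                                            *)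
(*                                                                            *)
(* Kostant's criterion itself follows from an identity between polynomials    *)
(* in x: the determinant of ad x bordered by r vectors u_k is, up to a        *)
(* nonzero constant, the square of det (df_j(x)(u_k)). On a Cartan subalgebra *)
(* it says that the Jacobian of the basic invariants is, up to sign, the      *)
(* product of the positive roots; both sides are invariant under conjugation, *)
(* and on a suitable line through any x all but finitely many points are      *)
(* conjugate into the Cartan subalgebra.                                      *)

(** * Polynomial functions along lines *)

(** Strong regularity is first turned into a statement about vectors. The trace form is
    nondegenerate on each g_i, so [grad p y] represents dp(y). The projection onto g_i is
    orthogonal, so the differential at [x] of a pulled-back invariant is represented by the gradient
    at x_i itself ([strongly_regular_grads]). Hence [x] is strongly regular iff all these gradients
    are linearly independent in g.

    The chain argument, [strongly_regular_iff], uses only [kostant_property] for each g_i and the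
    value of dim g_n. [free_gz_grads] passes from independence at each level to independence
    overall, and [dim_z_of_cap0] is the dimension count that forces dim z_i = r_i.

    [kostant_of_cartan] derives [kostant_property] from a Cartan subalgebra with root vectors, the
    Jacobian of the basic invariants on it, Chevalley restriction and a density statement. Its
    centre is [bordered_jac]. Border vectors u_1, ..., u_r with nonzero bordered determinant exist
    iff dim z(x) = r, vectors with nonzero Jacobian determinant exist iff the gradients are
    independent, and the two determinants vanish together. Density is used only along lines: a
    polynomial in t that vanishes off the roots of a nonzero polynomial also vanishes at t = 0.

    [kostant_model] carries this over to m x m matrix algebras embedded in n x n matrices. For gl
    the invariants are coefficients of the characteristic polynomial, and their Jacobian is a
    Vandermonde determinant. For so the form is brought to an antidiagonal Gram matrix, so that a
    Cartan subalgebra is diagonal with spectrum symmetric under negation. The invariants are then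
    elementary symmetric functions of the squares; for even m the Pfaffian replaces the determinant,
    since the Weyl group changes only an even number of signs ([so_chevalley], [so_jacobian],
    [so_density]). *)

Section PolynomialIdentities.
Variable F : numFieldType.

Lemma horner_eq0_poly (p : {poly F}) : (forall t, p.[t] = 0) -> p = 0.
Proof.
move=> p0; apply/eqP/negPn/negP => pN0.
pose rs := [seq i%:R : F | i <- iota 0 (size p)].
have rs_uniq : uniq rs.
  rewrite map_inj_uniq ?iota_uniq // => i j /eqP.
  by rewrite eqr_nat => /eqP.
have rs_root : all (root p) rs by apply/allP => z _; apply/rootP.
by have := max_poly_roots pN0 rs_root rs_uniq; rewrite size_map size_iota ltnn.
Qed.

Lemma horner_eq0_generic (d p : {poly F}) : d != 0 ->
  (forall t, d.[t] != 0 -> p.[t] = 0) -> p = 0.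
Proof.
move=> dN0 dp; apply/eqP; have : d * p = 0.
  apply: horner_eq0_poly => t; rewrite hornerM.
  by have [->|/dp ->] := eqVneq d.[t] 0; rewrite ?mul0r ?mulr0.
by move/eqP; rewrite mulf_eq0 (negPf dN0).
Qed.

Section Curve.
Variables (k : nat) (w : 'I_k -> {poly F}).

Definition mcurve (p : {mpoly F[k]}) : {poly F} := mmap polyC w p.

Lemma mcurve_horner p t : (mcurve p).[t] = p.@[fun i => (w i).[t]].
Proof.
rewrite /mcurve /mmap mevalE horner_sum; apply: eq_bigr => m _.
rewrite hornerM hornerC; congr (_ * _).
by rewrite /mmap1 horner_prod; apply: eq_bigr => i _; rewrite horner_exp.
Qed.

(** The chain rule along a polynomial curve. It holds for constants and variables and, by the
    Leibniz rule on both sides, is stable under sums and products. *)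
Lemma deriv_mcurve p :
  (mcurve p)^`() = \sum_i (w i)^`() * mcurve p^`M(i).
Proof.
pose D q := (mcurve q)^`() = \sum_i (w i)^`() * mcurve q^`M(i).
have mcurveM a b : mcurve (a * b) = mcurve a * mcurve b by exact: rmorphM.
have mcurveD a b : mcurve (a + b) = mcurve a + mcurve b by exact: rmorphD.
have mcurveC c : mcurve c%:MP = c%:P by rewrite /mcurve mmapC.
have DM a b : D a -> D b -> D (a * b).
  rewrite /D => Da Db; rewrite mcurveM derivM Da Db mulr_suml mulr_sumr -big_split.
  by apply: eq_bigr => i _; rewrite mderivM mcurveD !mcurveM /=; ring.
have DC c : D c%:MP.
  rewrite /D mcurveC derivC big1 // => i _.
  by rewrite mderivC /mcurve mmap0 mulr0.
have DX i : D 'X_i.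
  rewrite /D (bigD1 i) //= big1 => [|j ji].
    rewrite addr0 mderivX mnm1E eqxx.
    have -> : (U_(i) - U_(i) = 0)%MM by apply/mnmP => j; rewrite mnmBE subnn mnm0E.
    by rewrite scale1r mpolyX0 -mpolyC1 mcurveC mulr1 /mcurve mmapX mmap1U.
  by rewrite mderivX mnm1E eq_sym (negPf ji) scale0r /mcurve mmap0 mulr0.
rewrite -/(D p); elim/mpolyind: p => [|c m q _ _ Dq].
  by rewrite -mpolyC0; apply: DC.
have DA a b : D a -> D b -> D (a + b).
  rewrite /D => Da Db; rewrite mcurveD derivD Da Db -big_split.
  by apply: eq_bigr => i _; rewrite mderivD mcurveD mulrDr.
apply: DA => //; rewrite -mul_mpolyC; apply: (DM) => //.
rewrite mpolyXE_id; elim/big_ind: _ => [||i _].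
- by rewrite -mpolyC1; apply: (DC).
- exact: (DM).
by elim: (m i) => [|e IHe]; [rewrite expr0 -mpolyC1; apply: (DC)|rewrite exprS; apply: (DM)].
Qed.

Lemma deriv_mcurve_horner p t :
  (mcurve p)^`().[t] = \sum_i p^`M(i).@[fun i => (w i).[t]] * (w i)^`().[t].
Proof.
rewrite deriv_mcurve horner_sum; apply: eq_bigr => i _.
by rewrite hornerM mcurve_horner mulrC.
Qed.

End Curve.

Section Line.
Variables (k : nat) (u v : 'I_k -> F).

Definition mline : {mpoly F[k]} -> {poly F} :=
  mcurve (fun i => (u i)%:P + v i *: 'X).

Lemma mline_horner p t : (mline p).[t] = p.@[fun i => u i + t * v i].
Proof.
rewrite mcurve_horner; apply: meval_eq => i.
by rewrite hornerD hornerC hornerZ hornerX mulrC.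
Qed.

Lemma deriv_mline0 p :
  (mline p)^`().[0] = \sum_i p^`M(i).@[u] * v i.
Proof.
rewrite deriv_mcurve_horner; apply: eq_bigr => i _; congr (_ * _).
  by apply: meval_eq => j; rewrite hornerD hornerC hornerZ hornerX mulr0 addr0.
by rewrite derivD derivC add0r derivZ derivX alg_polyC hornerC.
Qed.

End Line.

(** Induction on the degree of the monomial: the constant coefficient is the value at 0, and a
    nonzero multiple of any other coefficient is a coefficient of a partial derivative, which
    vanishes everywhere as well. *)
Lemma meval_eq0 k (p : {mpoly F[k]}) : (forall v, p.@[v] = 0) -> p = 0.
Proof.
move=> p0; apply/mpolyP => m; rewrite mcoeff0.
have [d] := ubnP (mdeg m); elim: d => // d IHd in p p0 m * => md.
have [->|mN0] := eqVneq m 0%MM.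
  have := p0 (fun=> 0); rewrite mevalE => <-.
  have [/= p0m|p0m] := boolP (0%MM \in msupp p).
    rewrite (bigD1_seq 0%MM) ?msupp_uniq //= big1 => [|i _].
      rewrite big1_seq ?addr0 ?mulr1 // => i /andP[iN0 _].
      suff [j ij] : exists j, i j != 0%N.
        by rewrite (bigD1 j) //= expr0n (negPf ij) mul0r mulr0.
      apply/existsP; apply: contraR iN0; rewrite negb_exists => /forallP i0.
      by apply/eqP/mnmP => j; rewrite mnm0E; apply/eqP; rewrite -[_ == _]negbK.
    by rewrite mnm0E expr0.
  rewrite (memN_msupp_eq0 p0m) big1_seq // => i /= ip.
  suff [j ij] : exists j, i j != 0%N.
    by rewrite (bigD1 j) //= expr0n (negPf ij) mul0r mulr0.
  apply/existsP; apply: contraR p0m; rewrite negb_exists => /forallP i0.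
  suff <- : i = 0%MM by [].
  by apply/mnmP => j; rewrite mnm0E; apply/eqP; rewrite -[_ == _]negbK.
have [i mi] : exists i, m i != 0%N.
  apply/existsP; apply: contraR mN0; rewrite negb_exists => /forallP i0.
  by apply/eqP/mnmP => j; rewrite mnm0E; apply/eqP; rewrite -[_ == _]negbK.
have mE : m = (m - U_(i) + U_(i))%MM.
  apply/esym/submK; apply/mnm_lepP => j; rewrite mnm1E.
  by case: eqP => // <-; rewrite lt0n.
have dp0 v : p^`M(i).@[v] = 0.
  pose w (j : 'I_k) : F := (j == i)%:R.
  have q0 : mline v w p = 0 by apply: horner_eq0_poly => t; rewrite mline_horner.
  have := deriv_mline0 v w p; rewrite q0 deriv0 horner0 (bigD1 i) //= /w eqxx mulr1.
  by rewrite big1 ?addr0 // => j /negPf ->; rewrite mulr0.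
have /IHd/(_ (m - U_(i))%MM) : forall v, p^`M(i).@[v] = 0 by [].
rewrite mcoeff_mderiv -mE => /(_ _)/eqP.
rewrite mulrn_eq0 /= => H; apply/eqP/H.
by move: md; rewrite {1}mE mdegD mdeg1 addn1 ltnS.
Qed.

Lemma mpoly_eval_inj k (p q : {mpoly F[k]}) : (forall v, p.@[v] = q.@[v]) -> p = q.
Proof.
move=> pq; apply/eqP; rewrite -subr_eq0; apply/eqP/meval_eq0 => v.
by rewrite mevalB pq subrr.
Qed.

End PolynomialIdentities.

(** * Functions that are polynomial along lines *)

Section LinePolynomial.
Variables (F : numFieldType) (vT : lmodType F).
Implicit Types (f g : vT -> F) (x y : vT).

(* A weak form of polynomiality that suffices for density arguments. *)
Definition line_poly f :=
  forall x y, exists P : {poly F}, forall t, f (x + t *: y) = P.[t].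

Lemma line_poly_ext f g : f =1 g -> line_poly f -> line_poly g.
Proof. by move=> fg lf x y; have [P fP] := lf x y; exists P => t; rewrite -fg. Qed.

Lemma line_poly_const f : (forall x y, f x = f y) -> line_poly f.
Proof. by move=> fc x y; exists (f x)%:P => t; rewrite hornerC. Qed.

Lemma line_poly_cst c : line_poly (fun=> c).
Proof. exact: line_poly_const. Qed.

Lemma line_poly_lin (f : vT -> F) :
  (forall a x y, f (a *: x + y) = a * f x + f y) -> line_poly f.
Proof.
move=> lf x y; exists ((f x)%:P + f y *: 'X) => t.
by rewrite addrC lf hornerD hornerC hornerZ hornerX addrC mulrC.
Qed.

Lemma line_polyD f g :
  line_poly f -> line_poly g -> line_poly (fun x => f x + g x).
Proof.
move=> lf lg x y; have [P fP] := lf x y; have [Q gQ] := lg x y.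
by exists (P + Q) => t; rewrite fP gQ hornerD.
Qed.

Lemma line_polyM f g :
  line_poly f -> line_poly g -> line_poly (fun x => f x * g x).
Proof.
move=> lf lg x y; have [P fP] := lf x y; have [Q gQ] := lg x y.
by exists (P * Q) => t; rewrite fP gQ hornerM.
Qed.

Lemma line_polyZ c f : line_poly f -> line_poly (fun x => c * f x).
Proof. exact/line_polyM/line_poly_cst. Qed.

Lemma line_poly_sum (I : Type) (r : seq I) (P : pred I) (f : I -> vT -> F) :
  (forall i, P i -> line_poly (f i)) -> line_poly (fun x => \sum_(i <- r | P i) f i x).
Proof.
move=> lf; elim: r => [|i r IHr].
  by apply: (line_poly_ext _ (line_poly_cst 0)) => x; rewrite big_nil.
case Pi: (P i); last by apply: (line_poly_ext _ IHr) => x; rewrite big_cons Pi.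
apply: (line_poly_ext _ (line_polyD (lf i Pi) IHr)) => x.
by rewrite big_cons Pi.
Qed.

Lemma line_poly_prod (I : Type) (r : seq I) (P : pred I) (f : I -> vT -> F) :
  (forall i, P i -> line_poly (f i)) -> line_poly (fun x => \prod_(i <- r | P i) f i x).
Proof.
move=> lf; elim: r => [|i r IHr].
  by apply: (line_poly_ext _ (line_poly_cst 1)) => x; rewrite big_nil.
case Pi: (P i); last by apply: (line_poly_ext _ IHr) => x; rewrite big_cons Pi.
apply: (line_poly_ext _ (line_polyM (lf i Pi) IHr)) => x.
by rewrite big_cons Pi.
Qed.

Lemma line_poly_exp f n : line_poly f -> line_poly (fun x => f x ^+ n).
Proof.
move=> lf; elim: n => [|n IHn].
  by apply: (line_poly_ext _ (line_poly_cst 1)) => x; rewrite expr0.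
by apply: (line_poly_ext _ (line_polyM lf IHn)) => x; rewrite exprS.
Qed.

Lemma line_poly_det n (A : vT -> 'M[F]_n) :
  (forall i j, line_poly (fun x => A x i j)) -> line_poly (fun x => \det (A x)).
Proof.
move=> lA; apply: line_poly_sum => s _; apply: line_polyZ.
by apply: line_poly_prod => i _.
Qed.

Lemma line_poly_meval k (p : {mpoly F[k]}) (f : 'I_k -> vT -> F) :
  (forall i, line_poly (f i)) -> line_poly (fun x => p.@[fun i => f i x]).
Proof.
move=> lf; apply: (line_poly_ext (fun x => esym (mevalE _ _))).
apply: line_poly_sum => m _; apply: line_polyZ.
by apply: line_poly_prod => i _; apply: line_poly_exp.
Qed.

(** The point [x] itself, at t = 0, may be a root of [d]; but the restriction of [f] to the line is
    a polynomial with infinitely many roots. *)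
Lemma line_poly_density f (d : {poly F}) x y : line_poly f -> d != 0 ->
  (forall t, d.[t] != 0 -> f (x + t *: y) = 0) -> f x = 0.
Proof.
move=> lf dN0 df; have [P fP] := lf x y.
have P0 : P = 0.
  by apply: (horner_eq0_generic dN0) => t dt; rewrite -fP df.
by rewrite -[x]addr0 -(scale0r y) fP P0 horner0.
Qed.

End LinePolynomial.

(** * Directional derivatives of polynomial functions *)

Section Differentials.
Variables (F : numFieldType) (vT : vectType F) (U : {vspace vT}).
Implicit Types (p q : polyfun U) (x y : vT).

(** The coordinate formula of [differential], taken on all vectors of the ambient space so that the
    subtype [subvs_of U] is avoided. *)
Definition dfun p x y : F :=
  \sum_(k < \dim U) peval p^`M(k) x * coord (vbasis U) k y.

Lemma dfun_linear p x a y z : dfun p x (a *: y + z) = a * dfun p x y + dfun p x z.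
Proof.
rewrite /dfun mulr_sumr -big_split /=; apply: eq_bigr => k _.
by rewrite linearP /= mulrDr mulrCA.
Qed.

Lemma dfunD p x y z : dfun p x (y + z) = dfun p x y + dfun p x z.
Proof. by rewrite -{1}[y]scale1r dfun_linear mul1r. Qed.

Lemma dfun0 p x : dfun p x 0 = 0.
Proof. by rewrite /dfun big1 // => k _; rewrite linear0 mulr0. Qed.

Lemma dfunZ p x a y : dfun p x (a *: y) = a * dfun p x y.
Proof. by rewrite -[a *: y]addr0 dfun_linear dfun0 addr0. Qed.

Lemma dfun_sum p x I (r : seq I) (P : pred I) (f : I -> vT) :
  dfun p x (\sum_(i <- r | P i) f i) = \sum_(i <- r | P i) dfun p x (f i).
Proof.
by elim/big_rec2: _ => [|i a b _ <-]; rewrite ?dfun0 ?dfunD.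
Qed.

Lemma line_poly_coord k : line_poly (fun y => coord (vbasis U) k y : F).
Proof. by apply: line_poly_lin => a x y; rewrite linearP. Qed.

Lemma line_poly_peval p : line_poly (peval p).
Proof. by apply: line_poly_meval => k; apply: line_poly_coord. Qed.

Lemma line_poly_dfun p y : line_poly (fun x => dfun p x y).
Proof.
apply: line_poly_sum => k _.
by apply: line_polyM; [exact: (@line_poly_peval p^`M(k))|exact: line_poly_cst].
Qed.

(** Links the formal differential to a derivative along a line; differentials are computed later by
    exhibiting such a [P]. *)
Lemma dfun_deriv p x y (P : {poly F}) :
  (forall t, peval p (x + t *: y) = P.[t]) -> P^`().[0] = dfun p x y.
Proof.
move=> pP; pose u k := coord (vbasis U) k x; pose v k := coord (vbasis U) k y.
suff -> : P = mline u v p by rewrite deriv_mline0.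
apply/eqP; rewrite -subr_eq0; apply/eqP/horner_eq0_poly => t.
rewrite hornerD hornerN mline_horner -pP -/u; apply/eqP; rewrite subr_eq0.
by apply/eqP/meval_eq => k; rewrite linearD linearZ.
Qed.

Lemma dfun_comp k (f : polyfun U) (s : {mpoly F[k]}) (P : k.-tuple (polyfun U)) x y :
    (forall z, z \in U -> peval f z = s.@[fun j => peval (tnth P j) z]) ->
    x \in U -> y \in U ->
  dfun f x y = \sum_j s^`M(j).@[fun j => peval (tnth P j) x] * dfun (tnth P j) x y.
Proof.
move=> fs Ux Uy.
pose w j := mline (fun k => coord (vbasis U) k x) (fun k => coord (vbasis U) k y) (tnth P j).
have wE j t : peval (tnth P j) (x + t *: y) = (w j).[t].
  by rewrite mline_horner; apply: meval_eq => i; rewrite linearD linearZ.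
rewrite -(@dfun_deriv f x y (mcurve w s)) => [|t]; last first.
  by rewrite mcurve_horner fs ?memvD ?memvZ //; apply: meval_eq => j; rewrite wE.
rewrite deriv_mcurve_horner; apply: eq_bigr => j _; congr (_ * _).
  by apply: meval_eq => i; rewrite -wE scale0r addr0.
by apply: dfun_deriv => t; rewrite wE.
Qed.

End Differentials.

(** * The trace form *)

Section TraceForm.
Variables (F : numFieldType) (n : nat).
Local Notation M := 'M[F]_n.
Implicit Types (g h : {vspace M}) (x y z : M).

Lemma tr_lie x y z : \tr (x *m lie y z) = \tr (lie x y *m z).
Proof.
rewrite /lie mulmxBr mulmxBl !raddfB /= !mulmxA; congr (_ - _).
by rewrite mxtrace_mulC mulmxA.
Qed.

Lemma lieC x y : lie x y = - lie y x.
Proof. by rewrite /lie opprB. Qed.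

Lemma lieDl x y z : lie (x + y) z = lie x z + lie y z.
Proof. by rewrite /lie mulmxDl mulmxDr opprD addrACA. Qed.

Lemma lieZl a x z : lie (a *: x) z = a *: lie x z.
Proof. by rewrite /lie -scalemxAl -scalemxAr -scalerBr. Qed.

Definition nondeg g :=
  forall y, y \in g -> (forall z, z \in g -> \tr (z *m y) = 0) -> y = 0.

Definition gram g : 'M[F]_(\dim g) :=
  \matrix_(i, j) \tr ((vbasis g)`_i *m (vbasis g)`_j).

Lemma mem_vbasis_nth g (i : 'I_(\dim g)) : (vbasis g)`_i \in g.
Proof. by apply: vbasis_mem; rewrite mem_nth ?size_tuple. Qed.

Lemma gram_unit g : nondeg g -> gram g \in unitmx.
Proof.
move=> gN; rewrite -row_free_unit; apply/inj_row_free => v vG.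
have bF : free (vbasis g) by apply: basis_free (vbasisP g).
suff y0 : \sum_i v 0 i *: (vbasis g)`_i = 0.
  by apply/rowP => i; rewrite mxE -(coord_sum_free _ i bF) y0 linear0.
apply: gN => [|z /coord_vbasis ->].
  by apply: memv_suml => i _; rewrite memvZ ?mem_vbasis_nth.
rewrite mulmx_suml linear_sum big1 // => j _ /=.
rewrite -scalemxAl linearZ /=.
suff -> : \tr ((vbasis g)`_j *m \sum_i v 0 i *: (vbasis g)`_i) = (v *m gram g) 0 j.
  by rewrite vG mxE mulr0.
rewrite mulmx_sumr linear_sum !mxE; apply: eq_bigr => i _ /=.
by rewrite -scalemxAr linearZ mxE mxtrace_mulC.
Qed.

(** The representative of the linear form [phi] for the trace form on [g], computed with the inverse
    Gram matrix; meaningful when [g] is nondegenerate ([repP]). *)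
Definition rep g (phi : M -> F) : M :=
  \sum_i ((\row_j phi (vbasis g)`_j) *m invmx (gram g)) 0 i *: (vbasis g)`_i.

Lemma rep_mem g phi : rep g phi \in g.
Proof. by apply: memv_suml => i _; rewrite memvZ ?mem_vbasis_nth. Qed.

Lemma repP g phi y : nondeg g ->
    (forall a u v, phi (a *: u + v) = a * phi u + phi v) -> y \in g ->
  \tr (rep g phi *m y) = phi y.
Proof.
move=> gN phiL gy.
have phi0 : phi 0 = 0 by have := phiL (-1) 0 0; rewrite scaler0 addr0 mulN1r addNr.
have phiS (c : 'I_(\dim g) -> F) :
    phi (\sum_i c i *: (vbasis g)`_i) = \sum_i c i * phi (vbasis g)`_i.
  by elim/big_rec2: _ => // i a b _ <-; rewrite phiL.
have trj (j : 'I_(\dim g)) : \tr (rep g phi *m (vbasis g)`_j) = phi (vbasis g)`_j.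
  pose w := \row_(l < \dim g) phi (vbasis g)`_l.
  have -> : phi (vbasis g)`_j = (w *m invmx (gram g) *m gram g) 0 j.
    by rewrite mulmxKV ?gram_unit // mxE.
  rewrite mulmx_suml linear_sum mxE; apply: eq_bigr => i _ /=.
  by rewrite -scalemxAl linearZ [gram g _ _]mxE.
rewrite (coord_vbasis gy) phiS mulmx_sumr linear_sum; apply: eq_bigr => j _ /=.
by rewrite -scalemxAr linearZ /= trj.
Qed.

Lemma nondeg_eq g x y : nondeg g -> x \in g -> y \in g ->
  (forall z, z \in g -> \tr (x *m z) = \tr (y *m z)) -> x = y.
Proof.
move=> gN gx gy xy; apply/eqP; rewrite -subr_eq0; apply/eqP/gN => [|z gz].
  exact: memvB.
by rewrite mulmxBr raddfB /= mxtrace_mulC xy // [\tr (z *m y)]mxtrace_mulC subrr.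
Qed.

Section Projection.
Variables (g h : {vspace M}).
Hypotheses (hN : nondeg h) (hg : (h <= g)%VS).

Lemma trperp_cap : (h :&: trperp g h = 0)%VS.
Proof.
apply/eqP; rewrite -subv0; apply/subvP => y /memv_capP[hy /mem_trperp[_ yh]].
by rewrite memv0; apply/eqP/hN.
Qed.

Lemma trproj_mem x : trproj g h x \in h.
Proof. exact: memv_pi. Qed.

Lemma trproj_sub_mem x : x \in g -> x - trproj g h x \in trperp g h.
Proof.
(* [y] is the orthogonal projection of [x], obtained by representing z -> tr (x z) on [h];
   uniqueness of the decomposition identifies it with [trproj]. *)
move=> gx; pose y := rep h (fun z => \tr (x *m z)).
have hy : y \in h by exact: rep_mem.
have phiL a u v : \tr (x *m (a *: u + v)) = a * \tr (x *m u) + \tr (x *m v).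
  by rewrite mulmxDr raddfD /= -scalemxAr linearZ.
have yp : x - y \in trperp g h.
  apply/mem_trperp; split=> [|z hz]; first by rewrite memvB // (subvP hg).
  rewrite mulmxBr raddfB /= mxtrace_mulC [\tr (z *m y)]mxtrace_mulC repP //.
  by rewrite subrr.
suff -> : trproj g h x = y by [].
rewrite -[x](subrK y) linearD /= [trproj g h y](daddv_pi_id trperp_cap) //.
have capC : (trperp g h :&: h = 0)%VS by rewrite capvC trperp_cap.
have wsum : x - y \in (h + trperp g h)%VS by apply: (subvP (addvSr _ _)).
have := daddv_pi_add trperp_cap wsum; rewrite (daddv_pi_id capC yp) => /eqP.
by rewrite -subr_eq0 addrK => /eqP; rewrite /trproj => ->; rewrite add0r.
Qed.

Lemma tr_trproj x z : x \in g -> z \in h -> \tr (z *m trproj g h x) = \tr (z *m x).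
Proof.
move=> gx hz; have /mem_trperp[_ /(_ z hz)] := trproj_sub_mem gx.
by rewrite mulmxBr raddfB /= => /eqP; rewrite subr_eq0 => /eqP.
Qed.

End Projection.

Lemma free_map_inj (vT wT : vectType F) (f : 'Hom(vT, wT)) (X : seq vT) :
  (<<X>> :&: lker f = 0)%VS -> free (map f X) = free X.
Proof. by move=> Xf; rewrite /free size_map -limg_span limg_dim_eq. Qed.

Section TraceDual.
Variable g : {vspace M}.

(** The identification of [g] with its dual by the trace form, which exchanges gradients and
    differentials. *)
Definition trdual y : 'Hom(subvs_of g, F^o) := (linfun (trform y) \o linfun vsval)%VF.

Lemma trdualE y v : trdual y v = \tr (y *m vsval v).
Proof. by rewrite comp_lfunE !lfunE. Qed.

Lemma trdual_is_linear : linear trdual.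
Proof.
move=> a y z; apply/lfunP => v.
rewrite trdualE add_lfunE scale_lfunE !trdualE mulmxDl raddfD /=.
by rewrite -scalemxAl linearZ.
Qed.
HB.instance Definition _ := GRing.isLinear.Build F M 'Hom(subvs_of g, F^o) *:%R
  trdual trdual_is_linear.

Lemma free_trdual (X : seq M) : nondeg g -> {subset X <= g} ->
  free (map trdual X) = free X.
Proof.
move=> gN Xg; rewrite -(@free_map_inj _ _ (linfun trdual)).
  by congr (free _); apply: eq_map => y; rewrite lfunE.
apply/eqP; rewrite -subv0; apply/subvP => y /memv_capP[Xy].
have gy : y \in g by apply: subvP Xy; apply/span_subvP.
rewrite memv_ker lfunE /= memv0 => /eqP y0; apply/eqP/gN => // z gz.
move/lfunP: y0 => /(_ (Sub z gz)).
by rewrite trdualE zero_lfunE /= mxtrace_mulC.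
Qed.

End TraceDual.
End TraceForm.

(** * The chain of centralizers *)

Section Chain.
Variables (F : numFieldType) (n : nat).
Local Notation M := 'M[F]_n.

Definition grad (g : {vspace M}) (p : polyfun g) (x : M) : M := rep g (dfun p x).

Lemma tr_grad (g : {vspace M}) (p : polyfun g) x y : nondeg g -> y \in g ->
  \tr (grad p x *m y) = dfun p x y.
Proof. by move=> gN gy; apply: repP => // a u v; apply: dfun_linear. Qed.

(* What the chain argument needs to know about a single algebra of the chain  *)
(* (Kostant's theorem on regular elements).                                   *)
Definition kostant_property (g : {vspace M}) (r : nat) (psi : r.-tuple (polyfun g)) :=
  forall x, x \in g ->
  [/\ {subset [seq grad p x | p <- psi] <= liecent g x},
      free [seq grad p x | p <- psi] = (\dim (liecent g x) == r)
    & (r <= \dim (liecent g x))%N].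

Variables (g : nat -> {vspace M}) (r : nat -> nat).
Variable psi : forall i, (r i).-tuple (polyfun (g i)).
Hypotheses (n_gt0 : (0 < n)%N)
  (g_leS : forall i, (1 <= i < n)%N -> (g i <= g i.+1)%VS)
  (g_nondeg : forall i, (1 <= i <= n)%N -> nondeg (g i))
  (g_lie : forall i, (1 <= i <= n)%N -> forall x y, x \in g i -> y \in g i -> lie x y \in g i)
  (g_kostant : forall i, (1 <= i <= n)%N -> kostant_property (psi i))
  (dim_gn : \dim (g n) = ((\sum_(1 <= i < n) r i).*2 + r n)%N).

Lemma chain_le i j : (1 <= i)%N -> (i <= j <= n)%N -> (g i <= g j)%VS.
Proof.
move=> i1 /andP[ij]; elim: j ij => [|j IHj] ij jn.
  by move: ij i1; rewrite leqn0 => /eqP->.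
move: ij; rewrite leq_eqVlt => /predU1P[-> //|]; rewrite ltnS => ij.
by apply: subv_trans (IHj ij (ltnW jn)) (g_leS _); lia.
Qed.

Variable x : M.
Hypothesis gnx : x \in g n.
Local Notation x_ i := (gz_proj g i x).
Local Notation z_ i := (liecent (g i) (x_ i)).

Lemma gz_proj_mem i : x_ i \in g i.
Proof. exact: trproj_mem. Qed.

Lemma tr_gz_proj i y z : (1 <= i <= n)%N -> y \in g n -> z \in g i ->
  \tr (z *m gz_proj g i y) = \tr (z *m y).
Proof.
move=> i1n gy giz; apply: tr_trproj => //; first exact: g_nondeg.
by apply: chain_le; lia.
Qed.

(** Describes the centralizer through [x] instead of x_i: by invariance and nondegeneracy of the
    trace form, [y, x_i] = 0 says that [y] is in the radical of (z, y) -> tr ([z, y] x_i) on g_i,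
    and x_i may be replaced by [x] because brackets of g_i stay in g_i. *)
Lemma liecent_gz i y : (1 <= i <= n)%N -> y \in g i -> lie y (x_ i) = 0 <->
  (forall z, z \in g i -> \tr (lie z y *m x) = 0).
Proof.
move=> i1n giy; split=> [yx z giz|yx].
  rewrite -(tr_gz_proj i1n gnx); last exact: g_lie.
  by rewrite -tr_lie yx mulmx0 raddf0.
apply: (g_nondeg i1n); first by apply: g_lie => //; apply: gz_proj_mem.
by move=> z giz; rewrite tr_lie (tr_gz_proj i1n gnx) ?yx //; apply: g_lie.
Qed.

Lemma mem_z i y : (1 <= i <= n)%N -> reflect
  (y \in g i /\ forall z, z \in g i -> \tr (lie z y *m x) = 0) (y \in z_ i).
Proof.
move=> i1n; rewrite mem_liecent; apply: (iffP andP) => -[giy yx]; split=> //.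
  by apply/(liecent_gz i1n giy); rewrite lieC (eqP yx) oppr0.
by rewrite lieC oppr_eq0; apply/eqP/(liecent_gz i1n giy).
Qed.

(** The condition in [mem_z] involves the same [x] at every level, so shrinking the set of test
    vectors from g_j to g_i only weakens it. *)
Lemma z_le i j y : (1 <= i)%N -> (i <= j <= n)%N -> y \in g i -> y \in z_ j -> y \in z_ i.
Proof.
move=> i1 ijn giy /mem_z[|gjy yx]; first lia.
apply/mem_z; first lia; split=> // z giz; apply: yx.
by apply: subvP giz; apply: chain_le.
Qed.

Definition gz_grads i : seq M := [seq grad p (x_ i) | p <- psi i].

Lemma gz_grads_sub i : (1 <= i <= n)%N -> {subset gz_grads i <= z_ i}.
Proof. by move=> i1n; have [] := g_kostant i1n (gz_proj_mem i). Qed.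

Lemma gz_grads_span i : (1 <= i <= n)%N -> (<<gz_grads i>> <= z_ i)%VS.
Proof. by move=> i1n; apply/span_subvP/gz_grads_sub. Qed.

(** A gradient at x_i lies in g_i, so its traces against [v] and against the projection of [v]
    agree; hence it also represents the differential of the pullback at [x]. *)
Lemma strongly_regular_grads :
  strongly_regular (g := g) (r := r) psi x
    = free (flatten [seq gz_grads i | i <- iota 1 n]).
Proof.
rewrite -(@free_trdual _ _ (g n)); first last.
- move=> y /flattenP[_ /mapP[i + ->]]; rewrite mem_iota add1n ltnS => i1n.
  move/(gz_grads_sub i1n); rewrite mem_liecent => /andP[+ _].
  by apply: subvP; apply: chain_le; lia.
- by apply: g_nondeg; lia.
rewrite /strongly_regular /gz_functions map_flatten map_flatten -!map_comp.
congr (free (flatten _)); apply/eq_in_map => i; rewrite mem_iota add1n ltnS => i1n.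
rewrite /= /gz_grads -!map_comp; apply: eq_map => p /=; apply/lfunP => v.
have gv : vsval v \in g n := subvsP v.
have pv : gz_proj g i (vsval v) \in g i by exact: trproj_mem.
have tv := tr_gz_proj i1n gv (rep_mem (g i) (dfun p (x_ i))).
rewrite differentialE trdualE -tv.
rewrite tr_grad //; last exact: g_nondeg.
have [P pP] := line_poly_peval p (x_ i) (gz_proj g i (vsval v)).
rewrite -(dfun_deriv pP) -/(dfun (pullback (g n) (gz_proj g i) p) x (vsval v)).
apply/esym/dfun_deriv => t; rewrite pullbackE ?memvD ?memvZ //.
by rewrite linearD linearZ /= pP.
Qed.

Lemma iota_rcons m : iota 1 m.+1 = rcons (iota 1 m) m.+1.
Proof. by rewrite -[in LHS](addn1 m) iotaD cats1 add1n. Qed.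

(** Inductively, the gradients of the first m levels span a subspace of g_m, and the next ones lie
    in z_(m+1). A common vector is in g_m and z_(m+1), so by [z_le] in z_m as well, and vanishes. *)
Lemma free_gz_grads :
  (forall i, (1 <= i <= n)%N -> free (gz_grads i)) ->
  (forall i, (1 <= i < n)%N -> z_ i :&: z_ i.+1 = 0)%VS ->
  free (flatten [seq gz_grads i | i <- iota 1 n]).
Proof.
move=> freeG z0.
suff: forall m, (m <= n)%N ->
    free (flatten [seq gz_grads i | i <- iota 1 m])
    /\ (0 < m -> <<flatten [seq gz_grads i | i <- iota 1 m]>> <= g m)%VS%N.
  by move=> /(_ n (leqnn n))[].
elim=> [|m IHm] mn; first by rewrite nil_free.
have [IHf IHg] := IHm (ltnW mn).
have zg i : (z_ i <= g i)%VS by apply: capvSl.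
have Gm1 : (<<gz_grads m.+1>> <= z_ m.+1)%VS by apply: gz_grads_span; lia.
have [m0|m_gt0] := posnP m.
  rewrite m0 /= cats0; split=> [|_]; first by apply: freeG; lia.
  by rewrite m0 in Gm1; apply: subv_trans Gm1 (zg _).
rewrite iota_rcons map_rcons flatten_rcons cat_free IHf freeG; last lia.
split=> [|_].
  rewrite /=; apply/directv_addP/eqP; rewrite -subv0; apply/subvP => y.
  case/memv_capP => /(subvP (IHg m_gt0)) gmy /(subvP Gm1) zmy.
  rewrite -(z0 m); last lia.
  apply/memv_capP; split; last exact: zmy.
  by apply: (@z_le m m.+1 y m_gt0 _ gmy zmy); rewrite leqnSn.
rewrite span_cat subv_add (subv_trans Gm1 (zg _)) andbT.
by apply: subv_trans (IHg m_gt0) (g_leS _); lia.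
Qed.

(** The sum Z of all z_i is direct and isotropic for tr ([z, y] x). So ad x maps Z into the
    trace-orthogonal complement of Z in g_n, with kernel z_n, whence 2 dim Z <= dim g_n + dim z_n.
    Together with r_i <= dim z_i and the value of dim g_n this leaves only equalities. *)
Lemma dim_z_of_cap0 :
  (forall i, (1 <= i < n)%N -> z_ i :&: z_ i.+1 = 0)%VS ->
  forall i, (1 <= i <= n)%N -> \dim (z_ i) = r i.
Proof.
move=> z0; pose Z m := (\sum_(1 <= i < m.+1) z_ i)%VS.
have zg i : (z_ i <= g i)%VS by apply: capvSl.
have Z_props m : (1 <= m <= n)%N -> [/\ (Z m <= g m)%VS,
    \dim (Z m) = (\sum_(1 <= i < m.+1) \dim (z_ i))%N
  & forall y z, y \in Z m -> z \in Z m -> \tr (lie z y *m x) = 0].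
  elim: m => // m IHm m1n.
  have [m0|m_gt0] := posnP m.
    rewrite /Z m0 !big_nat1; split=> // y z /mem_z[|_ yx]; first lia.
    by move/(subvP (zg 1%N))/yx.
  have [|IHg IHd IHx] := IHm; first lia.
  have -> : Z m.+1 = (Z m + z_ m.+1)%VS by rewrite /Z big_nat_recr.
  rewrite big_nat_recr //=.
  have gmm1 : (g m <= g m.+1)%VS by apply: g_leS; lia.
  have capZ : (Z m :&: z_ m.+1 = 0)%VS.
    apply/eqP; rewrite -subv0; apply/subvP => y.
    case/memv_capP => /(subvP IHg) gmy zmy.
    rewrite -(z0 m); last lia.
    apply/memv_capP; split; last exact: zmy.
    by apply: (@z_le m m.+1 y m_gt0 _ gmy zmy); rewrite leqnSn.
  split.
  - by rewrite subv_add zg andbT; exact: (subv_trans IHg gmm1).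
  - by rewrite dimv_disjoint_sum // IHd.
  (* Isotropy of the enlarged sum: an element of z_(m+1) pairs to zero with all of g_(m+1), which
     contains [Z m]. *)
  move=> _ _ /memv_addP[y1 Zy1 [y2 zy2 ->]] /memv_addP[z1 Zz1 [z2 zz2 ->]].
  case/(mem_z _ m1n): (zy2) => gy2 yx.
  case/(mem_z _ m1n): (zz2) => gz2 zx.
  have gm1 u : u \in Z m -> u \in g m.+1 by move/(subvP IHg)/(subvP gmm1).
  have trDl a b c : \tr (lie (a + b) c *m x) = \tr (lie a c *m x) + \tr (lie b c *m x).
    by rewrite lieDl mulmxDl raddfD.
  have trDr a b c : \tr (lie a (b + c) *m x) = \tr (lie a b *m x) + \tr (lie a c *m x).
    by rewrite linearD mulmxDl raddfD.
  rewrite (trDl z1 z2) (trDr z1 y1 y2) (trDr z2 y1 y2) (IHx _ _ Zy1 Zz1) (yx _ (gm1 _ Zz1)) (yx _ gz2) [lie z2 y1]lieC.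
  rewrite mulNmx raddfN /= (zx _ (gm1 _ Zy1)).
  by rewrite oppr0 !addr0.
have [|ZG Zd Zx] := Z_props n; first lia.
pose f := linfun (lie x).
have zn_Z : (Z n :&: lker f = z_ n)%VS.
  have xn : x_ n = x.
    apply: (@nondeg_eq _ _ (g n)); rewrite ?gz_proj_mem //.
      by apply: g_nondeg; lia.
    move=> z gz; rewrite mxtrace_mulC [RHS]mxtrace_mulC.
    by apply: tr_gz_proj gnx gz; rewrite n_gt0 leqnn.
  have znZ : (z_ n <= Z n)%VS.
    by rewrite /Z big_nat_recr //= addvSr.
  apply/vspaceP => y; rewrite memv_cap mem_lker_linfun mem_liecent xn.
  apply/andP/andP => -[Zy yx]; split=> //; first exact: (subvP ZG).
  by apply: (subvP znZ); rewrite mem_liecent xn Zy.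
have le_dim : (\dim (Z n) + \dim (Z n) <= \dim (g n) + \dim (z_ n))%N.
  have := limg_ker_dim f (Z n); rewrite zn_Z => dimZ.
  (* The kernel of this map on g_n is the trace-orthogonal complement of [Z n]. *)
  pose T0 (y : M) : 'rV[F]_(\dim (Z n)) := \row_i \tr ((vbasis (Z n))`_i *m y).
  have T0L : linear T0.
    move=> a u v; apply/rowP => i; rewrite !mxE mulmxDr raddfD /=.
    by rewrite -scalemxAr linearZ.
  pose T0c := GRing.isLinear.Build F M _ *:%R T0 T0L.
  pose T := linfun (HB.pack T0 T0c : {linear M -> 'rV[F]_(\dim (Z n))}).
  have TE y : T y = \row_i \tr ((vbasis (Z n))`_i *m y) by rewrite lfunE.
  have fZ : (f @: Z n <= g n :&: lker T)%VS.
    apply/subvP => _ /memv_imgP[y Zy ->]; rewrite lfunE memv_cap memv_ker /=.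
    apply/andP; split.
      by apply: g_lie; [lia|exact: gnx|exact: (subvP ZG)].
    apply/eqP; rewrite TE; apply/rowP => i; rewrite !mxE tr_lie.
    by rewrite mxtrace_mulC tr_lie (Zx _ _ (mem_vbasis_nth i) Zy).
  have := limg_ker_dim T (g n).
  have -> : \dim (T @: g n) = \dim (Z n).
    have dV k : \dim {:'rV[F]_k} = k by rewrite dimvf dim_matrix mul1r.
    rewrite -[RHS]dV; congr (\dim _).
    apply/vspaceP => c; rewrite memvf; apply/memv_imgP.
    (* Surjectivity: the value [c] is attained at the representative of the form whose values on the
       basis of [Z n] are the entries of [c]. *)
    pose phi v := \sum_j c 0 j * coord (vbasis (Z n)) j v.
    exists (rep (g n) phi); first exact: rep_mem.
    rewrite TE; apply/rowP => i; rewrite mxE mxtrace_mulC repP.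
    - have fZn : free (vbasis (Z n)) := basis_free (vbasisP _).
      rewrite /phi (bigD1 i) //= big1 => [|j ji].
        by rewrite (coord_free _ _ fZn) eqxx mulr1 addr0.
      by rewrite (coord_free _ _ fZn) eq_sym (negPf ji) mulr0.
    - by apply: g_nondeg; rewrite n_gt0 leqnn.
    - move=> a u v; rewrite /phi mulr_sumr -big_split /=; apply: eq_bigr => j _.
      by rewrite linearP /= mulrDr mulrCA.
    by apply: (subvP ZG); apply: mem_vbasis_nth.
  move=> dimT; rewrite -dimT -{1}dimZ [X in (X + _ <= _)%N]addnC addnAC !leq_add2r.
  exact: dimvS.
pose D i := \dim (z_ i).
have ge_r i : (1 <= i <= n)%N -> (r i <= D i)%N.
  by move=> i1n; have [] := g_kostant i1n (gz_proj_mem i).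
have : ((\sum_(1 <= i < n) D i + D n).*2 <= (\sum_(1 <= i < n) r i).*2 + r n + D n)%N.
  by rewrite -dim_gn -addnn -(big_nat_recr _ _ D) //= -Zd.
have le_sum : (\sum_(1 <= i < n) r i <= \sum_(1 <= i < n) D i)%N.
  by rewrite !big_nat; apply: leq_sum => j /andP[j1 jn]; rewrite ge_r // j1 ltnW.
have ge_rn : (r n <= D n)%N by rewrite ge_r // n_gt0 leqnn.
move=> {}le_dim i /andP[i1]; rewrite leq_eqVlt -/(D i) => /predU1P[->|lt_in].
  by move: (\sum_(_ <= _ < _) _)%N le_sum le_dim => S; clear -ge_rn; lia.
have i_in : i \in index_iota 1 n by rewrite mem_index_iota i1.
have i_uniq : uniq (index_iota 1 n) by apply: iota_uniq.
have ge_ri : (r i <= D i)%N by rewrite ge_r // i1 ltnW.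
have : (\sum_(1 <= j < n | j != i) r j <= \sum_(1 <= j < n | j != i) D j)%N.
  rewrite big_nat_cond [leqRHS]big_nat_cond; apply: leq_sum => j /andP[/andP[j1 jn] _].
  by rewrite ge_r // j1 ltnW.
move: le_dim; rewrite !(bigD1_seq i i_in i_uniq) /= {le_sum}.
by clear -ge_ri ge_rn; lia.
Qed.

Lemma strongly_regular_iff :
  strongly_regular (g := g) (r := r) psi x <->
  (forall i, (1 <= i < n)%N -> z_ i :&: z_ i.+1 = 0)%VS.
Proof.
rewrite strongly_regular_grads; split=> [freeG i i1n|z0]; last first.
  apply: free_gz_grads => // i i1n.
  have [_ -> _] := g_kostant i1n (gz_proj_mem i).
  by rewrite dim_z_of_cap0.
have iotaE : iota 1 n = iota 1 i.-1 ++ [:: i; i.+1] ++ iota i.+2 (n - i.+1).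
  case: i i1n => // i /andP[_ lt_in]; rewrite -[in LHS](subnKC lt_in).
  by rewrite iotaD -[in iota 1 i.+2](addn2 i) iotaD -catA !add1n.
move: freeG; rewrite iotaE !map_cat !flatten_cat /= cats0.
move=> /catr_free/catl_free; rewrite cat_free => /and3P[freei freeSi].
(* Independent gradients number r_j = dim z_j, so they span z_j; independence of the two consecutive
   blocks then says that their spans meet trivially. *)
have spanE j : (1 <= j <= n)%N -> free (gz_grads j) -> z_ j = <<gz_grads j>>%VS.
  move=> j1n /[dup] fj; have [_ -> _ /eqP dj] := g_kostant j1n (gz_proj_mem j).
  apply/esym/eqP; rewrite eqEdim gz_grads_span //= dj.
  by move: fj; rewrite /free => /eqP ->; rewrite size_map size_tuple.
by move/directv_addP; rewrite -!spanE //; lia.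
Qed.

End Chain.

(** * Kostant's criterion from a Cartan subalgebra *)

Section CartanDatum.
Variables (F : numFieldType) (n : nat).
Local Notation M := 'M[F]_n.
Variables (g : {vspace M}) (G : M -> Prop) (r q : nat).
Variables (c : 'I_r -> M) (e : 'I_q -> M) (al : 'I_q -> ('I_r -> F) -> F).

Variable b : (r + q).-tuple M.
Hypotheses (b_c : forall i, b`_(lshift q i) = c i) (b_e : forall k, b`_(rshift r k) = e k).

Definition cartan (a : 'I_r -> F) : M := \sum_i a i *: c i.

Definition adj (s x : M) : M := s *m x *m invmx s.

Hypotheses (basis_g : basis_of g b) (g_nondeg : nondeg g)
  (g_lie : forall x y, x \in g -> y \in g -> lie x y \in g).
Hypotheses (lie_c : forall a i, lie (cartan a) (c i) = 0)
  (lie_e : forall a k, lie (cartan a) (e k) = al k a *: e k)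
  (tr_ce : forall i k, \tr (c i *m e k) = 0)
  (det_c : \det (\matrix_(i, j) \tr (c i *m c j)) != 0).
Hypotheses (G_unit : forall s, G s -> s \in unitmx)
  (G_adj : forall s y, G s -> y \in g -> adj s y \in g)
  (G_adjV : forall s y, G s -> y \in g -> invmx s *m y *m s \in g).
(** A group element fixing the Cartan subalgebra pointwise and scaling the root vector nontrivially;
    it forces differentials of invariants at Cartan points to vanish on root vectors. *)
Hypothesis torus : forall k, exists s tau,
  [/\ G s, tau != 1, forall i, adj s (c i) = c i & adj s (e k) = tau *: e k].

Variables (p : r.-tuple (polyfun g)) (P : r.-tuple {mpoly F[r]}).
(** [ok] is a genericity condition on Cartan points. The Jacobian formula compares a fourth power
    with a squared product over all roots in order to be insensitive to signs: this product is, up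
    to sign, the square of the product of the positive roots. *)
Variables (ok : ('I_r -> F) -> Prop) (kappa : F).
Hypotheses (p_inv : forall j, Ad_invariant G (tnth p j))
  (p_cartan : forall j a, peval (tnth p j) (cartan a) = (tnth P j).@[a])
  (kappa_neq0 : kappa != 0)
  (jacobian : forall a, ok a ->
     (\det (\matrix_(j, i) (tnth P j)^`M(i).@[a])) ^+ 4 = kappa * (\prod_k al k a) ^+ 2)
  (chevalley : forall f : polyfun g, Ad_invariant G f ->
     exists s : {mpoly F[r]}, forall a, peval f (cartan a) = s.@[fun j => (tnth P j).@[a]])
  (density : forall x, x \in g -> exists z d, [/\ z \in g, d != 0 :> {poly F}
     & forall t, d.[t] != 0 -> exists s a,
         [/\ G s, ok a & x + t *: z = adj s (cartan a)]]).

Lemma free_b : free b. Proof. exact: basis_free basis_g. Qed.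

Lemma mem_b (i : 'I_(r + q)) : b`_i \in g.
Proof. by apply: (basis_mem basis_g); rewrite mem_nth ?size_tuple. Qed.

Lemma coord_b y : y \in g -> y = \sum_i coord b i y *: b`_i.
Proof. exact: coord_basis. Qed.

Lemma c_mem i : c i \in g. Proof. by rewrite -b_c mem_b. Qed.
Lemma e_mem k : e k \in g. Proof. by rewrite -b_e mem_b. Qed.
Lemma cartan_mem a : cartan a \in g.
Proof. by apply: memv_suml => i _; rewrite memvZ ?c_mem. Qed.

Lemma decomp y : y \in g -> y = \sum_i coord b (lshift q i) y *: c i
   + \sum_k coord b (rshift r k) y *: e k.
Proof.
move=> /coord_b {1}->; rewrite big_split_ord /=.
by congr (_ + _); apply: eq_bigr => i _; rewrite ?b_c ?b_e.
Qed.

Lemma line_poly_density_g (f : M -> F) : line_poly f ->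
  (forall s a, G s -> ok a -> f (adj s (cartan a)) = 0) -> forall x, x \in g -> f x = 0.
Proof.
move=> lf f0 x gx; have [z [d [gz dN0 dP]]] := density gx.
apply: (line_poly_density lf dN0 (y := z)) => t /dP[s [a [Gs oka ->]]].
exact: f0.
Qed.

Lemma adjK s y : s \in unitmx -> invmx s *m adj s y *m s = y.
Proof. by move=> sU; rewrite /adj !mulmxA mulVmx // mul1mx mulmxKV. Qed.

Lemma adj_is_linear s : linear (adj s).
Proof.
by move=> a y z; rewrite /adj mulmxDr mulmxDl -scalemxAr -scalemxAl.
Qed.
HB.instance Definition _ s := GRing.isLinear.Build F M M *:%R (adj s) (adj_is_linear s).

Lemma adj_lie s x y : s \in unitmx -> lie (adj s x) (adj s y) = adj s (lie x y).
Proof.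
move=> sU; rewrite /lie /adj mulmxBr mulmxBl !mulmxA.
by rewrite !(mulmxKV sU).
Qed.

Lemma adj_tr s x y : s \in unitmx -> \tr (adj s x *m adj s y) = \tr (x *m y).
Proof.
move=> sU; rewrite /adj !mulmxA (mulmxKV sU) mxtrace_mulC !mulmxA.
by rewrite mulVmx // mul1mx.
Qed.

Lemma adj_ex s y : G s -> y \in g -> exists2 y', y' \in g & y = adj s y'.
Proof.
move=> Gs gy; exists (invmx s *m y *m s); first exact: G_adjV.
by rewrite /adj !mulmxA mulmxV ?G_unit // mul1mx mulmxK ?G_unit.
Qed.

Section InvariantDifferential.
Variable f : polyfun g.
Hypothesis f_inv : Ad_invariant G f.

Lemma dfun_adj s x y : G s -> x \in g -> y \in g ->
  dfun f (adj s x) (adj s y) = dfun f x y.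
Proof.
move=> Gs gx gy; have [Q fQ] := line_poly_peval f x y.
rewrite -(dfun_deriv fQ); apply/esym/dfun_deriv => t.
have -> : adj s x + t *: adj s y = adj s (x + t *: y) by rewrite linearD linearZ.
by rewrite f_inv ?fQ // memvD ?memvZ.
Qed.

Lemma dfun_root a k : dfun f (cartan a) (e k) = 0.
Proof.
have [s [tau [Gs tau1 sc se]]] := torus k.
have sh : adj s (cartan a) = cartan a.
  by rewrite linear_sum; apply: eq_bigr => i _; rewrite linearZ /= sc.
have := dfun_adj Gs (cartan_mem a) (e_mem k); rewrite sh se dfunZ => /eqP.
rewrite -subr_eq0 -{2}[dfun _ _ _]mul1r -mulrBl mulf_eq0 subr_eq0 (negPf tau1).
by move/eqP.
Qed.

(** Infinitesimal invariance, without differentiating the group action: by density and conjugation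
    [x] may be taken in the Cartan subalgebra, where [x, y] is a combination of root vectors. *)
Lemma dfun_lie x y : x \in g -> y \in g -> dfun f x (lie x y) = 0.
Proof.
move=> gx gy; move: x gx; apply: line_poly_density_g => [|s a Gs _].
  apply: line_poly_sum => k _; apply: line_polyM.
    exact: (@line_poly_peval _ _ _ f^`M(k)).
  apply: line_poly_lin => u x z.
  by rewrite lieDl lieZl linearP.
have [y' gy' ->] := adj_ex Gs gy; have sU := G_unit Gs.
rewrite adj_lie // dfun_adj ?cartan_mem //; last by rewrite g_lie ?cartan_mem.
rewrite (decomp gy') linearD !linear_sum /= big1 ?add0r => [|i _]; last first.
  by rewrite linearZ /= lie_c scaler0.
rewrite dfun_sum big1 // => k _.
by rewrite linearZ /= lie_e !dfunZ dfun_root !mulr0.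
Qed.

Lemma grad_liecent x : x \in g -> grad f x \in liecent g x.
Proof.
move=> gx; have gf : grad f x \in g by apply: rep_mem.
rewrite mem_liecent gf; apply/eqP/g_nondeg => [|z gz]; first exact: g_lie.
rewrite tr_lie mxtrace_mulC tr_grad // ?g_lie // lieC.
by rewrite -scaleN1r dfunZ dfun_lie // mulr0.
Qed.

End InvariantDifferential.

Lemma dfun_cartan j a i :
  dfun (tnth p j) (cartan a) (c i) = (tnth P j)^`M(i).@[a].
Proof.
pose v k : F := (k == i)%:R.
rewrite -(@dfun_deriv _ _ _ _ _ _ (mline a v (tnth P j))) => [|t].
  rewrite deriv_mline0 (bigD1 i) //= big1 => [|k /negPf ki].
    by rewrite /v eqxx mulr1 addr0.
  by rewrite /v ki mulr0.
have vc : \sum_k v k *: c k = c i.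
  rewrite (bigD1 i) //= big1 => [|k /negPf ki]; last by rewrite /v ki scale0r.
  by rewrite /v eqxx scale1r addr0.
rewrite mline_horner -p_cartan; congr (peval _ _).
rewrite -vc scaler_sumr -big_split; apply: eq_bigr => k _ /=.
by rewrite scalerDl scalerA.
Qed.

(** * The bordered determinant of ad x *)

Section Bordered.
Variable rho : nat.
Implicit Type u : 'I_rho -> M.

(* The matrix of (y, c) |-> ([x, y] + sum_k c_k u_k, (tr (y u_k))_k); it is   *)
(* invertible iff ad x has corank rho and u is transverse to the centralizer. *)
Definition bordered (x : M) u : 'M[F]_((r + q) + rho) :=
  block_mx (\matrix_(i, j) coord b j (lie x b`_i)) (\matrix_(i, k) \tr (b`_i *m u k))
           (\matrix_(k, j) coord b j (u k)) 0.

Lemma eq_bordered x u v : (forall k, u k = v k) -> bordered x u = bordered x v.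
Proof. by move=> uv; congr block_mx; apply/matrixP => i j; rewrite !mxE uv. Qed.

Lemma line_poly_bordered u : line_poly (fun x => \det (bordered x u)).
Proof.
apply: line_poly_det => i j.
rewrite /bordered -(splitK i) -(splitK j).
case: (split i) => i'; case: (split j) => j' /=.
- apply: (@line_poly_ext _ _ (fun x => coord b j' (lie x b`_i'))).
    by move=> x; rewrite block_mxEul mxE.
  by apply: line_poly_lin => a x y; rewrite lieDl lieZl linearP.
- by apply: line_poly_const => x y; rewrite !block_mxEur.
- by apply: line_poly_const => x y; rewrite !block_mxEdl.
- by apply: line_poly_const => x y; rewrite !block_mxEdr.
Qed.

Lemma bordered_det0 x u : x \in g -> (forall k, u k \in g) ->
  (exists y (d : 'rV[F]_rho), [/\ y \in g, (y != 0) || (d != 0),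
     lie x y + \sum_k d 0 k *: u k = 0 & forall k, \tr (y *m u k) = 0])
  <-> \det (bordered x u) = 0.
Proof.
move=> gx gu.
have mulE (v : 'rV[F]_(r + q)) (d : 'rV[F]_rho) (y := \sum_i v 0 i *: b`_i) :
    row_mx v d *m bordered x u
    = row_mx (\row_j coord b j (lie x y + \sum_k d 0 k *: u k)) (\row_k \tr (y *m u k)).
  rewrite mul_row_block mulmx0 addr0; congr row_mx; apply/rowP => j; rewrite !mxE.
    have -> : lie x y = \sum_i v 0 i *: lie x b`_i.
      by rewrite linear_sum; apply: eq_bigr => i _; rewrite linearZ.
    rewrite linearD !linear_sum /=.
    by congr (_ + _); apply: eq_bigr => i _; rewrite mxE linearZ.
  rewrite mulmx_suml linear_sum; apply: eq_bigr => i _ /=.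
  by rewrite mxE -scalemxAl linearZ.
split=> [[y [d [gy ydN0 yd yu]]]|/eqP/det0P[vd]].
  apply/eqP/det0P; exists (row_mx (\row_i coord b i y) d).
    apply: contraTneq ydN0 => /eqP; rewrite row_mx_eq0 => /andP[/eqP y0 /eqP->].
    rewrite eqxx orbF negbK (coord_b gy) big1 // => i _.
    by move/rowP/(_ i): y0; rewrite !mxE => ->; rewrite scale0r.
  rewrite mulE (eq_bigr (fun i => coord b i y *: b`_i)) => [|i _]; last by rewrite mxE.
  rewrite -(coord_b gy) yd -[RHS]row_mx0; congr row_mx; apply/rowP => j; rewrite !mxE.
    exact: linear0.
  exact: yu.
rewrite -[vd]hsubmxK; set v := lsubmx vd; set d := rsubmx vd => vdN0.
rewrite mulE; set y := \sum_i _ => /eqP; rewrite row_mx_eq0 => /andP[/eqP yd /eqP yu].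
have gy : y \in g by apply: memv_suml => i _; rewrite memvZ ?mem_b.
exists y, d; split=> // [||k]; last by move/rowP/(_ k): yu; rewrite !mxE.
  apply: contraR vdN0; rewrite negb_or !negbK => /andP[/eqP y0 /eqP->].
  rewrite row_mx_eq0 eqxx andbT; apply/eqP/rowP => i.
  by rewrite [RHS]mxE -(coord_sum_free (fun i => v 0 i) i free_b) -/y y0 linear0.
have gw : lie x y + \sum_k d 0 k *: u k \in g.
  by apply: memvD; [exact: g_lie|apply: memv_suml => k _; rewrite memvZ].
rewrite (coord_b gw) big1 // => j _.
by move/rowP/(_ j): yd; rewrite !mxE => ->; rewrite scale0r.
Qed.

(** If T is the matrix of Ad s in the basis [b], then diag (T, 1) intertwines the two matrices,
    since Ad s preserves brackets and traces. *)
Lemma det_bordered_adj s x u : G s -> x \in g -> (forall k, u k \in g) ->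
  \det (bordered (adj s x) (fun k => adj s (u k))) = \det (bordered x u).
Proof.
move=> Gs gx gu; have sU := G_unit Gs.
pose T : 'M[F]_(r + q) := \matrix_(i, j) coord b j (adj s b`_i).
have TE y j : y \in g -> coord b j (adj s y) = \sum_i coord b i y * T i j.
  move=> gy; rewrite {1}(coord_b gy) !linear_sum; apply: eq_bigr => i _ /=.
  by rewrite mxE linearZ /= linearZ.
have TU : T \in unitmx.
  rewrite -row_free_unit; apply/inj_row_free => v vT0.
  pose y := \sum_i v 0 i *: b`_i.
  have gy : y \in g by apply: memv_suml => i _; rewrite memvZ ?mem_b.
  have yv i : coord b i y = v 0 i by rewrite (coord_sum_free (fun i => v 0 i)) ?free_b.
  have sy0 : adj s y = 0.
    rewrite (coord_b (G_adj Gs gy)) big1 // => j _.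
    rewrite TE //; move/rowP/(_ j): vT0; rewrite !mxE => vTj.
    by rewrite (eq_bigr (fun i => v 0 i * T i j)) ?vTj ?scale0r // => i _; rewrite yv.
  apply/rowP => i; rewrite mxE -yv -(adjK y sU) sy0 mulmx0 mul0mx.
  exact: linear0.
pose T1 := block_mx T 0 0 (1%:M : 'M[F]_rho).
have detT1 : \det T1 != 0 by rewrite det_ublock det1 mulr1 -unitfE -unitmxE.
apply: (mulfI detT1); rewrite [RHS]mulrC -!det_mulmx; congr (\det _).
rewrite /bordered !mulmx_block !mulmx0 !mul0mx !mul1mx !mulmx1 !addr0 !add0r.
congr block_mx; apply/matrixP => i j; rewrite !mxE.
- transitivity (coord b j (adj s (lie x b`_i))).
    rewrite -adj_lie // (coord_b (G_adj Gs (mem_b i))) !linear_sum.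
    by apply: eq_bigr => k _; rewrite !mxE linearZ /= linearZ.
  by rewrite TE ?g_lie ?mem_b //; apply: eq_bigr => k _; rewrite !mxE.
- rewrite -(adj_tr _ _ sU) (coord_b (G_adj Gs (mem_b i))) mulmx_suml linear_sum.
  by apply: eq_bigr => k _; rewrite !mxE -scalemxAl linearZ.
- by rewrite TE //; apply: eq_bigr => k _; rewrite !mxE.
Qed.

(** A centralizer of dimension above [rho] contains a nonzero [y] orthogonal to all the u_k, and (y,
    0) is then a kernel vector. *)
Lemma dim_liecent_le x u : x \in g -> (forall k, u k \in g) ->
  \det (bordered x u) != 0 -> (\dim (liecent g x) <= rho)%N.
Proof.
move=> gx gu; rewrite leqNgt; apply: contra => lt_dim; set Z := liecent g x in lt_dim *.
pose W := \matrix_(i < \dim Z, k < rho) \tr ((vbasis Z)`_i *m u k).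
have [v vW vN0] : exists2 v : 'rV_(\dim Z), (v <= kermx W)%MS & v != 0.
  apply/rowV0Pn; rewrite kermx_eq0 /row_free ltn_eqF //.
  exact: leq_ltn_trans (rank_leq_col W) lt_dim.
pose y := \sum_i v 0 i *: (vbasis Z)`_i.
have Zy : y \in Z by apply: memv_suml => i _; rewrite memvZ ?mem_vbasis_nth.
move: (Zy); rewrite mem_liecent => /andP[gy /eqP xy0].
apply/eqP/(bordered_det0 gx gu); exists y, 0; split=> // [||k].
- rewrite eqxx orbF; apply: contra vN0 => /eqP y0; apply/eqP/rowP => i.
  rewrite [RHS]mxE -(coord_sum_free (fun i => v 0 i) i (basis_free (vbasisP Z))).
  by rewrite -/y y0 linear0.
- by rewrite xy0 add0r big1 // => k _; rewrite mxE scale0r.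
move/sub_kermxP/rowP/(_ k): vW; rewrite !mxE => vWk.
rewrite mulmx_suml linear_sum -[RHS]vWk; apply: eq_bigr => i _ /=.
by rewrite -scalemxAl linearZ !mxE.
Qed.

End Bordered.

Lemma bordered_liecent x : x \in g -> exists u : 'I_(\dim (liecent g x)) -> M,
  (forall k, u k \in g) /\ \det (bordered x u) != 0.
Proof.
move=> gx; set Z := liecent g x; pose phi k v : F := coord (vbasis Z) k v.
(* The u_k are dual to a basis of the centralizer. Pairing the first kernel equation with the
   centralizer gives d = 0; then [y] centralizes [x], and its coordinates tr (y u_k) vanish. *)
exists (fun k => rep g (phi k)); have gu k : rep g (phi k) \in g by apply: rep_mem.
split=> //; apply/eqP => /(bordered_det0 gx gu)[y [d [gy ydN0 yd yu]]].
have Zg z : z \in Z -> z \in g by rewrite mem_liecent => /andP[].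
have tr_u k z : z \in g -> \tr (rep g (phi k) *m z) = coord (vbasis Z) k z.
  by move=> gz; rewrite repP // => a v w; rewrite /phi linearP.
have d0 : d = 0.
  apply/rowP => j; rewrite [RHS]mxE; set zj := (vbasis Z)`_j.
  have Zzj : zj \in Z by apply: mem_vbasis_nth.
  have /eqP xzj : lie x zj == 0 by move: Zzj; rewrite mem_liecent => /andP[].
  have : \tr ((lie x y + \sum_k d 0 k *: rep g (phi k)) *m zj) = 0.
    by rewrite yd mul0mx raddf0.
  rewrite mulmxDl raddfD /= lieC mulNmx raddfN /= -tr_lie xzj mulmx0 raddf0 oppr0 add0r.
  rewrite mulmx_suml linear_sum (bigD1 j) //= big1 => [|k kj].
    rewrite addr0 -scalemxAl linearZ /= tr_u; last exact: Zg.
    by rewrite (coord_free _ _ (basis_free (vbasisP Z))) eqxx mulr1.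
  rewrite -scalemxAl linearZ /= tr_u; last exact: Zg.
  by rewrite (coord_free _ _ (basis_free (vbasisP Z))) eq_sym (negPf kj) mulr0.
move: ydN0; rewrite d0 eqxx orbF => /negP[]; apply/eqP.
have Zy : y \in Z.
  rewrite mem_liecent gy /=; move: yd; rewrite d0 big1 ?addr0 => [->//|k _].
  by rewrite mxE scale0r.
by rewrite (coord_vbasis Zy) big1 // => k _; rewrite -tr_u // mxtrace_mulC yu scale0r.
Qed.

Lemma tr_c_u i y : y \in g -> \tr (c i *m y) = \sum_j \tr (c i *m c j) * coord b (lshift q j) y.
Proof.
move=> gy; rewrite {1}(decomp gy) mulmxDr raddfD /= !mulmx_sumr !linear_sum /=.
rewrite [X in _ + X]big1 ?addr0 => [|k _]; last first.
  by rewrite -scalemxAr linearZ /= tr_ce mulr0.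
by apply: eq_bigr => j _; rewrite -scalemxAr linearZ mulrC.
Qed.

Section BorderedCartan.
Variables (rho : nat) (a : 'I_r -> F) (u : 'I_rho -> M).
Hypothesis gu : forall k, u k \in g.

Lemma bordered_cartan : bordered (cartan a) u =
  block_mx (block_mx 0 0 0 (diag_mx (\row_k al k a)))
    (col_mx (\matrix_(i, k) \tr (c i *m u k)) (\matrix_(i, k) \tr (e i *m u k)))
    (row_mx (\matrix_(k, j) coord b (lshift q j) (u k))
            (\matrix_(k, j) coord b (rshift r j) (u k))) 0.
Proof.
rewrite /bordered; congr block_mx; apply/matrixP => i j; rewrite [LHS]mxE.
- rewrite -(splitK i) -(splitK j); case: (split i) => i'; case: (split j) => j' /=.
  + by rewrite block_mxEul b_c lie_c linear0 mxE.
  + by rewrite block_mxEur b_c lie_c linear0 mxE.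
  + rewrite block_mxEdl b_e lie_e linearZ /= -b_e (coord_free _ _ free_b) mxE.
    by rewrite eq_rlshift mulr0.
  rewrite block_mxEdr b_e lie_e linearZ /= -b_e (coord_free _ _ free_b) !mxE.
  by rewrite eq_rshift mulr_natr.
- rewrite -(splitK i); case: (split i) => i' /=; first by rewrite col_mxEu b_c mxE.
  by rewrite col_mxEd b_e mxE.
rewrite -(splitK j); case: (split j) => j' /=; first by rewrite row_mxEl mxE.
by rewrite row_mxEr mxE.
Qed.

End BorderedCartan.

(** With fewer than [r] border vectors some nonzero Cartan element is orthogonal to all of them; it
    commutes with [cartan a], so it yields a kernel vector. *)
Lemma det_bordered_small rho s a (u : 'I_rho -> M) : (rho < r)%N ->
  G s -> (forall k, u k \in g) -> \det (bordered (adj s (cartan a)) u) = 0.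
Proof.
move=> lt_r Gs gu.
pose u' k := invmx s *m u k *m s.
have gu' k : u' k \in g by apply: G_adjV.
have uE k : u k = adj s (u' k).
  by rewrite /adj /u' !mulmxA mulmxV ?G_unit // mul1mx mulmxK ?G_unit.
rewrite (eq_bordered _ uE) det_bordered_adj ?cartan_mem //.
pose W := \matrix_(i, k) \tr (c i *m u' k).
have [v vW vN0] : exists2 v : 'rV_r, (v <= kermx W)%MS & v != 0.
  apply/rowV0Pn; rewrite kermx_eq0 /row_free ltn_eqF //.
  exact: leq_ltn_trans (rank_leq_col W) lt_r.
apply/(bordered_det0 (cartan_mem a) gu'); exists (\sum_i v 0 i *: c i), 0; split=> [|||k].
- by apply: memv_suml => i _; rewrite memvZ ?c_mem.
- rewrite eqxx orbF; apply: contra vN0 => /eqP y0; apply/eqP/rowP => i.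
  rewrite [RHS]mxE -(linear0 (coord b (lshift q i))) -y0 linear_sum (bigD1 i) //=.
  rewrite big1 => [|j ji]; rewrite linearZ /= -b_c (coord_free _ _ free_b).
    by rewrite eqxx mulr1 addr0.
  by rewrite eq_lshift (negPf ji) mulr0.
- rewrite linear_sum big1 ?add0r => [|i _]; last by rewrite linearZ /= lie_c scaler0.
  by rewrite big1 // => k _; rewrite mxE scale0r.
move/sub_kermxP/rowP/(_ k): vW; rewrite !mxE => vWk.
rewrite mulmx_suml linear_sum -[RHS]vWk; apply: eq_bigr => i _ /=.
by rewrite -scalemxAl linearZ !mxE.
Qed.

Let simp := (@mulmx0, @mul0mx, @mulmx1, @mul1mx, @addr0, @add0r).

(** The permutation matrix exchanging the Cartan coordinates with the border coordinates; right
    multiplication by it makes [bordered (cartan a) u] block triangular. *)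
Definition swap_mx : 'M[F]_((r + q) + r) :=
  block_mx (block_mx 0 0 0 1%:M) (col_mx 1%:M 0) (row_mx 1%:M 0) 0.

Lemma det_swap_mx : \det swap_mx != 0.
Proof.
suff : \det (swap_mx *m swap_mx) != 0 by rewrite det_mulmx mulf_eq0 negb_or => /andP[].
have -> : swap_mx *m swap_mx = 1%:M; last by rewrite det1 oner_eq0.
rewrite /swap_mx mulmx_block [in RHS]scalar_mx_block; congr block_mx.
- by rewrite mulmx_block mul_col_row add_block_mx !simp -scalar_mx_block.
- by rewrite mul_block_col !simp col_mx0.
- by rewrite mul_row_block !simp row_mx0.
by rewrite mul_row_col !simp.
Qed.

Lemma det_bordered_cartan a (u : 'I_r -> M) : (forall k, u k \in g) ->
  \det (bordered (cartan a) u) * \det swap_mx =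
  \det (\matrix_(i, j) \tr (c i *m c j)) * (\prod_k al k a)
    * \det (\matrix_(k, j) coord b (lshift q j) (u k)) ^+ 2.
Proof.
move=> gu; rewrite -det_mulmx bordered_cartan //.
set D := diag_mx _; set V1 := \matrix_(i, k) \tr (c i *m u k); set V2 := \matrix_(_, _) _.
set U1 := \matrix_(_, _) coord _ (lshift _ _) _; set U2 := \matrix_(_, _) coord _ _ _.
have -> : block_mx (block_mx 0 0 0 D) (col_mx V1 V2) (row_mx U1 U2) 0 *m swap_mx
  = block_mx (block_mx V1 0 V2 D) 0 (row_mx 0 U2) U1.
  rewrite /swap_mx mulmx_block; congr block_mx.
  - by rewrite mulmx_block mul_col_row add_block_mx !simp.
  - by rewrite mul_block_col !simp col_mx0.
  - by rewrite mul_row_block !simp.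
  by rewrite mul_row_col !simp.
rewrite !det_lblock det_diag.
(* Root vectors are orthogonal to the c_i, so only Cartan coordinates enter the traces. Hence the
   determinant of [U1] appears twice. *)
have -> : V1 = (\matrix_(i, j) \tr (c i *m c j)) *m U1^T.
  apply/matrixP => i k; rewrite !mxE tr_c_u //.
  by apply: eq_bigr => j _; rewrite !mxE.
rewrite det_mulmx det_tr (eq_bigr (fun k => al k a)) => [|k _]; last by rewrite mxE.
by rewrite expr2; ring.
Qed.

Definition jac_mx x (u : 'I_r -> M) : 'M[F]_r := \matrix_(j, k) dfun (tnth p j) x (u k).

Lemma det_jac_cartan a u : (forall k, u k \in g) ->
  \det (jac_mx (cartan a) u) = \det (\matrix_(j, i) (tnth P j)^`M(i).@[a])
     * \det (\matrix_(k, j) coord b (lshift q j) (u k)).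
Proof.
move=> gu; rewrite -[X in _ = _ * X]det_tr -det_mulmx; congr (\det _).
apply/matrixP => j k; rewrite !mxE (decomp (gu k)) dfunD !dfun_sum.
rewrite [X in _ + X]big1 ?addr0 => [|l _]; last first.
  by rewrite dfunZ dfun_root ?mulr0.
by apply: eq_bigr => i _; rewrite dfunZ dfun_cartan !mxE mulrC.
Qed.

(** Both sides are polynomial along lines and invariant under simultaneous conjugation of [x] and
    [u], so it suffices to compare them at Cartan points. There each is an explicit multiple of the
    fourth power of the determinant of the Cartan coordinates of [u], and the factors agree by
    [jacobian]. *)
Lemma bordered_jac x u : x \in g -> (forall k, u k \in g) ->
  kappa * (\det swap_mx) ^+ 2 * \det (bordered x u) ^+ 2 =
  (\det (\matrix_(i, j) \tr (c i *m c j))) ^+ 2 * \det (jac_mx x u) ^+ 4.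
Proof.
move=> gx gu; apply/eqP; rewrite -subr_eq0 -mulNr; apply/eqP.
move: x gx; apply: line_poly_density_g => [|s a Gs oka].
  apply: line_polyD; apply: line_polyZ; first exact/line_poly_exp/line_poly_bordered.
  apply/line_poly_exp/line_poly_det => j k.
  apply: (line_poly_ext _ (line_poly_dfun (tnth p j) (u k))) => x.
  by rewrite mxE.
pose u' k := invmx s *m u k *m s.
have gu' k : u' k \in g by apply: G_adjV.
have uE k : u k = adj s (u' k).
  by rewrite /adj /u' !mulmxA mulmxV ?G_unit // mul1mx mulmxK ?G_unit.
have -> : \det (bordered (adj s (cartan a)) u) = \det (bordered (cartan a) u').
  by rewrite (eq_bordered _ uE) det_bordered_adj ?cartan_mem.
have -> : jac_mx (adj s (cartan a)) u = jac_mx (cartan a) u'.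
  by apply/matrixP => j k; rewrite !mxE uE dfun_adj ?cartan_mem.
apply/eqP; rewrite mulNr subr_eq0; apply/eqP.
rewrite -[LHS]mulrA -exprMn [_ * \det (bordered _ _)]mulrC det_bordered_cartan //.
by rewrite det_jac_cartan // !exprMn jacobian //; ring.
Qed.

(** Fewer than [r] border vectors give determinant zero on conjugates of Cartan points, hence
    everywhere by density, whereas dim z(x) suitable vectors give a nonzero determinant. *)
Lemma rank_le_dim_liecent x : x \in g -> (r <= \dim (liecent g x))%N.
Proof.
move=> gx; rewrite leqNgt; apply/negP => lt_r.
have [u [gu /negP[]]] := bordered_liecent gx; apply/eqP.
move: (\dim _) lt_r u gu => rho lt_r u gu.
move: x gx; apply: line_poly_density_g => [|s a Gs _]; first exact: line_poly_bordered.
exact: det_bordered_small.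
Qed.

Lemma free_grad_basic x : x \in g ->
  free [seq grad f x | f <- p] = (\dim (liecent g x) == r).
Proof.
move=> gx; have := rank_le_dim_liecent gx; rewrite leq_eqVlt eq_sym => r_le.
have grad_mem (f : polyfun g) : grad f x \in g by exact: rep_mem.
have pE : [seq grad f x | f <- p] = [tuple grad (tnth p j) x | j < r].
  by rewrite /= -{1}(map_tnth_enum p) -map_comp; apply: eq_map.
apply/idP/idP => [freep|/eqP dimr].
  (* Border vectors dual to the gradients make the Jacobian matrix the identity, so the bordered
     determinant is nonzero and dim z(x) <= r. *)
  pose phi j v : F := coord [tuple grad (tnth p j) x | j < r] j v.
  pose u j := rep g (phi j).
  have gu j : u j \in g by apply: rep_mem.
  have jac1 : jac_mx x u = 1%:M.
    apply/matrixP => j k; rewrite !mxE -(tr_grad _ _ g_nondeg) // mxtrace_mulC.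
    rewrite repP // => [|d v w]; last by rewrite /phi linearP.
    rewrite /phi -(tnth_mktuple (fun j => grad (tnth p j) x)) (tnth_nth 0).
    by rewrite coord_free -?pE // eq_sym.
  have := bordered_jac gx gu; rewrite jac1 det1 expr1n mulr1 => detE.
  have le_r := @dim_liecent_le _ x u gx gu.
  move: r_le; case: eqP => //= ne_r lt_r.
  suff /le_r : \det (bordered x u) != 0 by rewrite leqNgt lt_r.
  apply: contraTneq det_c => det0; move/eqP: detE.
  by rewrite det0 expr0n mulr0 eq_sym expf_eq0 /= negbK.
have [u [gu detN0]] := bordered_liecent gx.
rewrite dimr in u gu detN0.
have : \det (jac_mx x u) != 0.
  apply: contraTneq detN0 => jac0; have := bordered_jac gx gu.
  rewrite jac0 expr0n mulr0 => /eqP; rewrite !mulf_eq0 (negPf kappa_neq0).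
  by rewrite !orbb (negPf det_swap_mx) negbK.
rewrite pE => jacN0; set X := [tuple _ | _ < r]; apply/freeP => v v0.
pose w := \row_j v j.
have : w *m jac_mx x u = 0.
  apply/rowP => k; rewrite !mxE.
  transitivity (\tr ((\sum_(j < r) v j *: X`_j) *m u k)); last by rewrite v0 mul0mx raddf0.
  rewrite mulmx_suml linear_sum; apply: eq_bigr => j _.
  by rewrite -scalemxAl linearZ !mxE -tnth_nth tnth_mktuple /= tr_grad.
have jacU : jac_mx x u \in unitmx by rewrite unitmxE unitfE.
move/(congr1 (mulmxr (invmx (jac_mx x u)))); rewrite /= mulmxK // mul0mx => w0 j.
by move/rowP/(_ j): w0; rewrite !mxE.
Qed.

(** On [g], [p] and [psi] are polynomials in one another: [p] in [psi] because [psi] generates,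
    [psi] in [p] by Chevalley restriction and density. By the chain rule their gradients span the
    same space, and both families have [r] members, so they are free together. *)
Lemma kostant_of_cartan (psi : r.-tuple (polyfun g)) :
  free_generators G psi -> kostant_property psi.
Proof.
move=> [psi_gen _] x gx; split; last exact: rank_le_dim_liecent.
  move=> _ /mapP[f psi_f ->]; apply: grad_liecent => //.
  have /tnthP[j ->] := psi_f; apply/psi_gen; exists 'X_j.
  by rewrite comp_mpolyXU -tnth_nth.
rewrite -free_grad_basic //.
have span_sub (X Y : r.-tuple (polyfun g)) :
    (forall j, exists s : {mpoly F[r]}, forall z, z \in g ->
       peval (tnth X j) z = s.@[fun j => peval (tnth Y j) z]) ->
  (<<[seq grad f x | f <- X]>> <= <<[seq grad f x | f <- Y]>>)%VS.
  move=> XY; apply/span_subvP => _ /mapP[_ /tnthP[j ->] ->].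
  have [s Xs] := XY j.
  have -> : grad (tnth X j) x
      = \sum_i s^`M(i).@[fun j => peval (tnth Y j) x] *: grad (tnth Y i) x.
    apply: (nondeg_eq g_nondeg) => [||y gy]; first exact: rep_mem.
      by apply: memv_suml => i _; rewrite memvZ ?rep_mem.
    rewrite tr_grad // (dfun_comp Xs gx gy) mulmx_suml linear_sum /=.
    by apply: eq_bigr => i _; rewrite -scalemxAl linearZ /= tr_grad.
  apply: memv_suml => i _; apply/memvZ/memv_span/map_f; exact: mem_tnth.
have spanE : <<[seq grad f x | f <- psi]>>%VS = <<[seq grad f x | f <- p]>>%VS.
  apply/eqP; rewrite eqEsubv; apply/andP; split; apply: span_sub => j.
    have psi_inv : Ad_invariant G (tnth psi j).
      by apply/psi_gen; exists 'X_j; rewrite comp_mpolyXU -tnth_nth.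
    have [s sE] := chevalley psi_inv; exists s => z gz; apply/eqP.
    rewrite -subr_eq0 -mulrN1; apply/eqP; move: z gz.
    apply: line_poly_density_g => [|t a Gt _].
      apply: line_polyD; first exact: line_poly_peval.
      apply: line_polyM; last exact: line_poly_cst.
      by apply: line_poly_meval => i; apply: line_poly_peval.
    rewrite /adj psi_inv ?cartan_mem // sE mulrN1; apply/eqP; rewrite subr_eq0; apply/eqP.
    by apply: meval_eq => i; rewrite p_inv ?cartan_mem // p_cartan.
  have [s sE] := (psi_gen _).1 (p_inv j); exists s => z gz.
  by rewrite sE /peval comp_mpoly_meval.
by rewrite /free spanE !size_map !size_tuple.
Qed.

End CartanDatum.

(** * Matrix algebras embedded by a change of basis *)

Section Embedding.
Variables (F : numFieldType) (m n : nat) (L : 'M[F]_(n, m)) (K : 'M[F]_(m, n)).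
Hypothesis KL : K *m L = 1%:M.

(* A subalgebra of gl(m) placed in gl(n) by letting it act on the image of L  *)
(* and annihilate the kernel of K; groups act trivially on the kernel of K.   *)
Definition emb (X : 'M[F]_m) : 'M[F]_n := L *m X *m K.
Definition gemb (A : 'M[F]_m) : 'M[F]_n := L *m A *m K + (1%:M - L *m K).

Lemma emb_is_linear : linear emb.
Proof. by move=> a X Y; rewrite /emb mulmxDr mulmxDl -scalemxAr -scalemxAl. Qed.
HB.instance Definition _ := GRing.isLinear.Build F 'M[F]_m 'M[F]_n *:%R emb emb_is_linear.

Lemma embM X Y : emb X *m emb Y = emb (X *m Y).
Proof. by rewrite /emb !mulmxA -(mulmxA (L *m X)) KL mulmx1. Qed.

Lemma embK X : K *m emb X *m L = X.
Proof. by rewrite /emb !mulmxA KL mul1mx -mulmxA KL mulmx1. Qed.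

Lemma tr_emb X : \tr (emb X) = \tr X.
Proof. by rewrite /emb mxtrace_mulC mulmxA KL mul1mx. Qed.

Lemma lie_emb X Y : lie (emb X) (emb Y) = emb (lie X Y).
Proof. by rewrite /lie !embM raddfB. Qed.

Let N := 1%:M - L *m K.

Lemma embedding_compl : [/\ K *m N = 0, N *m L = 0 & N *m N = N].
Proof.
have KN : K *m N = 0 by rewrite mulmxBr mulmx1 mulmxA KL mul1mx subrr.
split=> //; first by rewrite mulmxBl mul1mx -mulmxA KL mulmx1 subrr.
by rewrite {1}/N mulmxBl mul1mx -mulmxA KN mulmx0 subr0.
Qed.

Lemma gembM A B : gemb A *m gemb B = gemb (A *m B).
Proof.
rewrite /gemb -/N; case: embedding_compl; move: N => N' KN NL NN.
rewrite mulmxDl !mulmxDr NN [_ *m (L *m B *m K)]embM -[_ *m N']mulmxA KN.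
by rewrite mulmx0 addr0 /emb !mulmxA NL !mul0mx add0r.
Qed.

Lemma gemb1 : gemb 1%:M = 1%:M.
Proof. by rewrite /gemb mulmx1 addrC subrK. Qed.

Lemma gemb_unit A : A \in unitmx -> gemb A \in unitmx.
Proof.
move=> AU; have /mulmx1_unit[] // : gemb A *m gemb (invmx A) = 1%:M.
by rewrite gembM mulmxV // gemb1.
Qed.

Lemma gembV A : A \in unitmx -> invmx (gemb A) = gemb (invmx A).
Proof.
move=> AU; rewrite -[RHS]mulmx1 -(mulmxV (gemb_unit AU)) mulmxA gembM mulVmx //.
by rewrite gemb1 mul1mx.
Qed.

Lemma gemb_emb A X : gemb A *m emb X = emb (A *m X).
Proof.
rewrite /gemb -/N; case: embedding_compl; move: N => N' KN NL NN.
by rewrite mulmxDl [L *m A *m K *m _]embM /emb !mulmxA NL !mul0mx addr0.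
Qed.

Lemma emb_gemb A X : emb X *m gemb A = emb (X *m A).
Proof.
rewrite /gemb -/N; case: embedding_compl; move: N => N' KN NL NN.
rewrite mulmxDr [_ *m (L *m A *m K)]embM {2}/emb -[_ *m N']mulmxA.
by rewrite KN mulmx0 addr0.
Qed.

Lemma adj_gemb A X : A \in unitmx -> adj (gemb A) (emb X) = emb (adj A X).
Proof. by move=> AU; rewrite /adj gembV // gemb_emb emb_gemb. Qed.

(** * Kostant's criterion for an embedded matrix model *)

Section Model.
Variables (g : {vspace 'M[F]_n}) (G : 'M[F]_n -> Prop).
Variables (model Gm : 'M[F]_m -> Prop) (S : {set 'I_m * 'I_m}).
Variables (bas : 'I_m -> 'I_m -> 'M[F]_m) (nu : F).
Hypotheses (gP : forall x, x \in g <-> model (K *m x *m L) /\ x = emb (K *m x *m L))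
  (model_decomp : forall X, model X -> X = \sum_(p in S) X p.1 p.2 *: bas p.1 p.2)
  (bas_model : forall i j, (i, j) \in S -> model (bas i j) /\ model (bas j i))
  (bas_coord : forall p p', p \in S -> p' \in S -> bas p.1 p.2 p'.1 p'.2 = (p == p')%:R)
  (tr_bas : forall X i j, model X -> (i, j) \in S -> \tr (bas j i *m X) = nu * X i j)
  (nu_neq0 : nu != 0)
  (model_lie : forall X Y, model X -> model Y -> model (lie X Y)).

Lemma emb_mem X : emb X \in g <-> model X.
Proof. by rewrite gP embK; split=> [[]|]. Qed.

Lemma emb_ex x : x \in g -> exists2 X, model X & x = emb X.
Proof. by move=> /gP[mX xE]; exists (K *m x *m L). Qed.

Lemma nondeg_model : nondeg g.
Proof.
move=> _ /emb_ex[X mX ->] trX0; suff -> : X = 0 by rewrite raddf0.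
rewrite [LHS]model_decomp // big1 // => -[i j] Sij /=.
have [_ mji] := bas_model Sij.
have := trX0 _ ((emb_mem (bas j i)).2 mji); rewrite embM tr_emb tr_bas // => /eqP.
by rewrite mulf_eq0 (negPf nu_neq0) => /eqP->; rewrite scale0r.
Qed.

Lemma lie_model x y : x \in g -> y \in g -> lie x y \in g.
Proof.
move=> /emb_ex[X mX ->] /emb_ex[Y mY ->]; rewrite lie_emb.
by apply/emb_mem/model_lie.
Qed.

Variables (r : nat) (w : 'I_r -> 'I_m).
Hypotheses (w_inj : injective w) (w_S : forall i, (w i, w i) \in S)
  (diag_S : forall i, (i, i) \in S -> exists k, i = w k).

Definition root_set := [set p in S | p.1 != p.2].
Local Notation q := #|root_set|.

(** Orders the positions in [S] with the diagonal ones, which span the Cartan subalgebra, before the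
    root positions. *)
Definition pos (i : 'I_(r + q)) : 'I_m * 'I_m :=
  match split i with inl j => (w j, w j) | inr k => enum_val k end.

Lemma pos_l i : pos (lshift q i) = (w i, w i).
Proof. by rewrite /pos (unsplitK (inl i)). Qed.

Lemma pos_r k : pos (rshift r k) = enum_val k.
Proof. by rewrite /pos (unsplitK (inr k)). Qed.

Lemma enum_root_set (k : 'I_q) : enum_val k \in S /\ (enum_val k).1 != (enum_val k).2.
Proof. by have := enum_valP k; rewrite inE => /andP[]. Qed.

Lemma pos_S i : pos i \in S.
Proof.
rewrite /pos; case: split => [j|k]; first exact: w_S.
by have [] := enum_root_set k.
Qed.

Lemma pos_inj : injective pos.
Proof.
move=> i j; rewrite -(splitK i) -(splitK j).
case: (split i) => i'; case: (split j) => j' /=; rewrite ?pos_l ?pos_r.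
- by case=> /w_inj->.
- by move=> ij; have [_] := enum_root_set j'; rewrite -ij eqxx.
- by move=> ij; have [_] := enum_root_set i'; rewrite ij eqxx.
by move/enum_val_inj->.
Qed.

Lemma pos_ex p : p \in S -> exists i, p = pos i.
Proof.
case: p => i j Sij; have [ij|ij] := eqVneq i j.
  have [k iE] := diag_S (etrans (congr1 (fun j => (i, j) \in S) ij) Sij).
  by exists (lshift q k); rewrite pos_l -iE -ij.
have Rij : (i, j) \in root_set by rewrite inE Sij.
by exists (rshift r (enum_rank_in Rij (i, j))); rewrite pos_r enum_rankK_in.
Qed.

Definition model_basis : (r + q).-tuple 'M[F]_n :=
  [tuple emb (bas (pos i).1 (pos i).2) | i < r + q].

Lemma model_basisE (i : 'I_(r + q)) : model_basis`_i = emb (bas (pos i).1 (pos i).2).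
Proof. by rewrite -tnth_nth tnth_mktuple. Qed.

Lemma basis_model : basis_of g model_basis.
Proof.
apply/andP; split.
  rewrite eqEsubv; apply/andP; split.
    apply/span_subvP => _ /tnthP[i ->]; rewrite tnth_mktuple; apply/emb_mem.
    by have := pos_S i; case: (pos i) => k l /bas_model[].
  apply/subvP => _ /emb_ex[X mX ->]; rewrite (model_decomp mX) raddf_sum /=.
  apply: memv_suml => p /pos_ex[i ->]; rewrite linearZ /= memvZ // -model_basisE.
  by apply: memv_span; rewrite mem_nth // size_tuple.
apply/freeP => v v0 k.
have : \sum_i v i *: bas (pos i).1 (pos i).2 = 0.
  transitivity (K *m (\sum_(i < r + q) v i *: model_basis`_i) *m L).
    rewrite -[LHS]embK raddf_sum /=; congr (K *m _ *m L).
    by apply: eq_bigr => i _; rewrite model_basisE linearZ.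
  by rewrite v0 mulmx0 mul0mx.
move/matrixP/(_ (pos k).1 (pos k).2); rewrite summxE !mxE (bigD1 k) //= big1.
  by rewrite !mxE bas_coord ?pos_S // eqxx mulr1 addr0.
move=> i ik; rewrite !mxE bas_coord ?pos_S // (inj_eq pos_inj) (negPf ik).
by rewrite mulr0.
Qed.

Lemma dim_model : \dim g = #|S|.
Proof.
rewrite (size_basis basis_model) -[LHS]card_ord -cardsT -(card_imset _ pos_inj).
apply: eq_card => p; apply/imsetP/idP => [[i _ ->]|/pos_ex[i ->]]; first exact: pos_S.
by exists i.
Qed.

Variable d : ('I_r -> F) -> 'I_m -> F.
Local Notation dm a := (diag_mx (\row_i d a i)).
Hypotheses
  (dm_eq : forall a, dm a = \sum_i a i *: bas (w i) (w i))
  (lie_dm_bas : forall a i j, (i, j) \in S ->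
     lie (dm a) (bas i j) = (d a i - d a j) *: bas i j).
Hypotheses (Gm_unit : forall A, Gm A -> A \in unitmx)
  (Gm_adj : forall A X, Gm A -> model X -> model (adj A X) /\ model (invmx A *m X *m A))
  (GP : forall s, G s <-> exists2 A, Gm A & s = gemb A).
Hypothesis Gm_torus : forall i j, (i, j) \in S -> i != j -> exists A tau,
  [/\ Gm A, tau != 1, forall k, adj A (bas (w k) (w k)) = bas (w k) (w k)
    & adj A (bas i j) = tau *: bas i j].
Variables (pf : 'I_r -> {mpoly F[m * m]}) (P : r.-tuple {mpoly F[r]}).
Local Notation pi j X := (pf j).@[fun k => mxvec X 0 k].
Variables (ok : ('I_r -> F) -> Prop) (kappa : F).
Hypotheses
  (pi_inv : forall j A X, Gm A -> model X -> pi j (adj A X) = pi j X)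
  (pi_dm : forall j a, pi j (dm a) = (tnth P j).@[a])
  (kappa_neq0 : kappa != 0)
  (jacobian : forall a, ok a ->
     (\det (\matrix_(j, i) (tnth P j)^`M(i).@[a])) ^+ 4
       = kappa * (\prod_(p in root_set) (d a p.1 - d a p.2)) ^+ 2)
  (chevalley : forall f : {mpoly F[r]},
     (forall A a a', Gm A -> adj A (dm a) = dm a' -> f.@[a'] = f.@[a]) ->
     exists s : {mpoly F[r]}, forall a, f.@[a] = s.@[fun j => (tnth P j).@[a]])
  (density : forall X, model X -> exists Z e, [/\ model Z, e != 0 :> {poly F}
     & forall t, e.[t] != 0 -> exists A a, [/\ Gm A, ok a & X + t *: Z = adj A (dm a)]]).

Let c i := emb (bas (w i) (w i)).
Let e (k : 'I_q) := emb (bas (enum_val k).1 (enum_val k).2).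

Lemma cartan_emb a : cartan c a = emb (dm a).
Proof.
by rewrite dm_eq raddf_sum; apply: eq_bigr => i _; rewrite /= linearZ.
Qed.

Lemma dm_model a : model (dm a).
Proof.
apply/emb_mem; rewrite dm_eq raddf_sum; apply: memv_suml => i _ /=.
by rewrite linearZ /= memvZ //; apply/emb_mem; have [] := bas_model (w_S i).
Qed.

(** A polynomial in the matrix entries is restricted to [g] by substituting the entries of K x L,
    which are linear in the coordinates of [x]. *)
Definition model_invariants : r.-tuple (polyfun g) :=
  [tuple pf j \mPo [tuple \sum_(l < \dim g)
     mxvec (K *m (vbasis g)`_l *m L) 0 k *: 'X_l | k < m * m] | j < r].

Lemma model_invariantsE j X : model X -> peval (tnth model_invariants j) (emb X) = pi j X.
Proof.
move=> /emb_mem gX; rewrite tnth_mktuple /peval comp_mpoly_meval; apply: meval_eq => k.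
rewrite tnth_mktuple raddf_sum -[in RHS](embK X) [in RHS](coord_vbasis gX) /=.
rewrite !(mulmx_sumr, mulmx_suml) !raddf_sum summxE /=; apply: eq_bigr => l _.
by rewrite mevalZ mevalXU -scalemxAr -scalemxAl linearZ mxE mulrC.
Qed.

Lemma kostant_model (psi : r.-tuple (polyfun g)) :
  free_generators G psi -> kostant_property psi.
Proof.
have G_ex s : G s -> exists2 A, Gm A & s = gemb A by move/GP.
have G_adj s y : G s -> y \in g -> adj s y \in g.
  move=> /G_ex[A GA ->] /emb_ex[X mX ->]; rewrite adj_gemb ?Gm_unit //.
  by apply/emb_mem; have [] := Gm_adj GA mX.
apply: (@kostant_of_cartan _ _ _ _ _ _ c e (fun k a => d a (enum_val k).1 - d a (enum_val k).2)
  model_basis _ _ basis_model nondeg_model lie_model _ _ _ _ _ G_adj _ _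
  model_invariants P ok kappa).
- by move=> i; rewrite model_basisE pos_l.
- by move=> k; rewrite model_basisE pos_r.
- by move=> a i; rewrite cartan_emb lie_emb lie_dm_bas // subrr scale0r raddf0.
- move=> a k; rewrite cartan_emb lie_emb.
  have [Sk _] := enum_root_set k; rewrite lie_dm_bas ?linearZ //.
  by case: (enum_val k) Sk.
- move=> i k; have [Sk k12] := enum_root_set k; rewrite embM tr_emb tr_bas //; last first.
    by case: (enum_val k) Sk => ? ? /bas_model[].
  rewrite (bas_coord (p' := (w i, w i))) //.
  by case: eqP => [kE|_]; [move: k12; rewrite kE eqxx|rewrite mulr0].
- suff -> : \matrix_(i, j) \tr (c i *m c j) = nu%:M by rewrite det_scalar expf_neq0.
  apply/matrixP => i j; rewrite !mxE embM tr_emb tr_bas //; last by have [] := bas_model (w_S j).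
  rewrite (bas_coord (p := (w j, w j)) (p' := (w i, w i))) // xpair_eqE andbb.
  by rewrite (inj_eq w_inj) eq_sym mulr_natr.
- by move=> s /G_ex[A GA ->]; rewrite gemb_unit ?Gm_unit.
- move=> s y /G_ex[A GA ->] /emb_ex[X mX ->].
  rewrite gembV ?Gm_unit // gemb_emb emb_gemb; apply/emb_mem.
  by have [] := Gm_adj GA mX.
- move=> k; have [Sk k12] := enum_root_set k.
  have [|A [tau [GA tau1 Ac Ae]]] := Gm_torus _ k12; first by case: (enum_val k) Sk.
  exists (gemb A), tau; split=> // [|i|]; first by apply/GP; exists A.
    by rewrite adj_gemb ?Gm_unit // Ac.
  by rewrite adj_gemb ?Gm_unit // Ae linearZ.
- move=> j s y /G_ex[A GA ->] /emb_ex[X mX ->]; rewrite -/(adj _ _).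
  rewrite adj_gemb ?Gm_unit // !model_invariantsE ?pi_inv //.
  by have [] := Gm_adj GA mX.
- by move=> j a; rewrite cartan_emb model_invariantsE ?pi_dm //; apply: dm_model.
- exact: kappa_neq0.
- by move=> a /jacobian->; rewrite big_enum_val.
- move=> f f_inv.
  (* The restriction of [f] to the Cartan subalgebra, as a polynomial in the parameters [a]. *)
  pose fh : {mpoly F[r]} := f \mPo [tuple \sum_i coord (vbasis g) k (c i) *: 'X_i | k < \dim g].
  have fhE a : fh.@[a] = peval f (cartan c a).
    rewrite comp_mpoly_meval; apply: meval_eq => k.
    rewrite tnth_mktuple raddf_sum linear_sum; apply: eq_bigr => i _ /=.
    by rewrite mevalZ mevalXU linearZ /= mulrC.
  have [A a a' GA|s sE] := @chevalley fh; last by exists s => a; rewrite -fhE.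
  rewrite !fhE !cartan_emb => <-; rewrite -adj_gemb ?Gm_unit // f_inv //; first by apply/GP; exists A.
  exact/emb_mem/dm_model.
move=> x /emb_ex[X mX ->]; have [Z [dd [mZ ddN0 ddP]]] := density mX.
exists (emb Z), dd; split=> // [|t /ddP[A [a [GA oka XZ]]]]; first exact/emb_mem.
exists (gemb A), a; split=> //; first by apply/GP; exists A.
by rewrite cartan_emb adj_gemb ?Gm_unit // -XZ raddfD /= linearZ.
Qed.

End Model.
End Embedding.

(** * Characteristic polynomials and elementary symmetric functions *)

Section GenericMatrix.
Variables (F : numFieldType) (m : nat).

Definition gen_mx : 'M[{mpoly F[m * m]}]_m := vec_mx (\row_k 'X_k).

Lemma meval_gen_mx (X : 'M[F]_m) : map_mx (meval (fun k => mxvec X 0 k)) gen_mx = X.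
Proof. by apply/matrixP => i j; rewrite !mxE mevalXU mxvecE. Qed.

Lemma meval_char_poly_coef (X : 'M[F]_m) k :
  ((char_poly gen_mx)`_k).@[fun k => mxvec X 0 k] = (char_poly X)`_k.
Proof.
by rewrite -[X in RHS]meval_gen_mx -map_char_poly coef_map.
Qed.

Lemma char_poly_adj (A X : 'M[F]_m) : A \in unitmx -> char_poly (adj A X) = char_poly X.
Proof.
move=> AU; rewrite /char_poly /char_poly_mx /adj.
have AA : map_mx polyC A *m map_mx polyC (invmx A) = 1%:M.
  by rewrite -map_mxM mulmxV // map_mx1.
have -> : 'X%:M - map_mx polyC (A *m X *m invmx A)
    = map_mx polyC A *m ('X%:M - map_mx polyC X) *m map_mx polyC (invmx A).
  by rewrite !map_mxM mulmxBr mulmxBl scalar_mxC -['X%:M *m _ *m _]mulmxA AA mulmx1.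
by rewrite !det_mulmx mulrAC -det_mulmx AA det1 mul1r.
Qed.

Lemma char_poly_diag (d : 'I_m -> F) :
  char_poly (diag_mx (\row_i d i)) = \prod_(i < m) ('X - (d i)%:P).
Proof.
rewrite char_poly_trig ?diag_mx_is_trig //.
by apply: eq_bigr => i _; rewrite !mxE eqxx mulr1n.
Qed.

Lemma tr_delta_mul (X : 'M[F]_m) i j : \tr (delta_mx j i *m X) = X i j.
Proof.
rewrite /mxtrace (bigD1 j) //= big1 => [|k /negPf kj].
  rewrite !mxE (bigD1 i) //= big1 => [|l /negPf li]; rewrite !mxE ?eqxx ?mul1r ?addr0 //.
  by rewrite li andbF mul0r.
by rewrite mxE big1 // => l _; rewrite mxE kj mul0r.
Qed.

Lemma adj_perm_diag (s : 'S_m) (d : 'I_m -> F) :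
  adj (perm_mx s) (diag_mx (\row_i d i)) = diag_mx (\row_i d (s i)).
Proof.
suff E : perm_mx s *m diag_mx (\row_i d i) = diag_mx (\row_i d (s i)) *m perm_mx s.
  by rewrite /adj E mulmxK ?unitmx_perm.
rewrite mul_mx_diag mul_diag_mx; apply/matrixP => i j; rewrite !mxE.
by case: eqP => [->|_]; rewrite ?mul0r ?mulr0 // mulrC.
Qed.

End GenericMatrix.

Section ElementarySymmetric.
Variables (F : numFieldType) (r : nat).
Local Notation es k := (mesym r F k).
Implicit Type a : 'I_r -> F.

Lemma mesym_coeff a (j : 'I_r) :
  (es j.+1).@[a] = (-1) ^+ j.+1 * (\prod_(i < r) ('X - (a i)%:P))`_(r - j.+1).
Proof.
have jr : (j.+1 < r.+1)%N by rewrite ltnS.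
have := mroots_coeff [tuple a i | i < r] (Ordinal jr).
rewrite big_tuple (eq_bigr (fun i => 'X - (a i)%:P)) => [/= ->|i _]; last first.
  by rewrite tnth_mktuple.
rewrite mulrA -expr2 sqrr_sign mul1r.
by apply: meval_eq => i; rewrite tnth_mktuple.
Qed.

(** An elementary symmetric polynomial is affine in each variable, and its slope in the i-th one is
    elementary symmetric in the others. *)
Lemma mderiv_mesym a (i j : 'I_r) : (es j.+1)^`M(i).@[a] =
  (-1) ^+ j * (\prod_(k < r | k != i) ('X - (a k)%:P))`_(r - j.+1).
Proof.
pose v k : F := (k == i)%:R; set Q := \prod_(k < r | _) _.
set s := (es j.+1).
have -> : s^`M(i).@[a] = (mline a v s)^`().[0].
  rewrite deriv_mline0 (bigD1 i) //= big1 => [|k /negPf ki]; last by rewrite /v ki mulr0.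
  by rewrite /v eqxx mulr1 addr0.
pose C := (-1) ^+ j.+1 * (('X - (a i)%:P) * Q)`_(r - j.+1).
have -> : mline a v s = C%:P + ((-1) ^+ j * Q`_(r - j.+1)) *: 'X.
  apply/eqP; rewrite -subr_eq0; apply/eqP/horner_eq0_poly => t.
  rewrite hornerD hornerN mline_horner hornerD hornerC hornerZ hornerX mesym_coeff.
  rewrite (bigD1 i) //= (eq_bigr (fun k => 'X - (a k)%:P)) => [|k /negPf ki]; last first.
    by rewrite /v ki mulr0 addr0.
  rewrite -/Q /v eqxx mulr1 polyCD opprD addrA [in X in X - _]mulrDl mulNr coefD coefN.
  by rewrite mul_polyC coefZ /C exprS; ring.
by rewrite derivD derivC add0r derivZ derivX alg_polyC hornerC.
Qed.

Definition vdm a : F := \prod_(i < r) \prod_(j < r | (i < j)%N) (a j - a i).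

Lemma vdm_neq0 a : injective a -> vdm a != 0.
Proof.
move=> ainj; apply/prodf_neq0 => i _; apply/prodf_neq0 => j ij.
by rewrite subr_eq0 (inj_eq ainj) -val_eqE /= gtn_eqF.
Qed.

Lemma prod_neq_vdm a : \prod_(i < r) \prod_(k < r | k != i) (a i - a k)
  = (\prod_(i < r) \prod_(j < r | (i < j)%N) -1) * vdm a ^+ 2.
Proof.
have splitE : \prod_(i < r) \prod_(k < r | k != i) (a i - a k) =
    \prod_(i < r) (\prod_(k < r | (i < k)%N) (a i - a k) * \prod_(k < r | (k < i)%N) (a i - a k)).
  apply: eq_bigr => i _; rewrite (bigID (fun k : 'I_r => (i < k)%N)) /=.
  by congr (_ * _); apply: eq_bigl => k; rewrite -val_eqE /=; case: ltngtP.
rewrite splitE big_split /= [X in _ * X](exchange_big_dep predT) //=.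
rewrite expr2 mulrA -!big_split /=; apply: eq_bigr => i _.
rewrite -!big_split; apply: eq_bigr => k _ /=; by ring.
Qed.

(** Multiplying the transposed Jacobian by signs and by a Vandermonde matrix evaluates the product
    of the X - a_k over k != i at a_l, so the result is diagonal ([JV]). Its determinant is, up to
    sign, [vdm a ^+ 2], and one factor [vdm a] cancels. *)
Lemma det_jac_mesym a : injective a ->
  (\det (\matrix_(j < r, i < r) (es j.+1)^`M(i).@[a])) ^+ 2 = vdm a ^+ 2.
Proof.
move=> ainj; set J := \matrix_(_, _) _.
pose V : 'M[F]_r := \matrix_(j, l) a l ^+ (r - j.+1).
pose E : 'M[F]_r := diag_mx (\row_(j < r) (-1) ^+ j).
have JV : J^T *m E *m V = diag_mx (\row_i \prod_(k < r | k != i) (a i - a k)).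
  rewrite mul_mx_diag; apply/matrixP => i l; rewrite !mxE.
  transitivity ((\prod_(k < r | k != i) ('X - (a k)%:P)).[a l]).
    set Q := \prod_(_ < _ | _) _.
    have sQ : (size Q <= r)%N.
      have := size_char_poly (diag_mx (\row_k a k)); rewrite char_poly_diag (bigD1 i) //= -/Q.
      have QN0 : Q != 0 by rewrite monic_neq0 // monic_prod // => k _; apply: monicXsubC.
      by rewrite mulrC (size_Mmonic QN0 (monicXsubC _)) size_XsubC addn2 => -[->].
    rewrite (horner_coef_wide _ sQ) [RHS](reindex_inj rev_ord_inj) /=.
    apply: eq_bigr => j _; rewrite !mxE mderiv_mesym -/Q /=.
    by rewrite [X in X * _]mulrAC -expr2 sqrr_sign mul1r.
  rewrite horner_prod; have [->|il] := eqVneq i l.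
    by rewrite mulr1n; apply: eq_bigr => k _; rewrite !hornerE.
  by rewrite mulr0n (bigD1 l) 1?eq_sym //= !hornerE subrr mul0r.
have detV : (\det V) ^+ 2 = vdm a ^+ 2.
  have -> : V = row_perm (perm (@rev_ord_inj r)) (Vandermonde r (\row_i a i)).
    by apply/matrixP => j l; rewrite !mxE permE.
  rewrite row_permE det_mulmx exprMn det_perm sqrr_sign mul1r det_Vandermonde.
  by congr (_ ^+ 2); apply: eq_bigr => i _; apply: eq_bigr => j _; rewrite !mxE.
have detE : (\det E) ^+ 2 = 1.
  rewrite det_diag -prodrXl big1 // => i _; by rewrite mxE sqrr_sign.
have := congr1 (fun A => (\det A) ^+ 2) JV.
rewrite /= !det_mulmx det_tr !exprMn detE detV mulr1 det_diag.
rewrite (eq_bigr (fun i => \prod_(k < r | k != i) (a i - a k))) => [|i _]; last by rewrite mxE.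
rewrite prod_neq_vdm exprMn.
set e := \prod_(_ < _) _; have -> : e ^+ 2 = 1.
  rewrite -prodrXl big1 // => i _; rewrite -prodrXl big1 // => k _.
  by rewrite sqrrN expr1n.
by rewrite mul1r [RHS]expr2; apply: mulIf; rewrite expf_neq0 ?vdm_neq0.
Qed.

End ElementarySymmetric.

Section Symmetric.
Variables (F : numFieldType) (r : nat).
Local Notation es k := (mesym r F k).

Lemma symmetric_of_meval (f : {mpoly F[r]}) :
  (forall (s : 'S_r) a, f.@[fun i => a (s i)] = f.@[a]) -> f \is mpoly.symmetric.
Proof.
move=> fs; apply/issymP => s; apply: mpoly_eval_inj => a.
have := msym_mPo s f [tuple 'X_i | i < r]; rewrite comp_mpoly_id => ->.
rewrite comp_mpoly_meval -[RHS](fs s); apply: meval_eq => i.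
by rewrite !tnth_mktuple mevalXU.
Qed.

Lemma mesym_generate (f : {mpoly F[r]}) : f \is mpoly.symmetric ->
  exists s : {mpoly F[r]}, forall a, f.@[a] = s.@[fun j : 'I_r => (es j.+1).@[a]].
Proof.
move=> /sym_fundamental[s [sE _]]; exists s => a; rewrite -sE comp_mpoly_meval.
by apply: meval_eq => i; rewrite tnth_mktuple.
Qed.

End Symmetric.

(** * Simple spectrum along a line, and diagonalization *)

Section SeparableLine.
Variables (F : numFieldType) (m : nat).
Hypothesis m_gt0 : (0 < m)%N.

(** [e] is the discriminant along the line, as a resultant over the polynomials in t. Specializing t
    commutes with the resultant because the leading coefficients 1 and m of the two polynomials do
    not vanish. *)
Lemma separable_line (X Z : 'M[F]_m) : exists e : {poly F},
  forall t, (e.[t] != 0) = separable_poly (char_poly (X + t *: Z)).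
Proof.
pose W : 'M[{poly F}]_m := map_mx polyC X + 'X *: map_mx polyC Z.
exists (resultant (char_poly W) (char_poly W)^`()) => t.
have WE : map_mx (horner_eval t) W = X + t *: Z.
  by apply/matrixP => i j; rewrite !mxE /horner_eval !hornerE.
have leadE (K : comNzRingType) (A : 'M[K]_m) : m%:R != 0 :> K ->
    lead_coef (char_poly A)^`() = m%:R.
  move=> mN0; have cm : (char_poly A)^`()`_m.-1 = m%:R.
    have := char_poly_monic A; rewrite coef_deriv monicE lead_coefE size_char_poly.
    by rewrite prednK //= => /eqP->.
  have sz : size (char_poly A)^`() = m.
    apply/eqP; rewrite eqn_leq; apply/andP; split.
      by rewrite -ltnS -(size_char_poly A) lt_size_deriv // -size_poly_gt0 size_char_poly.
    rewrite leqNgt; apply: contra mN0 => lt_m.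
    have /leq_sizeP/(_ _ (leqnn _)) : (size (char_poly A)^`() <= m.-1)%N.
      by rewrite -ltnS prednK.
    by rewrite cm => ->.
  by rewrite lead_coefE sz cm.
have mN0 (K : numFieldType) : m%:R != 0 :> K by rewrite pnatr_eq0 -lt0n.
rewrite -[_.[t]]/(horner_eval t _) map_resultant.
- rewrite -deriv_map map_char_poly WE resultant_eq0 -leqNgt separable_poly.unlock /coprimep.
  rewrite eqn_leq andbC lt0n size_poly_eq0 gcdp_eq0 negb_and.
  by rewrite monic_neq0 ?char_poly_monic.
- by rewrite (monicP (char_poly_monic _)) rmorph1 oner_eq0.
have mP : (m%:R : {poly F}) != 0 by rewrite -polyC_natr polyC_eq0 mN0.
by rewrite (leadE _ _ mP) rmorph_nat mN0.
Qed.

End SeparableLine.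

Section Diagonalization.
Variables (F : numClosedFieldType) (m : nat).

Lemma char_poly_roots (X : 'M[F]_m) : separable_poly (char_poly X) ->
  exists rs, [/\ uniq rs, size rs = m & char_poly X = \prod_(z <- rs) ('X - z%:P)].
Proof.
have [rs rsE] := closed_field_poly_normal (char_poly X).
rewrite (monicP (char_poly_monic X)) scale1r in rsE.
rewrite rsE separable_prod_XsubC => urs; exists rs; split=> //.
by apply/eqP; rewrite -eqSS -(size_char_poly X) rsE (size_prod_XsubC rs id).
Qed.

Lemma diagonalization (X : 'M[F]_m) (d : 'I_m -> F) : injective d ->
  (forall i, root (char_poly X) (d i)) ->
  exists2 A, A \in unitmx & X = adj A (diag_mx (\row_i d i)).
Proof.
move=> d_inj Xd.
have eig i : exists v : 'rV[F]_m, v *m X = d i *: v /\ v != 0.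
  have /eigenvalueP[v] : eigenvalue X (d i) by rewrite eigenvalue_root_char.
  by exists v.
have [v vP] := fin_all_exists eig.
pose W : 'M[F]_m := \matrix_i v i; pose D : 'M[F]_m := diag_mx (\row_i d i).
have rowW i : row i W = v i by rewrite rowK.
have WX : W *m X = D *m W.
  apply/row_matrixP => i; rewrite !row_mul rowW row_diag_mx -scalemxAl -rowE rowW mxE.
  by have [] := vP i.
have WU : W \in unitmx.
  rewrite -row_free_unit; apply/inj_row_free => c cW; apply/rowP => i.
  have [vi viN0] := vP i; rewrite [RHS]mxE; apply/eqP.
  have /mxdirect_sumsP/(_ i isT) capi : mxdirect (\sum_(i | predT i) eigenspace X (d i))%MS.
    by apply: mxdirect_sum_eigenspace => k l _ _ /d_inj.
  have : (c 0 i *: v i <= (0 : 'M[F]_m))%MS.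
    rewrite -capi sub_capmx scalemx_sub; last by apply/eigenspaceP.
    have -> : c 0 i *: v i = - \sum_(j | j != i) c 0 j *: v j.
      apply/eqP; rewrite -subr_eq0 opprK; apply/eqP; transitivity (c *m W) => //.
      rewrite mulmx_sum_row [RHS](bigD1 i) //= rowW; congr (_ + _).
      by apply: eq_bigr => j _; rewrite rowW.
    rewrite eqmx_opp summx_sub // => j ji; rewrite scalemx_sub //.
    by apply: (sumsmx_sup j) => //; apply/eigenspaceP; have [] := vP j.
  by rewrite submx0 scaler_eq0 (negPf viN0) orbF.
exists (invmx W); first by rewrite unitmx_inv.
by rewrite /adj invmxK -mulmxA -WX mulKmx.
Qed.



End Diagonalization.

(** * General linear algebras *)

Section GeneralLinearKostant.
Variables (F : numClosedFieldType) (n m : nat).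
Hypotheses (m_gt0 : (0 < m)%N) (mn : (m <= n)%N).

Definition corner_inj : 'M[F]_(n, m) := \matrix_(k, l) (k == l :> nat)%:R.
Local Notation L := corner_inj.
Local Notation K := L^T.

Lemma corner_injK : K *m L = 1%:M.
Proof.
apply/matrixP => k l; rewrite !mxE (bigD1 (widen_ord mn k)) //= big1 => [|j jk].
  by rewrite !mxE /= eqxx mul1r addr0.
by rewrite !mxE; case: eqP => [jk'|]; rewrite ?mul0r //; case/eqP: jk; apply: val_inj.
Qed.

Definition corner_proj : 'M[F]_n := diag_mx (\row_k (k < m)%N%:R).

Lemma corner_projE : L *m K = corner_proj.
Proof.
apply/matrixP => k l; rewrite !mxE; have [km|mk] := ltnP k m.
  rewrite (bigD1 (Ordinal km)) //= big1 => [|j jk].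
    by rewrite !mxE /= eqxx mul1r addr0 -val_eqE eq_sym; case: eqP.
  rewrite !mxE; case: eqP => [jk'|]; rewrite ?mul0r //.
  by case/eqP: jk; apply: val_inj.
rewrite mul0rn big1 // => j _; rewrite !mxE; case: eqP => [kj|]; rewrite ?mul0r //.
by move: mk; rewrite kj leqNgt ltn_ord.
Qed.

Lemma corner_embE x k l : emb L K (K *m x *m L) k l = x k l *+ ((k < m) && (l < m))%N.
Proof.
rewrite /emb !mulmxA corner_projE -mulmxA corner_projE mul_diag_mx mul_mx_diag !mxE.
by case: (k < m)%N; case: (l < m)%N; rewrite ?mulr1 ?mulr0 ?mul1r ?mul0r.
Qed.

Lemma gl_corner_emb x :
  x \in gl_corner F n m <-> True /\ x = emb L K (K *m x *m L).
Proof.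
split=> [/mem_gl_corner x0|[_ ->]].
  split=> //; apply/matrixP => k l; rewrite corner_embE.
  by case: (boolP (_ && _)) => [_|/x0 ->]; rewrite ?mulr1n ?mulr0n.
by apply/mem_gl_corner => k l kl; rewrite corner_embE (negPf kl).
Qed.

Lemma GL_corner_gemb s : GL_corner m s <-> exists2 A, A \in unitmx & s = gemb L K A.
Proof.
split=> [[sU s1]|[A AU ->]]; last first.
  split=> [|k l kl]; first exact: gemb_unit corner_injK _ AU.
  have := corner_embE (emb L K A) k l.
  rewrite (embK corner_injK) (negPf kl) mulr0n => A0.
  rewrite /gemb mxE -/(emb L K A) A0 add0r corner_projE !mxE.
  move: kl; case: eqP => [<-|_]; rewrite ?andbb ?subr0 //.
  by case: ltnP; rewrite ?subr0.
have sP : s *m corner_proj = corner_proj *m s.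
  rewrite mul_mx_diag mul_diag_mx; apply/matrixP => k l; rewrite !mxE.
  case: (boolP ((k < m) && (l < m))%N) => [/andP[-> ->]|kl]; first by rewrite mulr1 mul1r.
  by rewrite (s1 _ _ kl); case: (eqVneq k l) kl => [->|kl _]; rewrite ?mulr0 ?mul0r // mulrC.
pose A := K *m s *m L.
have AU : A \in unitmx.
  have /mulmx1_unit[] // : A *m (K *m invmx s *m L) = 1%:M.
  rewrite /A !mulmxA -(mulmxA (K *m s) L K) corner_projE -(mulmxA K s) sP.
  rewrite -corner_projE !mulmxA corner_injK mul1mx -!mulmxA (mulmxA s) mulmxV //.
  by rewrite mul1mx corner_injK.
exists A => //; apply/matrixP => k l; rewrite /gemb mxE -/(emb L K A) corner_embE.
rewrite corner_projE !mxE; case: (boolP (_ && _)) => [/andP[-> _]|kl].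
  by rewrite subrr mulr1n addr0.
rewrite (s1 _ _ kl) mulr0n add0r; move: kl; case: eqP => [<-|_]; rewrite ?andbb.
  by move/negPf ->; rewrite subr0.
by rewrite ?mulr0n ?subr0 ?mulr0n ?subrr.
Qed.

Local Notation g := (gl_corner F n m).
Local Notation model := (fun _ : 'M[F]_m => True).
Local Notation S := [set: 'I_m * 'I_m].
Local Notation bas := (@delta_mx F m m).

Lemma gl_decomp (X : 'M[F]_m) : X = \sum_(p in S) X p.1 p.2 *: bas p.1 p.2.
Proof.
rewrite {1}[X]matrix_sum_delta pair_big /=; apply: eq_bigl => p; by rewrite inE.
Qed.

Lemma gl_bas_coord (p p' : 'I_m * 'I_m) : p \in S -> p' \in S ->
  bas p.1 p.2 p'.1 p'.2 = (p == p')%:R.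
Proof. by case: p => i j; case: p' => k l _ _; rewrite mxE xpair_eqE !(eq_sym k) !(eq_sym l). Qed.

Lemma gl_tr_bas (X : 'M[F]_m) i j : \tr (bas j i *m X) = 1 * X i j.
Proof.
by rewrite mul1r tr_delta_mul.
Qed.

Lemma gl_nondeg : nondeg g.
Proof.
apply: (nondeg_model (model := model) corner_injK gl_corner_emb (nu := 1) (bas := bas) (S := S)) => //.
- by move=> X _; apply: gl_decomp.
- by move=> X i j _ _; apply: gl_tr_bas.
exact: oner_neq0.
Qed.

Lemma gl_lie x y : x \in g -> y \in g -> lie x y \in g.
Proof. by apply: (lie_model (model := model) corner_injK gl_corner_emb). Qed.

Lemma gl_dim : \dim g = (m * m)%N.
Proof.
transitivity #|S|; last by rewrite cardsT card_prod card_ord.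
apply: (@dim_model _ _ _ _ _ corner_injK g model S bas gl_corner_emb _ _ gl_bas_coord m id).
- by move=> X _; apply: gl_decomp.
- by [].
- by [].
- by move=> i; rewrite inE.
by move=> i _; exists i.
Qed.

Lemma gl_kostant (psi : m.-tuple (polyfun g)) :
  free_generators (@GL_corner F n m) psi -> kostant_property psi.
Proof.
have dmE (a : 'I_m -> F) : diag_mx (\row_i a i) = \sum_i a i *: bas i i.
  apply/matrixP => k l; rewrite summxE !mxE (bigD1 k) //= big1 => [|i /negPf ik].
    by rewrite !mxE eqxx /= addr0 eq_sym mulr_natr.
  by rewrite !mxE eq_sym ik mulr0.
(* Signed so as to restrict to the elementary symmetric polynomials on diagonal matrices. *)
pose pf (j : 'I_m) : {mpoly F[m * m]} :=
  (-1) ^+ j.+1 *: (char_poly (gen_mx F m))`_(m - j.+1).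
have pfE j (X : 'M[F]_m) : (pf j).@[fun k => mxvec X 0 k]
    = (-1) ^+ j.+1 * (char_poly X)`_(m - j.+1).
  by rewrite mevalZ meval_char_poly_coef.
pose e : F := \prod_(i < m) \prod_(j < m | (i < j)%N) -1.
have e2 : e * e = 1.
  by rewrite -expr2 -prodrXl big1 // => i _; rewrite -prodrXl big1 // => j _; rewrite sqrrN expr1n.
apply: (@kostant_model _ _ _ _ _ corner_injK g _ model (fun A => A \in unitmx) S bas 1
  gl_corner_emb _ _ gl_bas_coord _ (oner_neq0 _) _ m id _ _ _ (fun a => a) _ _ _ _
  GL_corner_gemb _ pf [tuple mesym m F i.+1 | i < m] (fun a => injective a) 1).
- by move=> X _; apply: gl_decomp.
- by [].
- by move=> X i j _ _; apply: gl_tr_bas.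
- by [].
- by [].
- by move=> i; rewrite inE.
- by move=> i _; exists i.
- by move=> a; rewrite dmE.
- move=> a i j _; rewrite /lie mul_diag_mx mul_mx_diag; apply/(@matrixP F m m) => k l; rewrite !mxE.
  by case: (eqVneq k i) => [->|_]; case: (eqVneq l j) => [->|_] /=; ring.
- by [].
- by [].
(* The torus element doubling the i-th coordinate scales the matrix unit at (i, j) by 2. *)
- move=> i j _ ij; pose t k : F := if k == i then 2 else 1.
  have tN0 k : t k != 0 by rewrite /t; case: ifP => _; rewrite ?oner_neq0 ?pnatr_eq0.
  exists (diag_mx (\row_k t k)), 2.
  have tU : diag_mx (\row_k t k) \in unitmx.
    rewrite unitmxE unitfE det_diag; apply/prodf_neq0 => k _.
    by rewrite mxE.
  have tbas k l : diag_mx (\row_k t k) *m bas k l = (t k / t l) *: bas k l *m diag_mx (\row_k t k).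
    rewrite mul_diag_mx mul_mx_diag; apply/matrixP => u v; rewrite !mxE.
    case: (eqVneq u k) => [->|_]; case: (eqVneq v l) => [->|_] /=; rewrite ?mulr0 ?mul0r //.
    by rewrite !mulr1 divfK.
  split=> // [|k|].
  - by rewrite -subr_eq0 -[2]/(1 + 1) addrK oner_neq0.
  - by rewrite /adj tbas divff // scale1r mulmxK.
  by rewrite /adj tbas mulmxK // /t eqxx eq_sym (negPf ij) divr1.
- by move=> j A X AU _; rewrite !pfE char_poly_adj.
- by move=> j a; rewrite pfE char_poly_diag tnth_mktuple mesym_coeff.
- exact: oner_neq0.
- move=> a a_inj.
  have -> : \matrix_(j, i) (tnth [tuple mesym m F i.+1 | i < m] j)^`M(i).@[a]
      = \matrix_(j, i) (mesym m F j.+1)^`M(i).@[a].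
    by apply/matrixP => j i; rewrite !mxE tnth_mktuple.
  rewrite (exprM _ 2 2) det_jac_mesym //.
  have -> : \prod_(p in root_set S) (a p.1 - a p.2) = \prod_(i < m) \prod_(k < m | k != i) (a i - a k).
    rewrite pair_big_dep /=; apply: eq_bigl => p; by rewrite !inE eq_sym.
  by rewrite prod_neq_vdm -/e (exprMn _ e) (expr2 e) e2 !mul1r.
- move=> f fW; have fsym : f \is mpoly.symmetric.
    apply: symmetric_of_meval => s a; apply: (fW (perm_mx s)); first exact: unitmx_perm.
    exact: adj_perm_diag.
  have [s sE] := mesym_generate fsym; exists s => a; rewrite sE.
  by apply: meval_eq => j; rewrite tnth_mktuple.
(* The line joins [X] to a diagonal matrix with distinct entries, reached at t = 1; so the
   discriminant along it is not the zero polynomial. *)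
move=> X _; pose a0 (i : 'I_m) : F := i%:R.
have a0_inj : injective a0 by move=> i j /eqP; rewrite eqr_nat => /eqP/val_inj.
have [d dP] := separable_line m_gt0 X (diag_mx (\row_i a0 i) - X).
exists (diag_mx (\row_i a0 i) - X), d; split=> // [|t].
  suff : d.[1] != 0 by apply: contraNneq => ->; rewrite horner0.
  rewrite dP scale1r addrC subrK char_poly_diag.
  rewrite -(big_map a0 predT (fun z => 'X - z%:P)) separable_prod_XsubC.
  by rewrite map_inj_uniq ?index_enum_uniq.
rewrite dP => sep; have [rs [urs srs rsE]] := char_poly_roots sep.
pose a (i : 'I_m) := rs`_i.
have a_inj : injective a.
  by move=> i j /eqP; rewrite nth_uniq ?srs // => /eqP/val_inj.
have Xa i : root (char_poly (X + t *: (diag_mx (\row_i a0 i) - X))) (a i).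
  by rewrite rsE root_prod_XsubC mem_nth ?srs.
by have [A AU XE] := diagonalization a_inj Xa; exists A, a.
Qed.

End GeneralLinearKostant.

(** * Orthogonal algebras *)

Section SymmetricForms.
Variable F : numClosedFieldType.

(** Polarization: if H i j != 0 and the basis vectors i and j are both isotropic, their sum has
    value 2 H i j. *)
Lemma anisotropic_vector m (H : 'M[F]_m) : H^T = H -> H != 0 ->
  exists v : 'rV_m, v *m H *m v^T != 0.
Proof.
move=> HT HN0.
have /existsP[i /existsP[j Hij]] : [exists i, exists j, H i j != 0].
  apply: contraR HN0 => /existsPn H0; apply/eqP/matrixP => i j.
  by have /existsPn/(_ j) := H0 i; rewrite negbK mxE => /eqP.
pose B (u v : 'rV[F]_m) := (u *m H *m v^T) 0 0.
have BE k l : B (delta_mx 0 k) (delta_mx 0 l) = H k l.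
  by rewrite /B -rowE trmx_delta -colE !mxE.
have Bnz u : B u u != 0 -> exists v : 'rV_m, v *m H *m v^T != 0.
  by move=> Bu; exists u; apply: contraNneq Bu => u0; rewrite /B u0 mxE.
have [Hii|/Bnz//] := eqVneq (B (delta_mx 0 i) (delta_mx 0 i)) 0.
have [Hjj|/Bnz//] := eqVneq (B (delta_mx 0 j) (delta_mx 0 j)) 0.
apply: (Bnz (delta_mx 0 i + delta_mx 0 j)).
have -> : B (delta_mx 0 i + delta_mx 0 j) (delta_mx 0 i + delta_mx 0 j) = H i j *+ 2.
  rewrite /B linearD /= !mulmxDl !mulmxDr mxE [X in X + _]mxE [X in _ + X]mxE.
  rewrite -!/(B _ _) Hii Hjj !BE add0r addr0 mulr2n; congr (_ + _).
  by rewrite -[in LHS]HT mxE.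
by rewrite mulrn_eq0 /= .
Qed.

(** [row_ebase v] completes an anisotropic [v], up to a scalar, to a basis with [v] first. *)
Lemma congruent_diag0 m (H : 'M[F]_m.+1) : H^T = H -> H != 0 ->
  exists2 Q, Q \in unitmx & (Q^T *m H *m Q) 0 0 != 0.
Proof.
move=> HT HN0; have [v vHv] := anisotropic_vector HT HN0.
have vN0 : v != 0 by apply: contraNneq vHv => ->; rewrite !mul0mx.
exists (row_ebase v)^T; first by rewrite unitmx_tr row_ebase_unit.
pose w := row 0 (row_ebase v).
have vE : v = col_ebase v 0 0 *: w.
  rewrite -[LHS]mulmx_ebase rank_rV vN0 -mulmxA.
  have -> : pid_mx 1 *m row_ebase v = w.
    apply/rowP => j; rewrite !mxE (bigD1 0) //= big1 => [|k kN0].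
      by rewrite !mxE eqxx mul1r addr0.
    by rewrite !mxE eq_sym -val_eqE /= in kN0 *; rewrite (negPf kN0) mul0r.
  by rewrite {1}(mx11_scalar (col_ebase v)) mul_scalar_mx.
apply: contraNneq vHv => H00; rewrite vE linearZ /= -scalemxAr -!scalemxAl.
suff -> : w *m H *m w^T = 0 by rewrite !scaler0.
apply/matrixP => i j; rewrite !ord1 [RHS]mxE -[RHS]H00 trmxK.
rewrite /w -row_mul mxE [RHS]mxE; apply: eq_bigr => k _.
by rewrite !mxE.
Qed.

(** The nonzero pivot [a] clears its row and column ([Q1]), leaves the Schur complement [D'] to the
    induction, and is normalized by a square root. *)
Lemma congruent_id m (H : 'M[F]_m) : H^T = H -> H \in unitmx ->
  exists2 Q, Q \in unitmx & Q^T *m H *m Q = 1%:M.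
Proof.
elim: m H => [|m IHm] H HT HU.
  by exists 1%:M; rewrite ?unitmx1 //; apply/matrixP => -[].
have HN0 : H != 0.
  by apply: contraTneq HU => ->; rewrite unitmxE unitfE det0 eqxx.
have [Q0 Q0U] := congruent_diag0 HT HN0; move E0: (Q0^T *m H *m Q0) => H0 H00.
have H0T : H0^T = H0 by rewrite -E0 !trmx_mul trmxK HT mulmxA.
have H0U : H0 \in unitmx by rewrite -E0 !unitmx_mul unitmx_tr Q0U HU.
pose a := H0 0 0; pose b := @ursubmx _ 1 m 1 m H0; pose D := @drsubmx _ 1 m 1 m H0.
have H0E : (H0 : 'M_(1 + m)) = block_mx (a%:M : 'M_1) b b^T D.
  rewrite -[LHS](@submxK _ 1 m 1 m); congr block_mx.
    by apply/matrixP => i j; rewrite !ord1 !mxE mulr1n; congr (H0 _ _); apply: val_inj.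
  by rewrite /b trmx_ursub H0T.
move Ec: (- a^-1 *: b) => c.
have ac : a%:M *m c = - b by rewrite mul_scalar_mx -Ec scalerA mulrN divff // scaleN1r.
have ca : c^T *m a%:M = - b^T.
  by rewrite mul_mx_scalar -linearZ /= -Ec scalerA mulrN divff // scaleN1r linearN.
pose Q1 : 'M[F]_(1 + m) := block_mx 1%:M c 0 1%:M.
pose D' := D - a^-1 *: (b^T *m b).
have H1E : Q1^T *m (H0 : 'M_(1 + m)) *m Q1 = block_mx a%:M 0 0 D'.
  rewrite H0E /Q1 tr_block_mx !mulmx_block !trmx1 trmx0 !mul1mx !mul0mx !mulmx1 !mulmx0.
  rewrite !addr0 ac ca !addNr mul0mx add0r; congr block_mx.
  by rewrite addrC -Ec linearZ /= -scalemxAl scaleNr.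
have D'T : D'^T = D'.
  rewrite /D' linearB /= linearZ /= trmx_mul trmxK; congr (_ - _).
  by rewrite /D trmx_drsub H0T.
have Q1U : Q1 \in unitmx by rewrite unitmxE det_ublock !det1 mul1r unitr1.
have D'U : D' \in unitmx.
  have : Q1^T *m (H0 : 'M_(1 + m)) *m Q1 \in unitmx by rewrite !unitmx_mul unitmx_tr Q1U H0U.
  by rewrite H1E unitmxE det_ublock unitrM => /andP[].
have [Q2 Q2U Q2E] := IHm D' D'T D'U.
pose s := (sqrtC a)^-1; have sN0 : s != 0 by rewrite invr_eq0 sqrtC_eq0.
pose Q3 : 'M[F]_(1 + m) := block_mx s%:M 0 0 Q2.
have Q3U : Q3 \in unitmx.
  by rewrite unitmxE det_ublock unitrM -!unitmxE Q2U andbT unitmxE det_scalar1 unitfE.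
exists (Q0 *m Q1 *m Q3); first by rewrite !unitmx_mul Q0U Q1U.
have -> : (Q0 *m Q1 *m Q3)^T *m H *m (Q0 *m Q1 *m Q3) = Q3^T *m (Q1^T *m (H0 : 'M_(1 + m)) *m Q1) *m Q3.
  by rewrite -E0 !trmx_mul !mulmxA.
rewrite H1E /Q3 tr_block_mx !mulmx_block !trmx0 !mul0mx !mulmx0 !addr0 !add0r mul0mx Q2E.
rewrite tr_scalar_mx -!scalar_mxM.
have -> : s * a * s = 1 by rewrite mulrAC -expr2 exprVn sqrtCK mulVf.
by rewrite mul0mx -scalar_mx_block.
Qed.

End SymmetricForms.

Section Determinant.
Variables (F : comUnitRingType).

(** Sylvester's identity, from two eliminations of the same block matrix. *)
Lemma det1D_mulC n m (U : 'M[F]_(n, m)) (V : 'M[F]_(m, n)) :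
  \det (1%:M + U *m V) = \det (1%:M + V *m U).
Proof.
pose M := block_mx (1%:M : 'M[F]_n) (- U) V (1%:M : 'M[F]_m).
have E1 : \det M = \det (1%:M + V *m U).
  have : block_mx 1%:M 0 (- V) 1%:M *m M = block_mx 1%:M (- U) 0 (1%:M + V *m U).
    rewrite mulmx_block !mul1mx !mul0mx !mulmx1 !addr0 addNr; congr block_mx.
    by rewrite mulNmx mulmxN opprK addrC.
  move/(congr1 (fun A => \det A)); rewrite det_mulmx det_lblock det_ublock !det1.
  by rewrite !mul1r.
have E2 : \det M = \det (1%:M + U *m V).
  have : block_mx 1%:M U 0 1%:M *m M = block_mx (1%:M + U *m V) 0 V 1%:M.
    by rewrite mulmx_block !mul1mx !mul0mx !mulmx1 !add0r addNr.
  move/(congr1 (fun A => \det A)); rewrite det_mulmx det_lblock det_ublock !det1.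
  by rewrite !mul1r mulr1.
by rewrite -E1 -E2.
Qed.

End Determinant.

Section AntidiagonalForm.
Variables (F : numClosedFieldType) (m : nat).
Local Notation sg := (@rev_ord m).

Definition anti_mx : 'M[F]_m := \matrix_(i, j) (j == sg i)%:R.
Local Notation J := anti_mx.

Lemma anti_mxT : J^T = J.
Proof. by apply/matrixP => i j; rewrite !mxE -(inj_eq rev_ord_inj) rev_ordK eq_sym. Qed.

Lemma mul_anti_mx p (A : 'M[F]_(m, p)) i j : (J *m A) i j = A (sg i) j.
Proof.
rewrite mxE (bigD1 (sg i)) //= big1 => [|k /negPf ki]; last by rewrite mxE ki mul0r.
by rewrite mxE eqxx mul1r addr0.
Qed.

Lemma mul_mx_anti p (A : 'M[F]_(p, m)) i j : (A *m J) i j = A i (sg j).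
Proof. by rewrite -[A *m J]trmxK trmx_mul anti_mxT mxE mul_anti_mx mxE. Qed.

Lemma anti_mxK : J *m J = 1%:M.
Proof. by apply/matrixP => i j; rewrite mul_anti_mx !mxE rev_ordK eq_sym. Qed.

Lemma anti_mx_unit : J \in unitmx.
Proof. by have /mulmx1_unit[] := anti_mxK. Qed.

Lemma congruent_anti (H : 'M[F]_m) : H^T = H -> H \in unitmx ->
  exists2 Q, Q \in unitmx & Q^T *m H *m Q = J.
Proof.
move=> HT HU; have [Q1 Q1U E1] := congruent_id HT HU.
have [Q2 Q2U E2] := congruent_id anti_mxT anti_mx_unit.
exists (Q1 *m invmx Q2); first by rewrite unitmx_mul Q1U unitmx_inv.
transitivity (invmx Q2^T *m (Q2^T *m J *m Q2) *m invmx Q2).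
  by rewrite E2 -E1 trmx_mul trmx_inv !mulmxA.
by rewrite -!mulmxA mulmxV // mulmx1 mulKmx // unitmx_tr.
Qed.

(* so(m) for the form with Gram matrix J, for which diagonal matrices form a   *)
(* Cartan subalgebra.                                                          *)
Definition so_model (X : 'M[F]_m) := forall i j, X (rev_ord j) (rev_ord i) = - X i j.

Lemma so_modelP X : so_model X <-> X^T *m J + J *m X = 0.
Proof.
split=> [mX|XJ i j].
  apply/matrixP => i j; rewrite mxE mul_mx_anti mul_anti_mx !mxE.
  by rewrite -{2}[j]rev_ordK mX addrN.
have := congr1 (fun A : 'M_m => A (rev_ord i) j) XJ.
rewrite mxE mul_mx_anti mul_anti_mx !mxE rev_ordK.
by move/eqP; rewrite addr_eq0 => /eqP.
Qed.

Definition so_group (A : 'M[F]_m) := A^T *m J *m A = J /\ \det A = 1.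

End AntidiagonalForm.

Lemma col_mulmx (R : pzRingType) p q r (A : 'M[R]_(p, q)) (C : 'M[R]_(q, r)) j :
  col j (A *m C) = A *m col j C.
Proof. by rewrite !colE mulmxA. Qed.

(** * Embedding the antidiagonal model of so into so(W) *)

Section OrthogonalEmbedding.
Variables (F : numClosedFieldType) (n : nat) (B : 'M[F]_n) (W : {vspace 'cV[F]_n}).
Hypotheses (BT : B^T = B) (BU : B \in unitmx).
Hypothesis (W_nondeg : (W :&: Defs.orthov B W = 0)%VS).
Local Notation m := (\dim W).
Local Notation J := (anti_mx F m).

(** The columns of [L] are a basis of [W] with Gram matrix [J]; K = J L^T B is then a left inverse
    of [L] whose kernel is the orthogonal complement of [W] ([orthov_coproj]). *)
Lemma isotropic_basis : exists (L : 'M[F]_(n, m)) K,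
  [/\ K *m L = 1%:M, J *m K = L^T *m B, forall j, col j L \in W
    & forall v : 'cV[F]_n, v \in W -> exists c, v = L *m c].
Proof.
pose L0 : 'M[F]_(n, m) := \matrix_(k, l) (vbasis W)`_l k 0.
have mulL0 (c : 'cV[F]_m) : L0 *m c = \sum_l c l 0 *: (vbasis W)`_l.
  apply/colP => k; rewrite !mxE summxE; apply: eq_bigr => l _.
  by rewrite !mxE mulrC.
have L0W (c : 'cV[F]_m) : L0 *m c \in W.
  by rewrite mulL0; apply: memv_suml => l _; rewrite memvZ ?vbasis_mem ?mem_nth ?size_tuple.
have L0_ex v : v \in W -> exists c, v = L0 *m c.
  move=> Wv; exists (\col_l coord (vbasis W) l v); rewrite mulL0 {1}(coord_vbasis Wv).
  by apply: eq_bigr => l _; rewrite mxE.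
move E: (L0^T *m B *m L0) => H.
have HT : H^T = H by rewrite -E !trmx_mul trmxK BT mulmxA.
have HU : H \in unitmx.
  rewrite -row_free_unit; apply/inj_row_free => c cH.
  have w0 : L0 *m c^T = 0.
    apply/eqP; rewrite -memv0 -W_nondeg memv_cap L0W /=; apply/mem_orthov => _ /L0_ex[d ->].
    rewrite trmx_mul -!mulmxA (mulmxA B) (mulmxA L0^T) (mulmxA L0^T) E.
    by rewrite -[H]HT -trmx_mul cH trmx0 mulmx0.
  apply/rowP => l; rewrite [RHS]mxE.
  have := coord_sum_free (fun l => c^T l 0) l (basis_free (vbasisP W)).
  by rewrite -mulL0 w0 linear0 mxE.
have [Q QU QE] := congruent_anti HT HU; exists (L0 *m Q), (J *m (L0 *m Q)^T *m B); split=> [||j|v].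
- transitivity (J *m (Q^T *m (L0^T *m B *m L0) *m Q)); first by rewrite trmx_mul !mulmxA.
  by rewrite E QE anti_mxK.
- by rewrite !mulmxA anti_mxK mul1mx.
- by rewrite colE -mulmxA L0W.
by move=> /L0_ex[c ->]; exists (invmx Q *m c); rewrite -!mulmxA mulKVmx.
Qed.

Variable L : 'M[F]_(n, m).
Hypotheses (LW : forall j, col j L \in W)
  (L_ex : forall v : 'cV[F]_n, v \in W -> exists c, v = L *m c).
Variable K : 'M[F]_(m, n).
Hypotheses (so_coprojK : K *m L = 1%:M) (anti_coproj : J *m K = L^T *m B).

Lemma coproj_anti : K^T *m J = B *m L.
Proof. by rewrite -[J]anti_mxT -trmx_mul anti_coproj trmx_mul trmxK BT. Qed.

Lemma orthov_coproj v : v \in Defs.orthov B W <-> K *m v = 0.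
Proof.
split=> [/mem_orthov Wv|Kv].
  suff E : J *m (K *m v) = 0 by rewrite -[LHS](mulKmx (anti_mx_unit F _)) E mulmx0.
  rewrite mulmxA anti_coproj -mulmxA.
  apply/row_matrixP => j; rewrite row_mul row0 mulmxA -tr_col.
  by rewrite -mulmxA [LHS]mulmxA Wv.
apply/mem_orthov => _ /L_ex[c ->]; rewrite trmx_mul -(mulmxA c^T) -anti_coproj.
by rewrite -!mulmxA Kv !mulmx0.
Qed.

(** LK is the orthogonal projection onto [W]. An element [x] of so(W) kills the kernel of [K], so x
    = x LK; passing to adjoints, with [x] skew and LK self-adjoint, also x = LK x. *)
Lemma so_sub_emb x :
  x \in so_sub B W <-> so_model (K *m x *m L) /\ x = emb L K (K *m x *m L).
Proof.
rewrite so_modelP; split=> [/mem_so_sub[xB xW]|[XJ ->]]; last first.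
  apply/mem_so_sub; split=> [|v /orthov_coproj Kv]; last by rewrite /emb -(mulmxA _ K v) Kv mulmx0.
  move: (K *m x *m L) XJ => X XJ.
  have -> : (emb L K X)^T *m B + B *m emb L K X = K^T *m (X^T *m J + J *m X) *m K.
    rewrite /emb !trmx_mul mulmxDr mulmxDl !mulmxA coproj_anti; congr (_ + _).
    by rewrite -!mulmxA anti_coproj.
  by rewrite XJ mulmx0 mul0mx.
have xLK : x = x *m (L *m K).
  apply/eqP; rewrite -subr_eq0 -{1}[x]mulmx1 -mulmxBr; apply/eqP.
  apply/matrixP => i j; rewrite [RHS]mxE.
  have : x *m col j (1%:M - L *m K) = 0.
    apply/xW/orthov_coproj; rewrite -col_mulmx mulmxBr mulmx1 mulmxA so_coprojK mul1mx.
    by rewrite subrr col0.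
  by rewrite -col_mulmx => /colP/(_ i); rewrite !mxE.
have LKB : (L *m K)^T *m B = B *m (L *m K).
  by rewrite mulmxA -coproj_anti -mulmxA anti_coproj trmx_mul mulmxA.
have xT : x^T *m B = - (B *m x) by apply/eqP; rewrite -addr_eq0 xB.
have LKx : x = L *m K *m x.
  have E1 : x^T *m B = (L *m K)^T *m (x^T *m B).
    by rewrite {1}xLK [(x *m (L *m K))^T]trmx_mul -mulmxA.
  apply: (can_inj (mulKmx BU)); apply: oppr_inj; rewrite -xT E1 xT mulmxN.
  by rewrite mulmxA LKB -!mulmxA.
split; last by rewrite /emb -!mulmxA -xLK mulmxA -LKx.
have -> : (K *m x *m L)^T *m J + J *m (K *m x *m L) = L^T *m (x^T *m B + B *m x) *m L.
  rewrite !trmx_mul mulmxDr mulmxDl !mulmxA anti_coproj; congr (_ + _).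
  by rewrite -!mulmxA coproj_anti.
by rewrite xB mulmx0 mul0mx.
Qed.

Lemma det_gemb A : \det (gemb L K A) = \det A.
Proof.
have -> : gemb L K A = 1%:M + (L *m (A - 1%:M)) *m K.
  by rewrite /gemb mulmxBr mulmxBl mulmx1 addrCA.
rewrite det1D_mulC mulmxA so_coprojK mul1mx; congr (\det _).
by rewrite addrC subrK.
Qed.

(** [N] projects orthogonally onto the complement of [W]. A form-preserving [s] that fixes the image
    of [N] preserves its orthogonal complement, the image of [L] ([sL]), and is therefore determined
    by K s L. *)
Lemma SO_sub_gemb s : SO_sub B W s <-> exists2 A, so_group A & s = gemb L K A.
Proof.
pose N := 1%:M - L *m K.
have KN : K *m N = 0 by rewrite /N mulmxBr mulmx1 mulmxA so_coprojK mul1mx subrr.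
have LBN : L^T *m B *m N = 0 by rewrite -anti_coproj -mulmxA KN mulmx0.
have NBL : N^T *m B *m L = 0.
  by apply: trmx_inj; rewrite !trmx_mul trmxK BT trmx0 mulmxA LBN.
have NB : N^T *m B = B *m N.
  rewrite /N linearB /= trmx1 mulmxBl mulmxBr mul1mx mulmx1 trmx_mul -mulmxA.
  by rewrite -anti_coproj mulmxA coproj_anti mulmxA.
have NBN : N^T *m B *m N = B - B *m L *m K.
  by rewrite {2}/N mulmxBr mulmx1 mulmxA NBL mul0mx subr0 NB /N mulmxBr mulmx1 mulmxA.
have gembE A : gemb L K A = L *m A *m K + N by [].
have Nmul p (y : 'M_(n, p)) : N *m y = y - L *m (K *m y) by rewrite /N mulmxBl mul1mx !mulmxA.
have LKN : L *m K + N = 1%:M by rewrite /N addrC subrK.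
move: N KN LBN NBL NB NBN gembE Nmul LKN => N KN LBN NBL NB NBN gembE Nmul LKN.
split=> [[sB s1 sW]|[A [AJ A1] ->]].
  have sN : s *m N = N.
    apply/matrixP => i j; have : s *m col j N = col j N.
      by apply/sW/orthov_coproj; rewrite -col_mulmx KN col0.
    by rewrite -col_mulmx => /colP/(_ i); rewrite !mxE.
  have sL : s *m L = L *m (K *m s *m L).
    apply/eqP; rewrite -subr_eq0.
    have -> : s *m L - L *m (K *m s *m L) = N *m (s *m L).
      by rewrite Nmul !mulmxA.
    apply/eqP/(can_inj (mulKmx BU)); rewrite mulmx0.
    rewrite mulmxA -NB -[in N^T]sN trmx_mul -!mulmxA (mulmxA B) (mulmxA s^T) (mulmxA s^T) sB.
    by rewrite mulmxA NBL.
  have sE : s = gemb L K (K *m s *m L).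
    by rewrite gembE -sL -[N]sN -mulmxA -mulmxDr LKN mulmx1.
  move: (K *m s *m L) sL sE => A sL sE.
  exists A => //; split; last by rewrite -det_gemb -sE.
  have JE : J = L^T *m B *m L by rewrite -anti_coproj -mulmxA so_coprojK mulmx1.
  transitivity ((L *m A)^T *m B *m (L *m A)); first by rewrite trmx_mul JE !mulmxA.
  by rewrite -sL trmx_mul -!mulmxA (mulmxA B) (mulmxA s^T) (mulmxA s^T) sB mulmxA -JE.
split=> [||v /orthov_coproj Kv].
- rewrite gembE [(_ + N)^T]linearD /= !mulmxDr !mulmxDl NBN -![L *m A *m K]mulmxA.
  have -> : (L *m (A *m K))^T *m B *m N = 0.
    by rewrite trmx_mul -!mulmxA (mulmxA L^T) LBN mulmx0.
  have -> : N^T *m B *m (L *m (A *m K)) = 0.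
    by rewrite (mulmxA (N^T *m B) L) NBL mul0mx.
  have -> : (L *m (A *m K))^T *m B *m (L *m (A *m K)) = B *m L *m K.
    rewrite -coproj_anti -AJ !trmx_mul -!mulmxA; congr (_ *m (_ *m _)).
    by rewrite [L^T *m _]mulmxA -anti_coproj -!mulmxA [K *m _]mulmxA so_coprojK mul1mx.
  by rewrite addr0 add0r addrC subrK.
- by rewrite det_gemb.
by rewrite gembE mulmxDl -(mulmxA _ K v) Kv mulmx0 add0r Nmul Kv mulmx0 subr0.
Qed.

End OrthogonalEmbedding.

(** * The antidiagonal model: basis, Cartan subalgebra, group *)

Section OrthogonalModel.
Variables (F : numClosedFieldType) (m : nat).
Local Notation sg := (@rev_ord m).
Local Notation J := (anti_mx F m).
Local Notation l := m./2.

(* By antisymmetry about the antidiagonal, an element of so_model is           *)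
(* determined by its entries above the antidiagonal.                           *)
Definition so_pos := [set p : 'I_m * 'I_m | ((p.1 + p.2).+1 < m)%N].
Local Notation S := so_pos.
Definition so_bas (i j : 'I_m) : 'M[F]_m := delta_mx i j - delta_mx (sg j) (sg i).

Lemma so_basE i j k u :
  so_bas i j k u = ((i, j) == (k, u))%:R - ((i, j) == (sg u, sg k))%:R.
Proof.
rewrite !mxE !xpair_eqE !(eq_sym k) !(eq_sym u); congr (_%:R - _%:R).
by rewrite -[sg j == _](inj_eq rev_ord_inj) -[sg i == _](inj_eq rev_ord_inj) !rev_ordK andbC.
Qed.

Lemma rev_pos k u : ((sg u, sg k) \in S) = (m < (k + u).+1)%N.
Proof. by rewrite inE /=; have := ltn_ord k; have := ltn_ord u; lia. Qed.

Lemma so_decomp (X : 'M[F]_m) : so_model X -> X = \sum_(p in S) X p.1 p.2 *: so_bas p.1 p.2.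
Proof.
move=> mX; apply/matrixP => k u; rewrite summxE.
have sumE (q : 'I_m * 'I_m) :
    \sum_(p in S) X p.1 p.2 * (p == q)%:R = X q.1 q.2 *+ (q \in S).
  have [qS|qS] := boolP (q \in S).
    rewrite (bigD1 q) //= big1 => [|p /andP[_ /negPf ->]]; last by rewrite mulr0.
    by rewrite eqxx mulr1 addr0.
  rewrite mulr0n big1 // => p pS; have /negPf -> : p != q; last by rewrite mulr0.
  by apply: contraNneq qS => <-.
rewrite (eq_bigr (fun p => X p.1 p.2 * (p == (k, u))%:R - X p.1 p.2 * (p == (sg u, sg k))%:R)).
  rewrite sumrB !sumE /= mX rev_pos inE /=.
  case: ltngtP => ku /=; rewrite ?mulr1n ?mulr0n ?subr0 ?sub0r ?opprK //.
  have -> : u = sg k by apply: val_inj => /=; have := ltn_ord k; lia.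
  have := mX k (sg k); rewrite rev_ordK => /eqP; rewrite -addr_eq0 -mulr2n mulrn_eq0 /=.
  by move/eqP->; rewrite ?oppr0.
by move=> [i j] _; rewrite mxE so_basE mulrBr.
Qed.

Lemma so_bas_model i j : so_model (so_bas i j).
Proof. by move=> k u; rewrite !so_basE !rev_ordK opprB. Qed.

Lemma so_bas_coord p p' : p \in S -> p' \in S -> so_bas p.1 p.2 p'.1 p'.2 = (p == p')%:R.
Proof.
case: p => i j; case: p' => k u pS p'S; rewrite so_basE /=.
have /negPf -> : (i, j) != (sg u, sg k); last by rewrite subr0.
apply: contraTneq pS => ->; rewrite rev_pos.
by move: p'S; rewrite inE /=; lia.
Qed.

Lemma so_tr_bas (X : 'M[F]_m) i j : so_model X -> (i, j) \in S ->
  \tr (so_bas j i *m X) = 2 * X i j.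
Proof.
by move=> mX _; rewrite mulmxBl raddfB /= !tr_delta_mul mX opprK mulr_natl mulr2n.
Qed.

Lemma so_model_lie (X Y : 'M[F]_m) : so_model X -> so_model Y -> so_model (lie X Y).
Proof.
move=> /so_modelP XJ /so_modelP YJ; apply/so_modelP; rewrite /lie.
have {}XJ : X^T *m J = - (J *m X) by apply/eqP; rewrite -addr_eq0 XJ.
have {}YJ : Y^T *m J = - (J *m Y) by apply/eqP; rewrite -addr_eq0 YJ.
rewrite linearB /= !trmx_mul mulmxBl mulmxBr -!mulmxA XJ YJ !mulmxN !(mulmxA _ J) XJ YJ.
by rewrite !mulNmx !opprK !mulmxA [X in X + _]addrC addrC subrKA subrr.
Qed.

Lemma half_le : (l <= m)%N. Proof. by lia. Qed.
Definition so_w (k : 'I_l) : 'I_m := widen_ord half_le k.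

Lemma so_w_inj : injective so_w.
Proof. by move=> i j /(congr1 val) /= /val_inj. Qed.

Lemma so_w_pos k : (so_w k, so_w k) \in S.
Proof. by rewrite inE /=; have := ltn_ord k; lia. Qed.

Lemma so_diag_pos i : (i, i) \in S -> exists k, i = so_w k.
Proof.
rewrite inE /= => ii; have il : (i < l)%N by lia.
by exists (Ordinal il); apply: val_inj.
Qed.

Definition so_half (a : 'I_l -> F) (i : 'I_m) : F :=
  if insub (i : nat) is Some k then a k else 0.
(** The diagonal a_1, ..., a_l, then 0 if m is odd, then -a_l, ..., -a_1. *)
Definition so_d a i : F := so_half a i - so_half a (sg i).

Lemma so_half_w a k : so_half a (so_w k) = a k.
Proof. by rewrite /so_half /= valK. Qed.

Lemma so_half0 a (i : 'I_m) : (l <= i)%N -> so_half a i = 0.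
Proof. by move=> li; rewrite /so_half insubN // -leqNgt. Qed.

Lemma so_d_rev a i : so_d a (sg i) = - so_d a i.
Proof. by rewrite /so_d rev_ordK opprB. Qed.

Lemma so_d_w a k : so_d a (so_w k) = a k.
Proof.
rewrite /so_d so_half_w so_half0 ?subr0 //=.
by have := ltn_ord k; lia.
Qed.

Lemma so_dm_model a : so_model (diag_mx (\row_i so_d a i)).
Proof.
by move=> i j; rewrite !mxE (inj_eq rev_ord_inj) so_d_rev mulNrn eq_sym; case: eqP => // ->.
Qed.

Lemma so_dm_eq a : diag_mx (\row_i so_d a i) = \sum_k a k *: so_bas (so_w k) (so_w k).
Proof.
rewrite [LHS](so_decomp (so_dm_model a)) (bigID (fun p => p.1 == p.2)) /= [X in _ + X]big1 ?addr0; last first.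
  by move=> p /andP[_ /negPf p12]; rewrite !mxE p12 mulr0n scale0r.
rewrite (eq_bigl (mem [set (so_w k, so_w k) | k in 'I_l])) => [|p]; last first.
  apply/andP/imsetP => [[Sp /eqP p12]|[k _ ->]]; last by rewrite so_w_pos eqxx.
  have [|k kE] := @so_diag_pos p.1; first by rewrite {2}p12 -surjective_pairing.
  by exists k => //; rewrite -kE {2}p12 -surjective_pairing.
rewrite big_imset => [|k k' _ _ /(congr1 fst)/so_w_inj] //=.
by apply: eq_bigr => k _; rewrite !mxE eqxx mulr1n so_d_w.
Qed.

Lemma so_lie_dm_bas a i j : lie (diag_mx (\row_i so_d a i)) (so_bas i j)
  = (so_d a i - so_d a j) *: so_bas i j.
Proof.
rewrite /lie mul_diag_mx mul_mx_diag; apply/(@matrixP F m m) => k u.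
rewrite !mxE; have := so_basE i j k u; rewrite !mxE => ->.
have [[-> ->]|ij] := eqVneq (i, j) (k, u).
  have [[-> ->]|_] := eqVneq (k, u) (sg u, sg k); rewrite ?subrr ?mulr0 ?mul0r ?subrr //.
  by rewrite subr0 !mulr1 mul1r.
have [[-> ->]|_] := eqVneq (i, j) (sg u, sg k); last by rewrite subrr !mulr0 mul0r subrr.
by rewrite !so_d_rev; ring.
Qed.

Lemma so_group_unit (A : 'M[F]_m) : so_group A -> A \in unitmx.
Proof. by case=> _ A1; rewrite unitmxE A1 unitr1. Qed.

Lemma so_group_adj (A X : 'M[F]_m) : so_group A -> so_model X ->
  so_model (adj A X) /\ so_model (invmx A *m X *m A).
Proof.
move=> GA /so_modelP XJ; have AU := so_group_unit GA; have [AJ _] := GA.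
split; apply/so_modelP.
  have : adj A X *m A = A *m X by rewrite /adj mulmxKV.
  move: (adj A X) => Y YA.
  suff E : A^T *m (Y^T *m J + J *m Y) *m A = 0.
    have ATU : A^T \in unitmx by rewrite unitmx_tr.
    by rewrite -[LHS](mulKmx ATU) -[A^T *m _](mulmxK AU) E mul0mx mulmx0.
  have E1 : A^T *m (Y^T *m J) *m A = X^T *m (A^T *m J *m A).
    by rewrite !mulmxA -trmx_mul YA trmx_mul.
  have E2 : A^T *m (J *m Y) *m A = (A^T *m J *m A) *m X by rewrite -!mulmxA YA.
  by rewrite mulmxDr mulmxDl E1 E2 AJ.
have : A *m (invmx A *m X *m A) = X *m A by rewrite -mulmxA mulKVmx.
move: (invmx A *m X *m A) => Y AY.
have E1 : Y^T *m (A^T *m J *m A) = A^T *m (X^T *m J) *m A.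
  by rewrite !mulmxA -trmx_mul AY trmx_mul.
have E2 : (A^T *m J *m A) *m Y = A^T *m (J *m X) *m A by rewrite -!mulmxA AY.
by rewrite -AJ E1 E2 -mulmxDl -mulmxDr XJ mulmx0 mul0mx.
Qed.

End OrthogonalModel.

Lemma mderiv_comp_mpoly (F : numFieldType) k r (q : {mpoly F[k]})
    (T : k.-tuple {mpoly F[r]}) i a :
  (q \mPo T)^`M(i).@[a] =
  \sum_j q^`M(j).@[fun j => (tnth T j).@[a]] * (tnth T j)^`M(i).@[a].
Proof.
pose v u : F := (u == i)%:R.
have E p : p^`M(i).@[a] = (mline a v p)^`().[0].
  rewrite deriv_mline0 (bigD1 i) //= big1 => [|j /negPf ji]; last by rewrite /v ji mulr0.
  by rewrite /v eqxx mulr1 addr0.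
have w0 j : (mline a v (tnth T j)).[0] = (tnth T j).@[a].
  by rewrite mline_horner; apply: meval_eq => u; rewrite mul0r addr0.
have -> : (q \mPo T)^`M(i).@[a] = (mcurve (fun j => mline a v (tnth T j)) q)^`().[0].
  rewrite E; congr (_^`().[_]); apply/eqP; rewrite -subr_eq0; apply/eqP/horner_eq0_poly => t.
  rewrite hornerD hornerN mline_horner mcurve_horner comp_mpoly_meval; apply/eqP.
  by rewrite subr_eq0; apply/eqP/meval_eq => j; rewrite mline_horner.
rewrite deriv_mcurve_horner; apply: eq_bigr => j _; rewrite -E; congr (_ * _).
exact: meval_eq.
Qed.

(** * Torus elements and the product of the roots *)

Section OrthogonalCartan.
Variables (F : numClosedFieldType) (m : nat).
Local Notation sg := (@rev_ord m).
Local Notation J := (anti_mx F m).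
Local Notation l := m./2.
Local Notation S := (so_pos m).

Lemma so_torus i j : (i, j) \in S -> i != j -> exists (A : 'M[F]_m) tau,
  [/\ so_group A, tau != 1, forall k, adj A (so_bas F (so_w k) (so_w k)) = so_bas F (so_w k) (so_w k)
    & adj A (so_bas F i j) = tau *: so_bas F i j].
Proof.
move=> Sij ij.
(* [k0] is [i], or [j] if [i] is the middle index, so that exactly one of [i], [j] lies in the
   mirror pair of [k0]. Positions of [S] are off the antidiagonal, so [j] is never the mirror of
   [i]. Entries 2 and 1/2 at this pair then scale the root vector by 2 or 1/2. *)
have [k0 k0N k0ij] : exists2 k0, k0 != sg k0 &
    [&& k0 == i, j != k0 & j != sg k0] || [&& k0 == j, i != k0 & i != sg k0].
  have [ii|ii] := eqVneq i (sg i); last first.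
    exists i => //; rewrite eqxx [j == i]eq_sym ij /=.
    have -> : j != sg i; last by [].
    by apply: contraTneq Sij => ->; rewrite inE /=; have := ltn_ord i; lia.
  exists j; last first.
    rewrite eqxx ij /=; have -> : i != sg j; last by rewrite orbT.
    by rewrite ii (inj_eq rev_ord_inj).
  apply: contra ij => /eqP jj; apply/eqP/val_inj.
  by have := congr1 val jj; have := congr1 val ii; rewrite /=; lia.
pose t k : F := if k == k0 then 2 else if k == sg k0 then 2^-1 else 1.
have two_neq0 : 2 != 0 :> F by rewrite pnatr_eq0.
have tN0 k : t k != 0 by rewrite /t; case: ifP => _ //; case: ifP => _; rewrite ?invr_eq0 ?oner_neq0.
have t_rev k : t (sg k) = (t k)^-1.
  rewrite /t (can2_eq rev_ordK rev_ordK) (inj_eq rev_ord_inj).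
  by case: (eqVneq k k0) k0N => [->|_ _]; [move/negPf->|case: ifP; rewrite ?invrK ?invr1].
pose A : 'M[F]_m := diag_mx (\row_k t k).
have GA : so_group A.
  split.
    rewrite tr_diag_mx mul_diag_mx mul_mx_diag; apply/matrixP => k u; rewrite !mxE.
    by case: eqP => [->|_]; rewrite ?mulr0 ?mul0r // t_rev mulr1 divff.
  rewrite det_diag (bigD1 k0) //= (bigD1 (sg k0)) 1?eq_sym //= big1 => [|k /andP[k1 k2]].
    by rewrite !mxE t_rev mulr1 divff.
  by rewrite !mxE /t (negPf k1) (negPf k2).
have Abas k u : adj A (so_bas F k u) = (t k / t u) *: so_bas F k u.
  have E : A *m so_bas F k u = (t k / t u) *: so_bas F k u *m A.
    rewrite mul_diag_mx mul_mx_diag; apply/matrixP => x y.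
    rewrite !mxE; have := so_basE F k u x y; rewrite !mxE => ->.
    have [[-> ->]|_] := eqVneq (k, u) (x, y).
      by rewrite [RHS]mulrAC divfK.
    have [[-> ->]|_] := eqVneq (k, u) (sg y, sg x); last by rewrite subrr !mulr0 mul0r.
    by rewrite !t_rev invrK; field.
  by rewrite /adj E mulmxK // so_group_unit.
exists A, (t i / t j); split=> // [|k]; last by rewrite Abas divff // scale1r.
case/orP: k0ij => /and3P[/eqP <- jk jk'].
  rewrite /t eqxx (negPf jk) (negPf jk') divr1 -subr_eq0 -[2]/(1 + 1) addrK.
  exact: oner_neq0.
rewrite /t eqxx (negPf jk) (negPf jk') mul1r invr_eq1 -subr_eq0 -[2]/(1 + 1) addrK.
exact: oner_neq0.
Qed.

Lemma prod_mirror (R : comNzRingType) (G : 'I_m -> R) :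
  \prod_(i < m) G i = (\prod_(k < l) (G (so_w k) * G (sg (so_w k))))
    * \prod_(i < m | (l <= i)%N && (l <= sg i)%N) G i.
Proof.
rewrite (bigID (fun i : 'I_m => (i < l)%N)) /= big_split /= -mulrA; congr (_ * _).
  by rewrite (big_ord_narrow (half_le m)).
rewrite (bigID (fun i : 'I_m => (sg i < l)%N)) /=; congr (_ * _).
  rewrite (reindex_inj rev_ord_inj) /=.
  rewrite (eq_bigl (fun i : 'I_m => (i < l)%N)) => [|i]; last first.
    by have := ltn_ord i; lia.
  by rewrite (big_ord_narrow (half_le m)).
by apply: eq_bigl => i; rewrite -!leqNgt.
Qed.

Lemma so_prod_split (R : comNzRingType) (f : F -> R) a :
  \prod_(i < m) f (so_d a i) = (\prod_(k < l) (f (a k) * f (- a k))) * f 0 ^+ odd m.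
Proof.
rewrite prod_mirror; congr (_ * _).
  by apply: eq_bigr => k _; rewrite so_d_rev so_d_w.
rewrite (eq_bigr (fun=> f 0)) => [|i /andP[il sil]]; last first.
  by rewrite /so_d !so_half0 ?subrr.
rewrite prodr_const; congr (_ ^+ _).
case: (boolP (odd m)) => om.
  have lm : (l < m)%N by lia.
  rewrite (@eq_card1 _ (Ordinal lm)) // => i; rewrite !inE -val_eqE /=.
  by have := ltn_ord i; lia.
apply: eq_card0 => i; rewrite !inE /=; have := ltn_ord i; lia.
Qed.

Section OrthogonalRoots.
Variable a : 'I_l -> F.
Let t k := a k ^+ 2.
Let q : {poly F} := \prod_(k < l) ('X - (t k)%:P).

Lemma so_prod_XsubC : \prod_(i < m) ('X - (so_d a i)%:P) = (q \Po 'X^2) * 'X^(odd m).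
Proof.
rewrite (so_prod_split (fun z => 'X - z%:P)) subr0; congr (_ * _).
rewrite /q rmorph_prod; apply: eq_bigr => k _ /=.
by rewrite comp_polyB comp_polyX comp_polyC polyCN /t rmorphXn /=; ring.
Qed.

Lemma so_char_poly_coef (j : 'I_l) :
  (-1) ^+ j.+1 * (char_poly (diag_mx (\row_i so_d a i)))`_(m - j.+1.*2)
    = (mesym l F j.+1).@[t].
Proof.
rewrite char_poly_diag so_prod_XsubC mesym_coeff; congr (_ * _).
rewrite coefMXn coef_comp_poly_Xn //.
have jl := ltn_ord j.
have -> : (m - j.+1.*2 < odd m)%N = false by lia.
have -> : (m - j.+1.*2 - odd m = (l - j.+1) * 2)%N by lia.
by rewrite dvdn_mull // mulnK.
Qed.

Hypotheses (t_inj : injective t) (aN0 : forall k, a k != 0).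

Lemma deriv_prod_root r (z : 'I_r -> F) i :
  (\prod_(j < r) ('X - (z j)%:P))^`().[z i] = \prod_(j < r | j != i) (z i - z j).
Proof.
rewrite (bigD1 i) //= derivM derivXsubC mul1r hornerD hornerM hornerXsubC subrr mul0r addr0.
by rewrite horner_prod; apply: eq_bigr => j _; rewrite hornerXsubC.
Qed.

Let delta : F := \prod_(p in root_set S) (so_d a p.1 - so_d a p.2).

(** The ordered pairs i != j are split by the antidiagonal. Reflection in it preserves the factors,
    so each side contributes [delta]; on it the factor is 2 so_d a i. *)
Lemma so_delta_sqr :
  delta ^+ 2 * \prod_(i < m | i != sg i) (2 * so_d a i)
  = \prod_(i < m) \prod_(j < m | j != i) (so_d a i - so_d a j).
Proof.
rewrite [RHS]pair_big_dep /= (bigID (fun p => p \in S)) /= expr2 -mulrA; congr (_ * _).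
  by apply: eq_bigl => p; rewrite inE eq_sym andbC.
rewrite (bigID (fun p : 'I_m * 'I_m => (sg p.2, sg p.1) \in S)) /=; congr (_ * _).
  rewrite (reindex_inj (h := fun p : 'I_m * 'I_m => (sg p.2, sg p.1))) /=; last first.
    by apply: inv_inj => -[i j]; rewrite /= !rev_ordK.
  apply: eq_big => [[i j]|[i j] _] /=.
    rewrite !rev_ordK (inj_eq rev_ord_inj) rev_pos !inE /=.
    by case: eqP => _ /=; rewrite ?andbT ?andbF // -leqNgt; case: ltngtP.
  by rewrite !so_d_rev opprK addrC.
rewrite (reindex_onto (fun i => (i, sg i)) fst) /=.
  apply: eq_big => [i|i _] /=; last by rewrite so_d_rev opprK mulr_natl mulr2n.
  rewrite eqxx andbT eq_sym rev_pos !inE /=.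
  by have := ltn_ord i; case: eqP => _ //=; lia.
move=> [i j] /= /andP[/andP[_]]; rewrite rev_pos inE /= => ij1 ij2.
by congr (_, _); apply: val_inj => /=; have := ltn_ord i; have := ltn_ord j; lia.
Qed.

(** The product over all ordered pairs multiplies the values of the derivative of q(X^2) X^(odd m)
    at its roots ([E2]). The derivatives of [q] give the Vandermonde of the squares ([E3]), and the
    antidiagonal factors ([E1]) cancel. *)
Lemma so_delta_eq : delta ^+ 2 = (\prod_(k < l) t k) ^+ (2 * odd m) * vdm t ^+ 4.
Proof.
have t_neq0 k : t k != 0 by rewrite expf_neq0.
have E1 : \prod_(i < m | i != sg i) (2 * so_d a i) = \prod_(k < l) (- (4 * t k)).
  (* The value 1 at 0 accounts for the middle index, which the product omits. *)
  pose f z : F := if z == 0 then 1 else 2 * z.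
  rewrite big_mkcond /= (eq_bigr (fun i => f (so_d a i))) => [|i _].
    rewrite so_prod_split /f eqxx expr1n mulr1; apply: eq_bigr => k _.
    by rewrite oppr_eq0 (negPf (aN0 k)) /t; ring.
  rewrite /f; case: (eqVneq i (sg i)) => [ii|ii].
    suff -> : so_d a i = 0 by rewrite eqxx.
    have /eqP : so_d a i = - so_d a i by rewrite {1}ii so_d_rev.
    by rewrite -addr_eq0 -mulr2n mulrn_eq0 /= => /eqP.
  rewrite ifN //; have [il|il] := ltnP i l.
    by rewrite (_ : i = so_w (Ordinal il)) ?so_d_w //; apply: val_inj.
  have sil : (sg i < l)%N.
    by move: ii; rewrite -val_eqE /=; have := ltn_ord i; lia.
  rewrite -(rev_ordK i) so_d_rev oppr_eq0 (_ : sg i = so_w (Ordinal sil)) ?so_d_w //.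
  exact: val_inj.
have E2 : \prod_(i < m) \prod_(j < m | j != i) (so_d a i - so_d a j)
    = \prod_(k < l) (- (4 * t k)) * ((\prod_(k < l) t k) ^+ (2 * odd m) * (\prod_(k < l) q^`().[t k]) ^+ 2).
  rewrite (eq_bigr (fun i => ((q \Po 'X^2) * 'X^(odd m))^`().[so_d a i])) => [|i _]; last first.
    by rewrite -so_prod_XsubC deriv_prod_root.
  rewrite (so_prod_split (fun z => ((q \Po 'X^2) * 'X^(odd m))^`().[z])).
  have prodE e (G : 'I_l -> F) : \prod_k G k ^+ e = (\prod_k G k) ^+ e by rewrite prodrXl.
  have qt k : q.[t k] = 0.
    by rewrite horner_prod (bigD1 k) //= hornerXsubC subrr mul0r.
  have chiE k z : z ^+ 2 = t k ->
      ((q \Po 'X^2) * 'X^(odd m))^`().[z] = z ^+ odd m * (2 * z * q^`().[t k]).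
    move=> zt; rewrite derivM deriv_comp !derivXn hornerD !hornerM !horner_comp !hornerXn zt qt.
    by rewrite mul0r addr0 hornerMn hornerXn expr1; ring.
  rewrite (eq_bigr (fun k => (- (4 * t k)) * ((- t k) ^+ odd m * q^`().[t k] ^+ 2))) => [|k _].
    have C1 : \prod_(k < l) (- t k) ^+ odd m = (\prod_(k < l) - t k) ^+ odd m.
      exact: (prodE _ (fun k => - t k)).
    have C2 : \prod_(k < l) q^`().[t k] ^+ 2 = (\prod_(k < l) q^`().[t k]) ^+ 2.
      exact: (prodE _ (fun k => q^`().[t k])).
    have C3 : \prod_(k < l) ((- t k) ^+ odd m * q^`().[t k] ^+ 2)
        = (\prod_(k < l) - t k) ^+ odd m * (\prod_(k < l) q^`().[t k]) ^+ 2.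
      by rewrite -C1 -C2 -big_split.
    rewrite big_split /= C3.
    have CA : (\prod_(k < l) - t k) ^+ 2 = (\prod_(k < l) t k) ^+ 2.
      by rewrite -(prodE _ (fun k => - t k)) -(prodE _ t); apply: eq_bigr => k _; rewrite sqrrN.
    rewrite exprM -CA; case: (odd m) => /=; last by rewrite !expr0 mulr1 mul1r.
    have -> : ((q \Po 'X^2) * 'X^1)^`().[0] = \prod_(k < l) - t k.
      rewrite derivM derivX hornerD !hornerM hornerX mulr0 add0r hornerC mulr1 horner_comp hornerXn.
      by rewrite expr0n /= /q horner_prod; apply: eq_bigr => k _; rewrite hornerXsubC sub0r.
    by rewrite !expr1; ring.
  rewrite !(chiE k) ?sqrrN // /t; case: (odd m); rewrite ?expr1 ?expr0; ring.
have E3 : (\prod_(k < l) q^`().[t k]) ^+ 2 = vdm t ^+ 4.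
  rewrite (eq_bigr (fun k => \prod_(k' < l | k' != k) (t k - t k'))) => [|k _]; last first.
    exact: deriv_prod_root.
  rewrite prod_neq_vdm exprMn -exprM; set e := \prod_(_ < _) _.
  suff -> : e ^+ 2 = 1 by rewrite mul1r.
  by rewrite -prodrXl big1 // => i _; rewrite -prodrXl big1 // => j _; rewrite sqrrN expr1n.
have := so_delta_sqr; rewrite E1 E2 E3 mulrC; apply: mulfI.
by apply/prodf_neq0 => k _; rewrite oppr_eq0 mulf_eq0 pnatr_eq0 (negPf (t_neq0 k)).
Qed.

End OrthogonalRoots.
End OrthogonalCartan.

(** * The Pfaffian *)

Section Pfaffian.
Variables (R : comNzRingType) (m : nat).
Local Notation sg := (@rev_ord m).
Local Notation l := m./2.

(* On alternating matrices of even size m, this is the Pfaffian up to the     *)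
(* factor +- 2^l l!, where l = m./2.                                          *)
Definition pfaffian (A : 'M[R]_m) : R :=
  \sum_(s : 'S_m) (-1) ^+ s * \prod_(k < l) A (s (so_w k)) (s (sg (so_w k))).

(** Places the l chosen index pairs on the mirror pairs of positions; the middle position of an odd
    size is fixed. *)
Definition pair_fun (h : {ffun 'I_l -> 'I_m * 'I_m}) (i : 'I_m) : 'I_m :=
  if insub (i : nat) is Some k then (h k).1
  else if insub (sg i : nat) is Some k then (h k).2 else i.

Lemma pair_fun_w h k : pair_fun h (so_w k) = (h k).1.
Proof. by rewrite /pair_fun valK. Qed.

Lemma pair_fun_rev h k : pair_fun h (sg (so_w k)) = (h k).2.
Proof.
rewrite /pair_fun rev_ordK valK insubN //=.
by have := ltn_ord k; lia.
Qed.

Hypothesis m_even : ~~ odd m.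

Lemma prod_mirror_even (G : 'I_m -> R) :
  \prod_(i < m) G i = \prod_(k < l) (G (so_w k) * G (sg (so_w k))).
Proof.
rewrite prod_mirror [X in _ * X]big_pred0 ?mulr1 // => i /=.
by have := ltn_ord i; lia.
Qed.

(** Expanding the entries of b^T A b and exchanging sums gives a formula of Cauchy-Binet type ([E]),
    in which [b] enters only through determinants of selected rows. Passing from b = 1 to b = a
    multiplies each of them by det a. *)
Lemma pfaffian_congr (a A : 'M[R]_m) : pfaffian (a^T *m A *m a) = \det a * pfaffian A.
Proof.
have E (b : 'M[R]_m) : pfaffian (b^T *m A *m b)
    = \sum_(h : {ffun 'I_l -> 'I_m * 'I_m})
        (\prod_k A (h k).1 (h k).2) * \det (rowsub (pair_fun h) b).
  have bE p q : (b^T *m A *m b) p q = \sum_u A u.1 u.2 * (b u.1 p * b u.2 q).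
    rewrite mxE (eq_bigr (fun v => \sum_u A u v * (b u p * b v q))) => [|v _].
      by rewrite exchange_big pair_bigA.
    by rewrite mxE mulr_suml; apply: eq_bigr => u _; rewrite mxE; ring.
  rewrite /pfaffian (eq_bigr (fun s : 'S_m => \sum_(h : {ffun 'I_l -> 'I_m * 'I_m})
      (\prod_k A (h k).1 (h k).2) * ((-1) ^+ s * \prod_j rowsub (pair_fun h) b j (s j)))) => [|s _].
    by rewrite exchange_big; apply: eq_bigr => h _; rewrite mulr_sumr.
  under eq_bigr => k _ do rewrite bE.
  rewrite bigA_distr_bigA mulr_sumr; apply: eq_bigr => h _.
  rewrite mulrCA big_split /=; congr (_ * (_ * _)).
  by rewrite prod_mirror_even; apply: eq_bigr => k _; rewrite !mxE pair_fun_w pair_fun_rev.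
have := E 1%:M; rewrite trmx1 mul1mx mulmx1 => ->; rewrite E mulr_sumr; apply: eq_bigr => h _.
rewrite mulrCA; congr (_ * _); rewrite -{1}[a]mul1mx -mul_rowsub_mx det_mulmx.
by rewrite mulrC.
Qed.

End Pfaffian.

Section MirrorPermutations.
Variables (m : nat).
Local Notation sg := (@rev_ord m).
Local Notation l := m./2.
Hypothesis m_even : ~~ odd m.

(** [s] acts on the upper half as the mirror conjugate of its action on the lower half, so it is a
    product of two conjugate permutations. *)
Lemma odd_mirror_low (s : 'S_m) : (forall i, s (sg i) = sg (s i)) ->
  (forall k, (s (so_w k) < l)%N) -> odd_perm s = false.
Proof.
move=> s_sg s_low.
have low (i : 'I_m) : (i < l)%N -> (s i < l)%N.
  by move=> il; rewrite (_ : i = so_w (Ordinal il)) //; apply: val_inj.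
have high (i : 'I_m) : (l <= i)%N -> (l <= s i)%N.
  move=> li; have := low (sg i); rewrite s_sg /=.
  have := ltn_ord i; have := ltn_ord (s i); lia.
pose f (i : 'I_m) := if (i < l)%N then s i else i.
have f_inj : injective f.
  move=> i j; rewrite /f; case: ltnP => il; case: ltnP => jl //; first exact: perm_inj.
    by move=> E; have := low _ il; rewrite E ltnNge jl.
  by move=> E; have := low _ jl; rewrite -E ltnNge il.
pose r := perm (@rev_ord_inj m).
suff -> : s = (perm f_inj * perm f_inj ^ r)%g by rewrite odd_permM odd_permJ addbb.
apply/permP => i; rewrite permM permE /f; case: ltnP => il.
  have -> : s i = r (sg (s i)) by rewrite permE rev_ordK.
  rewrite permJ !permE /f !rev_ordK ifN ?rev_ordK //=.
  by have := low i il; have := ltn_ord (s i); lia.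
have {2}-> : i = r (sg i) by rewrite permE rev_ordK.
rewrite permJ !permE /f ifT ?s_sg ?rev_ordK //=.
by have := ltn_ord i; lia.
Qed.

(** Induction on the number of low indices sent to the upper half: composing with the transposition
    of such a mirror pair changes the parity and exactly one factor. *)
Lemma sign_mirror (R : comNzRingType) (s : 'S_m) : (forall i, s (sg i) = sg (s i)) ->
  (-1) ^+ s = \prod_(k < l) (if (s (so_w k) < l)%N then 1 else -1) :> R.
Proof.
move E : #|[set k : 'I_l | (l <= s (so_w k))%N]| => N; elim: N s E => [|N IHN] s.
  move/cards0_eq => s0 s_sg.
  have s_low k : (s (so_w k) < l)%N.
    by have := in_set0 k; rewrite -s0 inE leqNgt => /negbFE.
  by rewrite odd_mirror_low // big1 // => k _; rewrite s_low.
move=> sN s_sg.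
have [k] : exists k, k \in [set k : 'I_l | (l <= s (so_w k))%N].
  by apply/set0Pn; rewrite -card_gt0 sN.
rewrite inE => lk; pose t := tperm (so_w k) (sg (so_w k)).
have wk : so_w k != sg (so_w k).
  by rewrite -val_eqE /=; have := ltn_ord k; lia.
have t_sg i : t (sg i) = sg (t i).
  by rewrite /t (inj_tperm _ _ _ (@rev_ord_inj m)) rev_ordK tpermC.
have t_w j : j != k -> t (so_w j) = so_w j.
  move=> jk; rewrite /t tpermD //; first by rewrite (inj_eq (@so_w_inj _)) eq_sym.
  by rewrite -val_eqE /=; have := ltn_ord k; have := ltn_ord j; lia.
have ts_k : ((t * s)%g (so_w k) < l)%N.
  by rewrite permM tpermL s_sg /=; have := ltn_ord (s (so_w k)); lia.
have := IHN (t * s)%g.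
rewrite odd_permM odd_tperm wk signr_addb expr1 mulN1r => IH.
rewrite [RHS](bigD1 k) //= ifN -?leqNgt // mulN1r; apply: oppr_inj; rewrite opprK IH.
- rewrite (bigD1 k) //= ts_k mul1r; apply: eq_bigr => j jk; rewrite permM t_w //.
- apply/eqP; rewrite -eqSS -sN (cardsD1 k [set k | (l <= s (so_w k))%N]) inE lk add1n eqSS.
  apply/eqP/eq_card => j; rewrite !inE; have [->|jk] := eqVneq j k; first by rewrite leqNgt ts_k.
  by rewrite permM t_w.
by move=> i; rewrite !permM t_sg s_sg.
Qed.

End MirrorPermutations.

Section PfaffianCartan.
Variables (F : numClosedFieldType) (m : nat).
Local Notation sg := (@rev_ord m).
Local Notation J := (anti_mx F m).
Local Notation l := m./2.
Hypothesis m_even : ~~ odd m.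

(** The matrix is congruent to the one for a = (1, ..., 1) through D = diag (a_1, ..., a_l, 1, ...,
    1). *)
Lemma pfaffian_dm (a : 'I_l -> F) : pfaffian (J *m diag_mx (\row_i so_d a i))
  = (\prod_k a k) * pfaffian (J *m diag_mx (\row_i so_d (fun=> 1) i)).
Proof.
pose D := diag_mx (\row_(i < m) (if insub (i : nat) is Some k then a k else 1 : F)).
have -> : J *m diag_mx (\row_i so_d a i)
    = D^T *m (J *m diag_mx (\row_i so_d (fun=> 1) i)) *m D.
  rewrite tr_diag_mx mul_mx_diag mul_diag_mx !mul_mx_diag; apply/matrixP => i j; rewrite !mxE.
  case: eqP => [->|_]; rewrite ?mul0r ?mulr0 ?mul0r // !mul1r.
  rewrite !so_d_rev mulrN mulNr; congr (- _).
  have [il|li] := ltnP i l.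
    have -> : i = so_w (Ordinal il) by apply: val_inj.
    by rewrite !so_d_w [insub _]valK insubN ?mulr1 //=; lia.
  have sil : (sg i < l)%N by rewrite /=; have := ltn_ord i; lia.
  have iE : i = sg (so_w (Ordinal sil)) by rewrite -[LHS]rev_ordK; congr sg; apply: val_inj.
  move: (Ordinal sil) iE => k ->; rewrite !so_d_rev !so_d_w rev_ordK [insub (val (so_w k))]valK.
  by rewrite insubN /=; [ring|have := ltn_ord k; lia].
rewrite pfaffian_congr // det_diag; congr (_ * _).
rewrite prod_mirror_even //; apply: eq_bigr => k _.
by rewrite !mxE valK insubN ?mulr1 //=; have := ltn_ord k; lia.
Qed.

(** Only permutations commuting with the reversal contribute, and by [sign_mirror] each contributes
    the same sign, so nothing cancels. *)
Lemma pfaffian_dm1_neq0 : pfaffian (J *m diag_mx (\row_i so_d (fun=> 1) i)) != 0 :> F.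
Proof.
pose H := [set s : 'S_m | [forall i, s (sg i) == sg (s i)]].
suff -> : pfaffian (J *m diag_mx (\row_i so_d (fun=> 1) i)) = (-1) ^+ l *+ #|H|.
  rewrite mulrn_eq0 signr_eq0 orbF -lt0n; apply/card_gt0P; exists 1%g.
  by rewrite inE; apply/forallP => i; rewrite !perm1.
rewrite /pfaffian (bigID (mem H)) /= [X in _ + X]big1 ?addr0 => [|s].
  rewrite -sumr_const; apply: eq_bigr => s; rewrite inE => /forallP s_sg.
  rewrite sign_mirror // -?big_split /=; last by move=> i; apply/eqP.
  rewrite -[l in RHS]card_ord -prodr_const; apply: eq_bigr => k _.
  rewrite mul_mx_diag !mxE (eqP (s_sg _)) eqxx mul1r so_d_rev.
  set i := s _; case: ltnP => il.
    by rewrite mul1r (_ : i = so_w (Ordinal il)) ?so_d_w //; apply: val_inj.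
  have sil : (sg i < l)%N by rewrite /=; have := ltn_ord i; lia.
  by rewrite -so_d_rev (_ : sg i = so_w (Ordinal sil)) ?so_d_w ?mulr1 //; apply: val_inj.
rewrite inE negb_forall => /existsP[i si].
have [k sk] : exists k, s (sg (so_w k)) != sg (s (so_w k)).
  have [il|li] := ltnP i l.
    exists (Ordinal il); rewrite (_ : so_w _ = i) //; exact: val_inj.
  have sil : (sg i < l)%N by rewrite /=; have := ltn_ord i; lia.
  exists (Ordinal sil); rewrite (_ : so_w _ = sg i) //; last exact: val_inj.
  by apply: contra si => /eqP; rewrite rev_ordK => ->; rewrite rev_ordK.
by rewrite (bigD1 k) //= mul_mx_diag !mxE (negPf sk) mul0r mul0r mulr0.
Qed.

End PfaffianCartan.

(** * The Weyl group and the invariants of orthogonal algebras *)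

Section OrthogonalWeyl.
Variables (F : numClosedFieldType) (m : nat).
Local Notation sg := (@rev_ord m).
Local Notation J := (anti_mx F m).
Local Notation l := m./2.

Lemma mirror_cases (i : 'I_m) :
  [\/ exists k, i = so_w k, exists k, i = sg (so_w k) | sg i = i /\ (l <= i)%N].
Proof.
have [il|li] := ltnP i l; first by constructor 1; exists (Ordinal il); apply: val_inj.
have [sil|lsi] := ltnP (sg i) l.
  by constructor 2; exists (Ordinal sil); rewrite -[LHS]rev_ordK; congr sg; apply: val_inj.
constructor 3; split=> //; apply: val_inj => /=; move: lsi => /=.
have := ltn_ord i; lia.
Qed.

Lemma so_d_mid (a : 'I_l -> F) i : sg i = i -> so_d a i = 0.
Proof.
move=> ii; have /eqP : so_d a i = - so_d a i by rewrite -{1}ii so_d_rev.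
by rewrite -addr_eq0 -mulr2n mulrn_eq0 /= => /eqP.
Qed.

(** Ensures that the diagonal matrix has simple spectrum ([so_d_inj]). *)
Definition so_regular (a : 'I_l -> F) :=
  injective (fun k => a k ^+ 2) /\ forall k, a k != 0.

Lemma so_d_inj (a : 'I_l -> F) : so_regular a -> injective (so_d a).
Proof.
move=> [t_inj aN0].
have aN k u : a k = - a u -> False.
  move=> ku; have ku' : k = u by apply: t_inj; rewrite /= ku sqrrN.
  have /eqP : a u = - a u by rewrite -{1}ku'.
  by rewrite -addr_eq0 -mulr2n mulrn_eq0 /= (negPf (aN0 u)).
have a_inj k u : a k = a u -> k = u by move=> ku; apply: t_inj; rewrite /= ku.
have N0 k : a k <> 0 by apply/eqP.
move=> i j; case: (mirror_cases i) => [[k ->]|[k ->]|[ii li]];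
  case: (mirror_cases j) => [[u ->]|[u ->]|[jj lj]];
  rewrite ?so_d_rev ?so_d_w ?(so_d_mid _ ii) ?(so_d_mid _ jj).
- by move=> /a_inj ->.
- by move=> /aN.
- by move=> /N0.
- by move=> /esym/aN.
- by move=> /oppr_inj/a_inj ->.
- by move=> /eqP; rewrite oppr_eq0 => /eqP/N0.
- by move=> /esym/N0.
- by move=> /esym/eqP; rewrite oppr_eq0 => /eqP/N0.
move=> _; apply: val_inj; move: (congr1 val ii) (congr1 val jj) => /=.
have := ltn_ord i; have := ltn_ord j; lia.
Qed.

Lemma so_regular_sign (a : 'I_l -> F) (tau : 'S_l) (ep : 'I_l -> bool) : so_regular a ->
  so_regular (fun k => (-1) ^+ ep k * a (tau k)).
Proof.
move=> [t_inj aN0]; split=> [k u|k]; last by rewrite mulf_neq0 ?signr_eq0.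
by rewrite !exprMn !sqrr_sign !mul1r => /t_inj/perm_inj.
Qed.

Lemma so_regular_nat : so_regular (fun k => k.+1%:R).
Proof.
split=> [k u|k]; last by rewrite pnatr_eq0.
move=> /eqP; rewrite -!natrX eqr_nat eqn_exp2r // => /eqP[ku].
exact: val_inj.
Qed.

(** Realizes a signed permutation of the parameters on the indices: where the sign is -1, mirror
    indices are exchanged. *)
Lemma mirror_perm (tau : 'S_l) (ep : 'I_l -> bool) : exists s : 'S_m,
  [/\ forall i, s (sg i) = sg (s i),
    forall a i, so_d a (s i) = so_d (fun k => (-1) ^+ ep k * a (tau k)) i :> F
    & ~~ odd m -> (-1) ^+ s = \prod_k (-1) ^+ ep k :> F].
Proof.
pose h := [ffun k => if ep k then (sg (so_w (tau k)), so_w (tau k))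
                     else (so_w (tau k), sg (so_w (tau k)))].
pose f := @pair_fun m h.
have f_mid i : sg i = i -> (l <= i)%N -> f i = i.
  move=> ii li; rewrite /f /pair_fun insubN -?leqNgt //.
  by have:= congr1 val ii; move=> /= ->; rewrite insubN -?leqNgt.
have f_w k : f (so_w k) = if ep k then sg (so_w (tau k)) else so_w (tau k).
  by rewrite /f pair_fun_w ffunE; case: (ep k).
have f_rev k : f (sg (so_w k)) = sg (f (so_w k)).
  by rewrite f_w /f pair_fun_rev ffunE; case: (ep k); rewrite ?rev_ordK.
have f_sg i : f (sg i) = sg (f i).
  case: (mirror_cases i) => [[k ->]|[k ->]|[ii li]] //; first by rewrite f_rev !rev_ordK.
  by rewrite ii f_mid.
have f_d a i : so_d a (f i) = so_d (fun k => (-1) ^+ ep k * a (tau k)) i :> F.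
  have fw k : so_d a (f (so_w k)) = (-1) ^+ ep k * a (tau k).
    by rewrite f_w; case: (ep k); rewrite ?so_d_rev so_d_w ?expr1 ?expr0 ?mulN1r ?mul1r.
  case: (mirror_cases i) => [[k ->]|[k ->]|[ii li]]; rewrite ?f_sg ?so_d_rev ?fw ?so_d_w //.
  by rewrite f_mid // !so_d_mid.
have f_inj : injective f.
  move=> i j /(congr1 (so_d (fun k => k.+1%:R : F))); rewrite !f_d; apply: so_d_inj.
  exact: (so_regular_sign tau ep so_regular_nat).
exists (perm f_inj); split=> [i|a i|om]; rewrite ?permE //.
rewrite sign_mirror // => [|i]; last by rewrite !permE.
apply: eq_bigr => k _; rewrite permE f_w; case: (ep k); last by rewrite /= ltn_ord.
rewrite ifN // -leqNgt /=; have := ltn_ord (tau k); lia.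
Qed.

Lemma perm_mx_anti (s : 'S_m) : (forall i, s (sg i) = sg (s i)) ->
  (perm_mx s)^T *m J *m perm_mx s = J.
Proof.
move=> s_sg; suff E : J *m perm_mx s = perm_mx s *m J.
  by rewrite -mulmxA E mulmxA tr_perm_mx -perm_mxM mulVg perm_mx1 mul1mx.
by apply/matrixP => i j; rewrite mul_anti_mx -row_permE !mxE s_sg eq_sym.
Qed.

Lemma so_weyl (tau : 'S_l) (ep : 'I_l -> bool) : odd m || (\prod_k (-1) ^+ ep k == 1 :> F) ->
  exists2 A : 'M[F]_m, so_group A & forall a,
   adj A (diag_mx (\row_i so_d a i)) = diag_mx (\row_i so_d (fun k => (-1) ^+ ep k * a (tau k)) i).
Proof.
move=> ep1; have [s [s_sg s_d s_odd]] := mirror_perm tau ep.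
(* For odd m the scalar -1 has determinant -1 and corrects an odd permutation; for even m the
   condition on [ep] already makes [s] even. *)
pose b := odd m && odd_perm s.
exists ((-1) ^+ b *: perm_mx s : 'M[F]_m).
  split.
    rewrite -scalemxAr [(_ *: _)^T]linearZ /= -!scalemxAl scalerA perm_mx_anti // -expr2 sqrr_sign.
    exact: scale1r.
  rewrite detZ det_perm /b; move: ep1; case: (boolP (odd m)) => om /=.
    by case: (odd_perm s) => _; rewrite ?expr1 ?expr0 ?expr1n ?mulr1 // -signr_odd om expr1 mulrNN mulr1.
  by move=> /eqP ep1; rewrite s_odd // ep1 expr0 expr1n mulr1.
move=> a; have -> : \row_i so_d (fun k => (-1) ^+ ep k * a (tau k)) i = \row_i so_d a (s i).
  by apply/rowP => i; rewrite !mxE s_d.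
rewrite -(adj_perm_diag s (so_d a)) /adj.
have -> : invmx ((-1) ^+ b *: perm_mx s) = (-1) ^+ b *: invmx (perm_mx s) :> 'M[F]_m.
  rewrite invmxZ ?unitfE ?signr_eq0 ?unitmx_perm //; first by rewrite invr_sign.
  by rewrite unitmxZ ?unitmx_perm // unitfE signr_eq0.
by rewrite -!scalemxAl -scalemxAr scalerA -expr2 sqrr_sign scale1r.
Qed.

End OrthogonalWeyl.

(** * Chevalley restriction for so(m) *)

Section ParityInvariants.
Variables (F : numClosedFieldType) (l : nat).
Implicit Types (f : {mpoly F[l]}) (a c : 'I_l -> F).

Lemma scaling_msupp f c : (forall a, f.@[fun k => c k * a k] = f.@[a]) ->
  forall u, u \in msupp f -> \prod_k c k ^+ u k = 1.
Proof.
move=> fc u uf.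
have E : f = \sum_(v <- msupp f) (f@_v * \prod_k c k ^+ v k) *: 'X_[v].
  apply: mpoly_eval_inj => a; rewrite -fc mevalE raddf_sum; apply: eq_bigr => v _ /=.
  rewrite mevalZ mevalX -mulrA -big_split; congr (_ * _); apply: eq_bigr => k _ /=.
  by rewrite exprMn.
move/(congr1 (mcoeff u)): E; rewrite raddf_sum (bigD1_seq u) ?msupp_uniq //= [X in _ + X]big1 => [|v /negPf vu].
  rewrite addr0 mcoeffZ mcoeffX eqxx mulr1 => /esym/eqP; rewrite -subr_eq0 -[X in _ - X]mulr1 -mulrBr.
  by rewrite mulf_eq0 mcoeff_eq0 uf /= subr_eq0 => /eqP.
by rewrite mcoeffZ mcoeffX vu mulr0.
Qed.

(** The exponents of a monomial are all even, or all odd; in the latter case the product of the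
    variables splits off. *)
Lemma parity_decomp f : (forall u, u \in msupp f -> forall i j, odd (u i) = odd (u j)) ->
  exists p0 p1 : {mpoly F[l]},
    (forall a, f.@[a] = p0.@[fun k => a k ^+ 2] + (\prod_k a k) * p1.@[fun k => a k ^+ 2])
    /\ ((forall u, u \in msupp f -> forall i, ~~ odd (u i)) -> p1 = 0).
Proof.
move=> f_par; pose E (u : 'X_{1..l}) := [forall i, ~~ odd (u i)].
pose p (Q : pred 'X_{1..l}) : {mpoly F[l]} :=
  \sum_(u <- msupp f | Q u) f@_u *: 'X_[[multinom (u i)./2 | i < l]].
have pE Q a : (p Q).@[fun k => a k ^+ 2] = \sum_(u <- msupp f | Q u) f@_u * \prod_k a k ^+ (u k)./2.*2.
  rewrite raddf_sum; apply: eq_bigr => u _ /=; rewrite mevalZ mevalX; congr (_ * _).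
  by apply: eq_bigr => k _; rewrite mnmE -exprM mul2n.
exists (p E), (p (predC E)); split=> [a|f_even]; last first.
  rewrite /p big_seq_cond big_pred0 // => u; apply/negP => /andP[uf /negP[]].
  by apply/forallP => i; apply: f_even.
rewrite !pE mevalE (bigID E) /=; congr (_ + _).
  apply: eq_bigr => u /forallP uE; congr (_ * _); apply: eq_bigr => k _.
  by congr (_ ^+ _); rewrite -[LHS]odd_double_half (negPf (uE k)).
rewrite mulr_sumr big_seq_cond [RHS]big_seq_cond; apply: eq_bigr => u /andP[uf].
case/forallPn => i; rewrite negbK => ui.
rewrite mulrCA; congr (_ * _); rewrite -big_split; apply: eq_bigr => k _ /=.
by rewrite -exprS -[LHS](congr1 (GRing.exp _) (odd_double_half _)) (f_par u uf k i) ui.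
Qed.

Lemma symmetrize (p : {mpoly F[l]}) : exists2 q : {mpoly F[l]},
  q \is mpoly.symmetric & forall a, l`!%:R * q.@[a] = \sum_(s : 'S_l) p.@[fun k => a (s k)].
Proof.
pose q := (l`!%:R)^-1 *: \sum_(s : 'S_l) (p \mPo [tuple 'X_(s k) | k < l]).
have qE a : l`!%:R * q.@[a] = \sum_(s : 'S_l) p.@[fun k => a (s k)].
  rewrite mevalZ mulrA divff ?pnatr_eq0 -?lt0n ?fact_gt0 // mul1r raddf_sum.
  apply: eq_bigr => s _ /=; rewrite comp_mpoly_meval; apply: meval_eq => k.
  by rewrite tnth_mktuple mevalXU.
exists q => //; apply: symmetric_of_meval => s a.
have lN0 : l`!%:R != 0 :> F by rewrite pnatr_eq0 -lt0n fact_gt0.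
apply: (mulfI lN0); rewrite !qE (reindex_inj (mulIg s^-1)%g) /=.
by apply: eq_bigr => t _; apply: meval_eq => k; rewrite permM permKV.
Qed.

(** Both parts are averaged over permutations instead of being shown symmetric; the decomposition
    survives because [f] and the product of the variables are fixed. *)
Lemma symmetric_parity_decomp f :
  (forall (s : 'S_l) a, f.@[fun k => a (s k)] = f.@[a]) ->
  (forall u, u \in msupp f -> forall i j, odd (u i) = odd (u j)) ->
  exists s0 s1 : {mpoly F[l]},
    let es a j := (mesym l F j.+1).@[fun k : 'I_l => a k ^+ 2] in
    (forall a, f.@[a] = s0.@[es a] + (\prod_k a k) * s1.@[es a])
    /\ ((forall u, u \in msupp f -> forall i, ~~ odd (u i)) -> forall a, s1.@[es a] = 0).
Proof.
move=> f_sym /parity_decomp[p0 [p1 [fE p10]]].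
have lN0 : l`!%:R != 0 :> F by rewrite pnatr_eq0 -lt0n fact_gt0.
have [q0 /mesym_generate[s0 s0E] q0E] := symmetrize p0.
have [q1 /mesym_generate[s1 s1E] q1E] := symmetrize p1.
exists s0, s1; split=> [a|/p10 p1_0 a]; last first.
  rewrite -s1E; apply: (mulfI lN0); rewrite q1E mulr0 big1 // => s _.
  by rewrite p1_0 meval0.
rewrite -s0E -s1E; apply: (mulfI lN0); rewrite mulrDr mulrCA q0E q1E [in RHS]mulr_sumr -big_split /=.
rewrite -card_Sn mulr_natl -sumr_const; apply: eq_bigr => s _.
rewrite -(f_sym s) fE; congr (_ + _ * _).
by rewrite [RHS](reindex_inj (@perm_inj _ s)).
Qed.

End ParityInvariants.

Section OrthogonalChevalley.
Variables (F : numClosedFieldType) (m : nat).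
Local Notation l := m./2.
Local Notation dm a := (diag_mx (\row_i so_d a i)).

Definition so_squares : l.-tuple {mpoly F[l]} := [tuple 'X_i ^+ 2 | i < l].

Lemma so_squaresE (a : 'I_l -> F) k : (tnth so_squares k).@[a] = a k ^+ 2.
Proof. by rewrite tnth_mktuple rmorphXn /= mevalXU. Qed.

(* The index at which, for m even, the Pfaffian takes the place of the         *)
(* determinant.                                                                *)
Definition pf_index (j : 'I_l) := ~~ odd m && (j.+1 == l).

Definition so_P : l.-tuple {mpoly F[l]} :=
  [tuple if pf_index j then \prod_i 'X_i else mesym l F j.+1 \mPo so_squares | j < l].

Lemma so_PE (a : 'I_l -> F) j : (tnth so_P j).@[a] =
  if pf_index j then \prod_i a i else (mesym l F j.+1).@[fun k => a k ^+ 2].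
Proof.
rewrite tnth_mktuple; case: ifP => _.
  by rewrite rmorph_prod; apply: eq_bigr => i _ /=; rewrite mevalXU.
by rewrite comp_mpoly_meval; apply: meval_eq => k; rewrite so_squaresE.
Qed.

Lemma mesym_top (t : 'I_l -> F) j : j.+1 = l -> (mesym l F j.+1).@[t] = \prod_i t i.
Proof.
move=> ->; rewrite mesymnnE rmorph_prod; apply: eq_bigr => i _ /=.
by rewrite mevalXU.
Qed.

(** Permutations make [f] symmetric. For odd m single sign changes make all exponents even; for even
    m sign changes in pairs make the exponents of a monomial equal in parity, and the odd part
    carries the Pfaffian as a factor. *)
Lemma so_chevalley (f : {mpoly F[l]}) :
  (forall (A : 'M[F]_m) a a', so_group A -> adj A (dm a) = dm a' -> f.@[a'] = f.@[a]) ->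
  exists s : {mpoly F[l]}, forall a, f.@[a] = s.@[fun j => (tnth so_P j).@[a]].
Proof.
move=> f_inv.
have f_weyl (tau : 'S_l) (ep : 'I_l -> bool) a : odd m || (\prod_k (-1) ^+ ep k == 1 :> F) ->
    f.@[fun k => (-1) ^+ ep k * a (tau k)] = f.@[a].
  by case/(so_weyl tau) => A GA /(_ a); apply: f_inv.
have f_sym (s : 'S_l) a : f.@[fun k => a (s k)] = f.@[a].
  rewrite -[RHS](f_weyl s (fun=> false)) ?big1 ?eqxx ?orbT //.
  by apply: meval_eq => k; rewrite mul1r.
have sgn1 (b : bool) : ((-1) ^+ b == 1 :> F) = ~~ b.
  by case: b; rewrite ?eqxx // expr1 eq_sym -addr_eq0 -[1 + 1]/(2%:R) pnatr_eq0.
have f_odd : odd m -> forall u, u \in msupp f -> forall i, ~~ odd (u i).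
  move=> om u uf i.
  have : \prod_k ((-1) ^+ (k == i)) ^+ u k = 1 :> F.
    apply: scaling_msupp uf => a; rewrite -[RHS](f_weyl 1%g (fun k => k == i)) ?om //.
    by apply: meval_eq => k; rewrite perm1.
  rewrite (bigD1 i) //= eqxx expr1 big1 ?mulr1 => [|k /negPf ->]; last by rewrite expr1n.
  by move/eqP; rewrite -signr_odd sgn1.
have f_even u : u \in msupp f -> forall i j, odd (u i) = odd (u j).
  move=> uf i j; case: (boolP (odd m)) => [/f_odd om|om]; first by rewrite !(negPf (om _ _ _)).
  have [->//|ij] := eqVneq i j.
  pose ep (k : 'I_l) := (k == i) || (k == j).
  have ep1 (e : 'I_l -> nat) : \prod_k ((-1) ^+ ep k) ^+ e k = (-1) ^+ e i * (-1) ^+ e j :> F.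
    rewrite (bigD1 i) //= (bigD1 j) 1?eq_sym //= big1 => [|k /andP[/negPf ki /negPf kj]].
      by rewrite /ep !eqxx orbT mulr1.
    by rewrite /ep ki kj expr1n.
  have : \prod_k ((-1) ^+ ep k) ^+ u k = 1 :> F.
    apply: scaling_msupp uf => a; rewrite -[RHS](f_weyl 1%g ep) ?om /=.
      by apply: meval_eq => k; rewrite perm1.
    by apply/orP; right; apply/eqP; apply: (etrans (ep1 (fun=> 1%N))); rewrite !expr1 mulrNN mulr1.
  rewrite ep1 -exprD => /eqP; rewrite -signr_odd sgn1 oddD.
  by case: (odd (u i)); case: (odd (u j)).
have [s0 [s1 [fE f1]]] := symmetric_parity_decomp f_sym f_even.
(* Recovers the elementary symmetric functions of the squares from [so_P]: at [pf_index] the top one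
   is the square of the product of the a_k. *)
pose T := [tuple if pf_index j then 'X_j ^+ 2 else 'X_j | j < l] : l.-tuple {mpoly F[l]}.
have TE a (j : 'I_l) : (tnth T j).@[fun j => (tnth so_P j).@[a]]
    = (mesym l F j.+1).@[fun k => a k ^+ 2].
  rewrite tnth_mktuple; case: (boolP (pf_index j)) => pj.
    rewrite rmorphXn /= mevalXU so_PE pj; have /andP[_ /eqP jl] := pj.
    by rewrite mesym_top // -prodrXl.
  by rewrite mevalXU so_PE (negPf pj).
have sE (p : {mpoly F[l]}) a : (p \mPo T).@[fun j => (tnth so_P j).@[a]]
    = p.@[fun j : 'I_l => (mesym l F j.+1).@[fun k => a k ^+ 2]].
  by rewrite comp_mpoly_meval; apply: meval_eq => j; rewrite TE.
case: (boolP (odd m)) => [om|om].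
  by exists (s0 \mPo T) => a; rewrite sE fE f1 ?mulr0 ?addr0 //; apply: f_odd.
have [l0|l_gt0] := posnP l.
  exists ((s0 \mPo T) + (s1 \mPo T)) => a; rewrite mevalD !sE fE.
  by rewrite big1 ?mul1r // => k _; have := ltn_ord k; rewrite {2}l0.
have jl : (l.-1 < l)%N by rewrite prednK.
exists ((s0 \mPo T) + 'X_(Ordinal jl) * (s1 \mPo T)) => a.
rewrite mevalD mevalM mevalXU !sE so_PE /pf_index om /= prednK // eqxx.
exact: fE.
Qed.

End OrthogonalChevalley.

(** * The Jacobian of the invariants of so(m) *)

Section OrthogonalJacobian.
Variables (F : numClosedFieldType) (m : nat).
Local Notation l := m./2.
Local Notation S := (so_pos m).
Local Notation jac P a := (\matrix_(j, i) (P j)^`M(i).@[a]).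
Hypothesis m_gt0 : (0 < m)%N.

Lemma mderiv_sqr k (p : {mpoly F[k]}) i a : (p ^+ 2)^`M(i).@[a] = 2 * p.@[a] * p^`M(i).@[a].
Proof. by rewrite expr2 mderivM mevalD !mevalM; ring. Qed.

Lemma so_jac_squares (a : 'I_l -> F) : injective (fun k => a k ^+ 2) ->
  (\det (jac (fun j : 'I_l => mesym l F j.+1 \mPo so_squares F m) a)) ^+ 4
   = vdm (fun k => a k ^+ 2) ^+ 4 * 16 ^+ l * (\prod_k a k ^+ 2) ^+ 2.
Proof.
move=> t_inj.
have -> : jac (fun j : 'I_l => mesym l F j.+1 \mPo so_squares F m) a
   = (\matrix_(j, i) (mesym l F j.+1)^`M(i).@[fun k => a k ^+ 2]) *m diag_mx (\row_i (2 * a i)).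
  rewrite mul_mx_diag; apply/matrixP => j i; rewrite !mxE mderiv_comp_mpoly (bigD1 i) //=.
  rewrite big1 ?addr0 => [|k /negPf ki]; rewrite tnth_mktuple mderiv_sqr mevalXU mderivX mnm1E.
    have -> : (U_(i) - U_(i) = 0)%MM by apply/mnmP => k; rewrite mnmBE subnn mnm0E.
    rewrite eqxx mpolyX0 scale1r meval1 mulr1; congr (_ * _).
    by apply: meval_eq => k; rewrite so_squaresE.
  by rewrite ki scale0r meval0 !mulr0.
rewrite det_mulmx exprMn (exprM _ 2 2) det_jac_mesym // -exprM -mulrA; congr (_ * _).
rewrite det_diag; have -> : \prod_i (\row_i (2 * a i)) 0 i = 2 ^+ l * \prod_i a i.
  have <- : \prod_(i < l) 2 = 2 ^+ l :> F by rewrite prodr_const card_ord.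
  rewrite -big_split; apply: eq_bigr => i _.
  by rewrite !mxE.
rewrite prodrXl exprMn -!exprM mulnC exprM; congr (_ ^+ _ * _).
by rewrite -natrX.
Qed.

(** Fourth power of the factors 2 coming from the derivatives of the a_k^2; for even m one of them
    is lost when the Pfaffian replaces its square. *)
Definition so_kappa : F := if odd m then 16 ^+ l else 16 ^+ l.-1.

Lemma so_kappa_neq0 : so_kappa != 0.
Proof. by rewrite /so_kappa; case: ifP => _; rewrite expf_neq0 ?pnatr_eq0. Qed.

Lemma so_jacobian (a : 'I_l -> F) : so_regular a ->
  (\det (jac (tnth (so_P F m)) a)) ^+ 4
    = so_kappa * (\prod_(p in root_set S) (so_d a p.1 - so_d a p.2)) ^+ 2.
Proof.
move=> [t_inj aN0]; rewrite so_delta_eq //; have := so_jac_squares t_inj.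
pose JB := jac (fun j : 'I_l => mesym l F j.+1 \mPo so_squares F m) a.
pose JP := jac (tnth (so_P F m)) a; rewrite -/JB -/JP /so_kappa.
case: (boolP (odd m)) => om.
  have -> : JP = JB.
    by apply/matrixP => j i; rewrite !mxE tnth_mktuple /pf_index om.
  by move=> ->; ring.
have l_gt0 : (0 < l)%N by lia.
have jl : (l.-1 < l)%N by rewrite prednK.
have pfE (j : 'I_l) : pf_index j = (j == Ordinal jl).
  by rewrite /pf_index om -val_eqE -[RHS]eqSS [val (Ordinal _)]/= prednK.
(* The last row of [JB] is the gradient of the squared product of the a_k, hence twice that product
   times the Pfaffian row of [JP]. *)
have -> : JB = diag_mx (\row_j (if pf_index j then 2 * \prod_k a k else 1)) *m JP.
  rewrite mul_diag_mx; apply/matrixP => j i; rewrite !mxE tnth_mktuple.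
  case: ifP => [/andP[_ /eqP jE]|_]; last by rewrite mul1r.
  have -> : mesym l F j.+1 \mPo so_squares F m = (\prod_k 'X_k) ^+ 2.
    apply: mpoly_eval_inj => b; rewrite comp_mpoly_meval mesym_top // rmorphXn rmorph_prod -prodrXl /=.
    by apply: eq_bigr => k _; rewrite so_squaresE mevalXU.
  rewrite mderiv_sqr; congr (_ * _ * _); rewrite rmorph_prod; apply: eq_bigr => k _ /=.
  by rewrite mevalXU.
rewrite det_mulmx det_diag.
have -> : \prod_j (\row_(j < l) (if pf_index j then 2 * \prod_k a k else 1) : 'rV_l) 0 j = 2 * \prod_k a k.
  rewrite [LHS](bigD1 (Ordinal jl)) //= mxE pfE eqxx [X in _ * X]big1 ?mulr1 // => j /negPf jj.
  by rewrite mxE pfE jj.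
rewrite muln0 expr0 mul1r prodrXl -[l in 16 ^+ l]prednK // (exprS 16).
have aN : \prod_k a k != 0 by apply/prodf_neq0.
move: (\prod_k a k) aN (16 ^+ l.-1) (\det JP) (vdm _) => p pN0 k d v E.
have p4 : 16 * p ^+ 4 != 0 by rewrite mulf_neq0 ?pnatr_eq0 ?expf_neq0.
apply: (mulfI p4); transitivity ((2 * p * d) ^+ 4); first ring.
by rewrite E; ring.
Qed.

End OrthogonalJacobian.

(** * Conjugating generic elements of so(m) into the Cartan subalgebra *)

Lemma opp_pairing (F : numFieldType) (rs : seq F) : uniq rs ->
  (forall x, x \in rs -> - x \in rs) -> exists xs,
  [/\ size xs = (size rs)./2, forall x, x \in xs -> x \in rs /\ x != 0,
      uniq [seq x ^+ 2 | x <- xs] & odd (size rs) -> 0 \in rs].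
Proof.
have [N] := ubnP (size rs); elim: N rs => // N IHN rs rsN urs rs_opp.
have [/hasP[x xrs x0]|/hasPn rs0] := boolP (has (fun x => x != 0) rs); last first.
  case: rs {IHN rsN rs_opp} rs0 urs => [|x [|y rs]] rs0 urs; first by exists [::].
    exists [::]; split=> //= _; have := rs0 x (mem_head _ _).
    by rewrite negbK => /eqP ->; apply: mem_head.
  have yrs : y \in [:: x, y & rs] by rewrite !inE eqxx orbT.
  have := rs0 x (mem_head _ _); have := rs0 y yrs.
  by rewrite !negbK => /eqP y0 /eqP x0; move: urs; rewrite x0 y0 /= mem_head.
have xNx : - x != x by rewrite eq_sym -addr_eq0 -mulr2n mulrn_eq0.
have xrem : x \in rem (- x) rs by rewrite mem_rem_uniq // !inE eq_sym xNx xrs.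
(* Removing a pair x, -x leaves a list closed under opposites; without nonzero entries a
   duplicate-free list has length at most one. *)
pose rs' := rem x (rem (- x) rs).
have rs'E y : (y \in rs') = [&& y != x, y != - x & y \in rs].
  by rewrite mem_rem_uniq ?rem_uniq // !inE mem_rem_uniq // !inE.
have szE : size rs = (size rs').+2.
  have : (0 < size (rem (- x) rs))%N by case: (rem _ _) xrem.
  by rewrite /rs' (size_rem xrem) (size_rem (rs_opp x xrs)); clear; move: (size rs) => k; lia.
have [||y|xs [sz xsrs' uxs o]] := IHN rs'.
- by move: rsN; rewrite szE ltnS => /ltnW.
- by rewrite !rem_uniq.
- by rewrite !rs'E eqr_oppLR eqr_opp => /and3P[-> -> /rs_opp ->].
exists (x :: xs); split=> [|y|/=|].
- by rewrite szE /= sz.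
- rewrite inE => /orP[/eqP -> //|/xsrs'[]].
  by rewrite rs'E => /and3P[].
- rewrite uxs andbT; apply/negP => /mapP[y /xsrs'[+ _] /esym/eqP].
  by rewrite rs'E eqf_sqr => /and3P[/negPf -> /negPf ->].
by rewrite szE /= negbK => /o; rewrite rs'E => /and3P[].
Qed.

Section OrthogonalDensity.
Variables (F : numClosedFieldType) (m : nat).
Local Notation sg := (@rev_ord m).
Local Notation J := (anti_mx F m).
Local Notation l := m./2.
Local Notation dm a := (diag_mx (\row_i so_d a i)).
Hypothesis m_gt0 : (0 < m)%N.

(** X^T is conjugate to -X by [J], and has the same characteristic polynomial as X. *)
Lemma so_model_root (X : 'M[F]_m) z : so_model X -> root (char_poly X) z -> root (char_poly X) (- z).
Proof.
move=> /so_modelP XJ; rewrite -!eigenvalue_root_char => /eigenvalueP[v vX v0].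
have JX : J *m X^T = - (X *m J).
  have := congr1 (fun A => J *m A *m J) XJ; rewrite mulmx0 mul0mx mulmxDr mulmxDl.
  rewrite -!mulmxA anti_mxK mulmx1 (mulmxA J J) anti_mxK mul1mx => /eqP.
  by rewrite addr_eq0 => /eqP.
have : eigenvalue X^T (- z).
  apply/eigenvalueP; exists (v *m J).
    by rewrite -mulmxA JX mulmxN mulmxA vX -scalemxAl scaleNr.
  by apply: contraNneq v0 => /(congr1 (mulmxr J)) /=; rewrite -mulmxA anti_mxK mulmx1 mul0mx => ->.
rewrite (eigenvalue_root_char X^T) (eigenvalue_root_char X).
suff -> : char_poly X^T = char_poly X by [].
by rewrite /char_poly -det_tr /char_poly_mx linearB /= tr_scalar_mx map_trmx trmxK.
Qed.

Lemma so_ordered_roots (X : 'M[F]_m) : so_model X -> separable_poly (char_poly X) ->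
  exists2 a : 'I_l -> F, so_regular a & forall i, root (char_poly X) (so_d a i).
Proof.
move=> mX /char_poly_roots[rs [urs srs rsE]].
have rsP z : (z \in rs) = root (char_poly X) z by rewrite rsE root_prod_XsubC.
have [|xs [sz xsP uxs o]] := opp_pairing urs.
  by move=> z; rewrite !rsP; apply: so_model_root.
rewrite srs in sz o.
pose a (k : 'I_l) := xs`_k.
have ax k : a k \in xs by rewrite mem_nth ?sz.
have ra : so_regular a.
  split=> [k u /eqP|k]; last by have [] := xsP _ (ax k).
  rewrite /a /= -!(nth_map 0 0 (fun x => x ^+ 2)) ?sz // nth_uniq ?size_map ?sz //.
  by move=> /eqP/val_inj.
have rk k : root (char_poly X) (a k) by rewrite -rsP; have [] := xsP _ (ax k).
exists a => // i; case: (mirror_cases i) => [[k ->]|[k ->]|[ii li]].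
- by rewrite so_d_w.
- by rewrite so_d_rev so_d_w; apply: so_model_root.
rewrite so_d_mid // -rsP o //; move: (congr1 val ii) => /=.
by have := ltn_ord i; lia.
Qed.

(* The Gram matrix P^T J P is supported on the antidiagonal; rescaling the    *)
(* columns of P makes it equal to J.                                          *)
Lemma so_rescale (X P : 'M[F]_m) (d : 'I_m -> F) : so_model X -> injective d ->
  (forall i, d (sg i) = - d i) -> P \in unitmx -> X = adj P (diag_mx (\row_i d i)) ->
  exists Q, [/\ Q \in unitmx, Q^T *m J *m Q = J & X = adj Q (diag_mx (\row_i d i))].
Proof.
move=> /so_modelP XJ d_inj d_sg PU XE; pose D := diag_mx (\row_i d i).
have XP : X *m P = P *m D by rewrite XE /adj mulmxKV.
have [H HE] : exists H, H = P^T *m J *m P by exists (P^T *m J *m P).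
have DH : D *m H + H *m D = 0.
  have <- : P^T *m (X^T *m J + J *m X) *m P = D *m H + H *m D; last by rewrite XJ mulmx0 mul0mx.
  rewrite mulmxDr mulmxDl HE -!mulmxA XP !mulmxA -trmx_mul XP trmx_mul tr_diag_mx.
  by rewrite -!mulmxA.
have H0 i j : j != sg i -> H i j = 0.
  move=> ji; have := congr1 (fun A : 'M_m => A i j) DH.
  rewrite mul_diag_mx mul_mx_diag !mxE mulrC -mulrDr => /eqP; rewrite mulf_eq0 => /orP[/eqP //|].
  rewrite addr_eq0 -d_sg (inj_eq d_inj) => /eqP ij.
  by rewrite ij rev_ordK eqxx in ji.
have HU : H \in unitmx by rewrite HE !unitmx_mul unitmx_tr PU anti_mx_unit.
have HT : H^T = H by rewrite HE !trmx_mul trmxK anti_mxT mulmxA.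
pose g (i : 'I_m) : F := H i (sg i).
have g_sg i : g (sg i) = g i by rewrite /g rev_ordK -[in LHS]HT mxE.
have g0 i : g i != 0.
  apply: contraTneq HU => gi0; rewrite unitmxE (expand_det_row _ i) big1 ?unitr0 // => j _.
  by have [->|ji] := eqVneq j (sg i); [rewrite -/(g i) gi0 mul0r|rewrite H0 ?mul0r].
pose c (i : 'I_m) : F := if (i < l)%N then (g i)^-1 else if (sg i < l)%N then 1 else (sqrtC (g i))^-1.
have c_w k : c (so_w k) = (g (so_w k))^-1 by rewrite /c /= ltn_ord.
have c_rev k : c (sg (so_w k)) = 1.
  have kl := ltn_ord k; rewrite /c rev_ordK (kl : (so_w k < l)%N) ifN //= -leqNgt.
  by have := ltn_ord k; lia.
have cg i : c i * g i * c (sg i) = 1.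
  case: (mirror_cases i) => [[k ->]|[k ->]|[ii li]].
  - by rewrite c_w c_rev mulr1 mulVf.
  - by rewrite rev_ordK c_rev c_w g_sg mul1r mulfV.
  by rewrite ii /c ii ltnNge li /= mulrAC -invfM -expr2 sqrtCK mulVf.
pose C := diag_mx (\row_i c i).
have CU : C \in unitmx.
  rewrite unitmxE unitfE det_diag; apply/prodf_neq0 => i _; rewrite mxE.
  apply: contra_eq_neq (cg i) => ->; rewrite !mul0r eq_sym; exact: oner_neq0.
exists (P *m C); split; first by rewrite unitmx_mul PU.
  have -> : (P *m C)^T *m J *m (P *m C) = C *m H *m C by rewrite HE trmx_mul tr_diag_mx !mulmxA.
  rewrite mul_mx_diag mul_diag_mx; apply/matrixP => i j; rewrite !mxE.
  by have [->|ji] := eqVneq j (sg i); [rewrite cg|rewrite H0 // mulr0 mul0r].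
have CD : C *m D = D *m C.
  rewrite mul_mx_diag mul_diag_mx; apply/matrixP => i j; rewrite !mxE.
  by case: eqP => [->|_]; rewrite ?mulr0n ?mulr0 ?mul0r // mulrC.
have QU : P *m C \in unitmx by rewrite unitmx_mul PU.
by rewrite /adj -/D -(mulmxA P C) CD (mulmxA P) -XP -(mulmxA X) mulmxK.
Qed.

Lemma so_diagonalization (X : 'M[F]_m) : so_model X -> separable_poly (char_poly X) ->
  exists A (a : 'I_l -> F), [/\ so_group A, so_regular a & X = adj A (dm a)].
Proof.
move=> mX /(so_ordered_roots mX)[a ra aX].
have [P PU XP] := diagonalization (so_d_inj ra) aX.
have [Q [QU QJ XQ]] := so_rescale mX (so_d_inj ra) (so_d_rev a) PU XP.
have detQ : \det Q ^+ 2 = 1.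
  have JN0 : \det J != 0 by rewrite -unitfE -unitmxE anti_mx_unit.
  apply: (mulfI JN0); rewrite mulr1 -{2}QJ !det_mulmx det_tr; ring.
have /orP[/eqP Q1|/eqP Q1] : (\det Q == 1) || (\det Q == -1) by rewrite -sqrf_eq1 detQ.
  by exists Q, a.
(* Determinant -1 is repaired by passing to -Q when m is odd, and otherwise by exchanging one mirror
   pair of columns, which changes the sign of one parameter. *)
case: (boolP (odd m)) => om.
  exists (- Q), a; split=> //.
    split; first by rewrite mulmxN [(- Q)^T]linearN /= !mulNmx opprK.
    by rewrite -scaleN1r detZ Q1 -signr_odd om expr1 mulrNN mulr1.
  rewrite XQ /adj; have -> : invmx (- Q) = - invmx Q.
    by rewrite -scaleN1r invmxZ ?unitmxZ ?unitrN1 // invrN1 scaleN1r.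
  by rewrite mulmxN !mulNmx opprK.
have l_gt0 : (0 < l)%N by lia.
pose ep (k : 'I_l) := k == Ordinal l_gt0.
have [s [s_sg s_d s_odd]] := mirror_perm F 1%g ep.
have ra' := so_regular_sign 1%g ep ra.
have sV_sg i : (s^-1)%g (sg i) = sg ((s^-1)%g i).
  by apply: (@perm_inj _ s); rewrite permKV s_sg permKV.
exists (Q *m perm_mx s^-1), (fun k => (-1) ^+ ep k * a ((1%g : 'S_l) k)); split=> //.
  split.
    rewrite trmx_mul !mulmxA -(mulmxA _ Q^T) -(mulmxA _ (Q^T *m J)) QJ.
    exact: perm_mx_anti.
  rewrite det_mulmx Q1 det_perm odd_permV s_odd // (bigD1 (Ordinal l_gt0)) // big1.
    by rewrite [ep _]eqxx expr1 /= mulr1 mulrNN mulr1.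
  by move=> k /negPf k0; rewrite [ep _]k0.
have -> : \row_i so_d (fun k => (-1) ^+ ep k * a ((1%g : 'S_l) k)) i = \row_i so_d a (s i).
  by apply/rowP => i; rewrite !mxE s_d.
rewrite -(adj_perm_diag s (so_d a)) XQ.
have SU : (perm_mx s : 'M[F]_m) \in unitmx by apply: unitmx_perm.
have -> : perm_mx s^-1 = invmx (perm_mx s : 'M[F]_m).
  by rewrite -[LHS]mul1mx -(mulVmx SU) -mulmxA -perm_mxM mulgV perm_mx1 mulmx1.
move: (diag_mx _) (perm_mx s) SU => D S SU.
have TU : Q *m invmx S \in unitmx by rewrite unitmx_mul QU unitmx_inv.
suff E : adj Q D *m (Q *m invmx S) = Q *m invmx S *m adj S D by rewrite [RHS]/adj -E mulmxK.
by rewrite /adj !mulmxA mulmxKV // mulmxKV.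
Qed.

Lemma so_density (X : 'M[F]_m) : so_model X -> exists Z e,
  [/\ so_model Z, e != 0 :> {poly F} & forall t, e.[t] != 0 ->
    exists A (a : 'I_l -> F), [/\ so_group A, so_regular a & X + t *: Z = adj A (dm a)]].
Proof.
move=> mX; pose a0 (k : 'I_l) : F := k.+1%:R.
have mZ : so_model (dm a0 - X).
  by move=> i j; have := so_dm_model a0 i j; rewrite !mxE mX => ->; rewrite opprB opprK addrC.
have [e eP] := separable_line m_gt0 X (dm a0 - X).
exists (dm a0 - X), e; split=> // [|t].
  suff : e.[1] != 0 by apply: contraNneq => ->; rewrite horner0.
  rewrite eP scale1r addrC subrK char_poly_diag.
  rewrite -(big_map (so_d a0) predT (fun z => 'X - z%:P)) separable_prod_XsubC.
  by rewrite map_inj_uniq ?index_enum_uniq //; apply/so_d_inj/so_regular_nat.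
rewrite eP; apply: so_diagonalization => i j; move: (mZ i j) (mX i j).
by rewrite !mxE => -> ->; ring.
Qed.

End OrthogonalDensity.

Lemma map_pfaffian (R R' : comNzRingType) (f : {rmorphism R -> R'}) m (A : 'M[R]_m) :
  f (pfaffian A) = pfaffian (map_mx f A).
Proof.
rewrite rmorph_sum; apply: eq_bigr => s _; rewrite rmorphM rmorph_sign rmorph_prod.
by congr (_ * _); apply: eq_bigr => k _; rewrite mxE.
Qed.

Section OrthogonalInvariants.
Variables (F : numClosedFieldType) (m : nat).
Local Notation J := (anti_mx F m).
Local Notation l := m./2.
Local Notation dm a := (diag_mx (\row_i so_d a i)).

Lemma pfaffian_adj (A X : 'M[F]_m) : ~~ odd m -> so_group A ->
  pfaffian (J *m adj A X) = pfaffian (J *m X).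
Proof.
move=> m_even GA; have AU := so_group_unit GA; have [AJ A1] := GA.
have -> : J *m adj A X = (invmx A)^T *m (J *m X) *m invmx A.
  rewrite /adj !mulmxA; congr (_ *m _ *m _); rewrite trmx_inv -{2}AJ -(mulmxA A^T).
  by rewrite mulKmx // unitmx_tr.
by rewrite pfaffian_congr // det_inv A1 invr1 mul1r.
Qed.

(** The Pfaffian of J X is divided by its value at the parameters (1, ..., 1), so that it restricts
    to the product of the a_k. *)
Definition so_invariant (j : 'I_l) : {mpoly F[m * m]} :=
  if pf_index j then
    (pfaffian (J *m dm (fun=> 1)))^-1 *: pfaffian (map_mx (@mpolyC (m * m) F) J *m gen_mx F m)
  else (-1) ^+ j.+1 *: (char_poly (gen_mx F m))`_(m - j.+1.*2).

Lemma so_invariantE j (X : 'M[F]_m) : (so_invariant j).@[fun k => mxvec X 0 k] =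
  if pf_index j then (pfaffian (J *m dm (fun=> 1)))^-1 * pfaffian (J *m X)
  else (-1) ^+ j.+1 * (char_poly X)`_(m - j.+1.*2).
Proof.
rewrite /so_invariant; case: ifP => _; rewrite mevalZ ?meval_char_poly_coef //.
rewrite map_pfaffian map_mxM meval_gen_mx; congr (_ * pfaffian (_ *m _)).
apply/matrixP => i k; rewrite mxE [map_mx _ _ _ _]mxE; exact: mevalC.
Qed.

Lemma so_invariant_adj j (A X : 'M[F]_m) : so_group A ->
  (so_invariant j).@[fun k => mxvec (adj A X) 0 k] = (so_invariant j).@[fun k => mxvec X 0 k].
Proof.
move=> GA; rewrite !so_invariantE char_poly_adj ?so_group_unit //.
by case: ifP => // /andP[om _]; rewrite pfaffian_adj.
Qed.

Lemma so_invariant_dm j a : (so_invariant j).@[fun k => mxvec (dm a) 0 k] = (tnth (so_P F m) j).@[a].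
Proof.
rewrite so_invariantE so_PE so_char_poly_coef; case: ifP => // /andP[om _].
by rewrite (pfaffian_dm om a) mulrCA mulVf ?mulr1 // pfaffian_dm1_neq0.
Qed.

(** Reflection in the antidiagonal exchanges the positions on its two sides, and m positions lie on
    it. *)
Lemma card_so_pos : (#|so_pos m|.*2 + m = m * m)%N.
Proof.
have [f f_inj] : exists2 f : 'I_m * 'I_m -> 'I_m * 'I_m, injective f &
    forall p, f p = (rev_ord p.2, rev_ord p.1).
  exists (fun p => (rev_ord p.2, rev_ord p.1)) => //.
  by apply: inv_inj => -[i j]; rewrite /= !rev_ordK.
move=> fE; have := cardsC (so_pos m); rewrite card_prod !card_ord => <-.
rewrite -addnn -addnA; congr (_ + _)%N.
rewrite -[X in (X + _)%N](card_imset _ f_inj).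
rewrite -(cardsID (f @: so_pos m) (~: so_pos m)).
have fP p : (p \in f @: so_pos m) = (m < (p.1 + p.2).+1)%N.
  rewrite -rev_pos; apply/imsetP/idP => [[q qS ->]|pS].
    by rewrite fE !rev_ordK -surjective_pairing.
  by exists (rev_ord p.2, rev_ord p.1) => //; rewrite fE !rev_ordK -surjective_pairing.
congr (_ + _)%N.
  by apply: eq_card => p; rewrite !inE fP -leqNgt; move: (p.1 + p.2)%N => k; lia.
rewrite -{1}[m]card_ord -cardsT -(card_imset (f := fun i => (i, rev_ord i))) => [|i j []] //.
apply: eq_card => -[i j]; apply/imsetP/idP => [[k _ [-> ->]]|].
  by rewrite !inE fP /=; have := ltn_ord k; lia.
rewrite !inE fP /= => ij; exists i => //; congr (_, _); apply: val_inj => /=.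
by have := ltn_ord i; have := ltn_ord j; lia.
Qed.

End OrthogonalInvariants.

(** * Kostant's criterion for so(W), and the conclusion *)

Section OrthogonalKostant.
Variables (F : numClosedFieldType) (n : nat) (B : 'M[F]_n) (W : {vspace 'cV[F]_n}).
Hypotheses (BT : B^T = B) (BU : B \in unitmx).
Hypothesis (W_nondeg : (W :&: Defs.orthov B W = 0)%VS).
Local Notation m := (\dim W).
Local Notation g := (so_sub B W).
Local Notation S := (so_pos m).

Lemma so_nondeg : nondeg g.
Proof.
have [L [K [KL JK LW Lex]]] := isotropic_basis BT W_nondeg.
have gP x : x \in g <-> so_model (K *m x *m L) /\ x = emb L K (K *m x *m L).
  exact: so_sub_emb.
apply: (nondeg_model (model := @so_model F m) KL gP (nu := 2) (bas := @so_bas F m) (S := S)).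
- exact: so_decomp.
- by move=> i j _; split; apply: so_bas_model.
- exact: so_tr_bas.
by rewrite pnatr_eq0.
Qed.

Lemma so_lie x y : x \in g -> y \in g -> lie x y \in g.
Proof.
have [L [K [KL JK LW Lex]]] := isotropic_basis BT W_nondeg.
have gP z : z \in g <-> so_model (K *m z *m L) /\ z = emb L K (K *m z *m L).
  exact: so_sub_emb.
by apply: (lie_model (model := @so_model F m) KL gP); apply: so_model_lie.
Qed.

Lemma so_dim : (\dim g).*2 = (m * m - m)%N.
Proof.
have [L [K [KL JK LW Lex]]] := isotropic_basis BT W_nondeg.
have gP x : x \in g <-> so_model (K *m x *m L) /\ x = emb L K (K *m x *m L).
  exact: so_sub_emb.
have -> : \dim g = #|S|; last by rewrite -card_so_pos addnK.
apply: (@dim_model _ _ _ _ _ KL g _ S (@so_bas F m) gP _ _ _ _ (@so_w m)).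
- exact: so_decomp.
- by move=> i j _; split; apply: so_bas_model.
- exact: so_bas_coord.
- exact: so_w_inj.
- exact: so_w_pos.
exact: so_diag_pos.
Qed.

Lemma so_kostant_dim (psi : (m./2).-tuple (polyfun g)) : (0 < m)%N ->
  free_generators (SO_sub B W) psi -> kostant_property psi.
Proof.
move=> m_gt0; have [L [K [KL JK LW Lex]]] := isotropic_basis BT W_nondeg.
have gP x : x \in g <-> so_model (K *m x *m L) /\ x = emb L K (K *m x *m L).
  exact: so_sub_emb.
have GP s : SO_sub B W s <-> exists2 A, so_group A & s = gemb L K A.
  exact: SO_sub_gemb.
apply: (@kostant_model _ _ _ _ _ KL g _ _ _ S (@so_bas F m) 2 gP _ _ _ _ _ _
  _ (@so_w m) _ _ _ (@so_d F m) _ _ _ _ GP _ (@so_invariant F m) (so_P F m)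
  (@so_regular F m) (so_kappa F m)).
- exact: so_decomp.
- by move=> i j _; split; apply: so_bas_model.
- exact: so_bas_coord.
- exact: so_tr_bas.
- by rewrite pnatr_eq0.
- exact: so_model_lie.
- exact: so_w_inj.
- exact: so_w_pos.
- exact: so_diag_pos.
- exact: so_dm_eq.
- by move=> a i j _; apply: so_lie_dm_bas.
- exact: so_group_unit.
- exact: so_group_adj.
- exact: so_torus.
- by move=> j A X GA _; apply: so_invariant_adj.
- exact: so_invariant_dm.
- exact: so_kappa_neq0.
- exact: so_jacobian.
- exact: so_chevalley.
exact: so_density.
Qed.

End OrthogonalKostant.

Lemma so_kostant (F : numClosedFieldType) n (B : 'M[F]_n) (W : {vspace 'cV[F]_n}) m
    (psi : (m./2).-tuple (polyfun (so_sub B W))) : B^T = B -> B \in unitmx ->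
  (W :&: Defs.orthov B W = 0)%VS -> \dim W = m -> (0 < m)%N ->
  free_generators (SO_sub B W) psi -> kostant_property psi.
Proof. by move=> BT BU W0 dimW; case: _ / dimW psi => psi; apply: so_kostant_dim. Qed.

Lemma so_subS (F : numClosedFieldType) n (B : 'M[F]_n) (U W : {vspace 'cV[F]_n}) :
  (U <= W)%VS -> (so_sub B U <= so_sub B W)%VS.
Proof.
move=> /subvP UW; apply/subvP => x /mem_so_sub[xB xU]; apply/mem_so_sub; split=> // v.
by move=> /mem_orthov Wv; apply/xU/mem_orthov => u /UW; apply: Wv.
Qed.

Lemma gl_cornerS (F : fieldType) n i j : (i <= j)%N -> (gl_corner F n i <= gl_corner F n j)%VS.
Proof.
move=> ij; apply/subvP => x /mem_gl_corner x0; apply/mem_gl_corner => k l kl; apply: x0.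
by apply: contra kl => /andP[ki li]; rewrite !(leq_trans _ ij).
Qed.

Lemma sum_ranks_gl n : (0 < n)%N -> (n * n = (\sum_(1 <= i < n) i).*2 + n)%N.
Proof.
case: n => // n _; elim: n => [|n IHn]; first by rewrite big_geq.
by rewrite big_nat_recr //=; lia.
Qed.

Lemma sum_ranks_so n : (0 < n)%N ->
  (n * n - n = ((\sum_(1 <= i < n) i./2).*2 + n./2).*2)%N.
Proof.
case: n => // n _; elim: n => [|n IHn]; first by rewrite big_geq.
by rewrite big_nat_recr //=; lia.
Qed.

Theorem proposition4p12 (R : realType) (n : nat) (n_gt0 : (0 < n)%N) :
  (* g = gl(n, C) *)
  (let g := gl_corner R[i] n in
   forall psi : forall i : nat, i.-tuple (polyfun (g i)),
     (forall i : nat, (1 <= i <= n)%N ->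
        free_generators (@GL_corner R[i] n i) (psi i)) ->
   forall x : 'M[R[i]]_n, x \in g n ->
     strongly_regular (g := g) (r := id) psi x <->
     (forall i : nat, (1 <= i < n)%N ->
        (liecent (g i) (gz_proj g i x)
         :&: liecent (g i.+1) (gz_proj g i.+1 x) = 0)%VS))
  /\
  (* g = so(n, C) *)
  (forall (B : 'M[R[i]]_n) (V : nat -> {vspace 'cV[R[i]]_n}),
     B^T = B -> B \in unitmx -> nondegenerate_flag B V ->
   let g := fun i : nat => so_sub B (V i) in
   forall psi : forall i : nat, (i./2).-tuple (polyfun (g i)),
     (forall i : nat, (1 <= i <= n)%N ->
        free_generators (SO_sub B (V i)) (psi i)) ->
   forall x : 'M[R[i]]_n, x \in g n ->
     strongly_regular (g := g) (r := half) psi x <->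
     (forall i : nat, (1 <= i < n)%N ->
        (liecent (g i) (gz_proj g i x)
         :&: liecent (g i.+1) (gz_proj g i.+1 x) = 0)%VS)).
Proof.
split=> [g psi psiP x gx|B V BT BU [V_dim VS] g psi psiP x gx].
  apply: strongly_regular_iff => //.
  - by move=> i _; apply: gl_cornerS.
  - by move=> i /andP[_]; apply: gl_nondeg.
  - by move=> i /andP[_ iN] u v; apply: gl_lie.
  - by move=> i iN; have /andP[i1 i2] := iN; apply: gl_kostant (psiP i iN).
  (* The dimension condition of the chain argument: n^2 = 2 (1 + ... + (n - 1)) + n. *)
  by rewrite gl_dim // -sum_ranks_gl.
apply: strongly_regular_iff => //.
- by move=> i iN; apply/so_subS/VS.
- by move=> i /V_dim[_]; apply: so_nondeg.
- by move=> i /V_dim[_ Vi] u v; apply: so_lie.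
- move=> i iN; have [Vd Vi] := V_dim i iN; have /andP[i1 _] := iN.
  exact: so_kostant Vd i1 (psiP i iN).
have [|Vd Vn] := V_dim n; first by rewrite n_gt0 leqnn.
apply: double_inj; rewrite so_dim // Vd; exact: sum_ranks_so.
Qed.
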